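(* Let $\pi_M$ be an $\mathbb H_M$-module and $\pi=\mathbb H\otimes_{\mathbb H_M}\pi_M$. (a) For every irreducible representation $\widetilde\sigma$ of $\widetilde W$, $$\dim\operatorname{Hom}_{\widetilde W}[\widetilde\sigma,\pi\otimes\mathcal S]=\frac{\dim\mathcal S}{\dim\mathcal S_M}\,\dim\operatorname{Hom}_{\widetilde W_M}[\widetilde\sigma|_{\widetilde W_M},\pi_M\otimes\mathcal S_M].$$ (b) Assume that $R$ spans $V$, that $\pi_M$ is unitary and that the irreducible $\widetilde W_M$-representation $\widetilde\sigma_M$ occurs in $H^D(\pi_M)$. If there exists an irreducible genuine $\widetilde W$-representation $\widetilde\sigma$ such that (i) $\operatorname{Hom}_{\widetilde W_M}[\widetilde\sigma_M,\widetilde\sigma]\ne0$, and (ii) if $\Psi(\widetilde\sigma)=[(e,h,f)]$, then the central character of $\pi$ is $\chi_{\frac12h}$, then $\widetilde\sigma$ occurs in $H^D(\pi)$.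
   Context: Root data: $\Phi=(V,R,V^\vee,R^\vee)$ is a reduced crystallographic real root system ($V,V^\vee$ finite-dimensional real vector spaces in perfect pairing $(\ ,\ )$, coroots $\alpha\leftrightarrow\alpha^\vee$), with Weyl group $W$, simple roots $\Pi$, positive roots $R^+$, and a fixed $W$-invariant inner product $\langle\ ,\ \rangle$ on $V$ with dual inner product on $V^\vee$; $|v|=\langle v,v\rangle^{1/2}$. $V_{\mathbb C},V_{\mathbb C}^\vee$ are complexifications. $\mathbb H=S(V_{\mathbb C})\otimes\mathbb C[W]$ as a vector space, with $S(V_{\mathbb C}),\mathbb C[W]$ as subalgebras and $s_\alpha\cdot\xi-s_\alpha(\xi)\cdot s_\alpha=(\xi,\alpha^\vee)$ for $\alpha\in\Pi$, $\xi\in V_{\mathbb C}$. Its center is $S(V_{\mathbb C})^W$; a module has central character $\chi_\nu$, $\nu\in V_{\mathbb C}^\vee$, if each $p\in S(V_{\mathbb C})^W$ acts by $p(\nu)$. The conjugate-linear anti-involution $*$ is $w^*=w^{-1}$ for $w\in W$, $\omega^*=-\omega+\sum_{\beta>0}(\omega,\beta^\vee)s_\beta$ for $\omega\in V$; a module is unitary if it has a positive definite Hermitian form with $(\pi(h)x,y)=(x,\pi(h^* )y)$. Subsystem: $(V_M,R_M,V_M^\vee,R_M^\vee)$ is a root subsystem with $V_M\subset V$, with simple roots $\Pi_M\subset\Pi$, positive roots $R_M^+=R_M\cap R^+$, and Weyl group $W_M=\langle s_\alpha:\alpha\in\Pi_M\rangle\subset W$. $\mathbb H_M$ is the subalgebra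 of $\mathbb H$ generated by $S(V_{\mathbb C})$ and $\mathbb C[W_M]$; its anti-involution (used for unitarity) is given by the same formulas with the sum over $\beta\in R_M^+$. Clifford algebra: $C(V)$ is generated by $V$ with $\omega\omega'+\omega'\omega=-2\langle\omega,\omega'\rangle$. Let $\epsilon$ be the grading automorphism ($-1$ on $V$), ${}^t$ the anti-automorphism with $\omega^t=-\omega$ on $V$, $\mathsf{Pin}(V)=\{a\in C(V):\epsilon(a)Va^{-1}\subset V,\ a^t=a^{-1}\}$, and $p:\mathsf{Pin}(V)\to\mathsf O(V)$, $p(a)\omega=\epsilon(a)\omega a^{-1}$, a double cover. $\widetilde W=p^{-1}(W)$, with central element $z=-1$; put $\widetilde s_\alpha=\alpha/|\alpha|\in\widetilde W$ for $\alpha\in R^+$. A representation of $\widetilde W$ is genuine if $z$ acts by $-1$. $\widetilde W_M=p^{-1}(W_M)$, which is identified with the preimage of $W_M$ in $\mathsf{Pin}(V_M)$. $\mathcal S$ is the simple complex $C(V)$-module $S$ if $\dim V$ is even, and $\mathcal S=S^+\oplus S^-$, the sum of the two inequivalent simple complex $C(V)$-modules, if $\dim V$ is odd; $\mathcal S_M$ is defined in the same way for $C(V_M)$. $\widetilde W$ acts on $\mathcal S$ via $\mathsf{Pin}(V)\subset C(V)$ and on $\mathbb H$-modules via $p$; similarly for $\widetilde W_M$. Dirac cohomology: for $\omega\in V$ put $\widetilde\omega=\omega-\frac12\sum_{\beta>0}(\omega,\beta^\vee)s_\beta$; for dual bases $\{\omega_i\},\{\omega^i\}$ of $V$, $D$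 is the action of $\sum_i\widetilde\omega_i\otimes\omega^i\in\mathbb H\otimes C(V)$ on $\pi\otimes\mathcal S$, and $H^D(\pi)=\ker D/(\ker D\cap\operatorname{Im}D)$, a $\widetilde W$-representation. $H^D(\pi_M)$ is defined in the same way with $V_M,R_M^+,C(V_M),\mathcal S_M$ in place of $V,R^+,C(V),\mathcal S$. The map $\Psi$ (when $R$ spans $V$): let $\mathfrak g$ be the complex semisimple Lie algebra with root system $\Phi$ and Cartan subalgebra $\mathfrak h=V_{\mathbb C}^\vee$, $G$ the simply connected group with Lie algebra $\mathfrak g$, and $\mathcal T_0(G)$ the set of $G$-conjugacy classes of Jacobson–Morozov triples $(e,h,f)$ in $\mathfrak g$ whose centralizer in $\mathfrak g$ is toral, with representatives chosen so that $h\in\mathfrak h$. Let $\Omega_{\widetilde W}=z\sum_{\alpha>0,\beta>0,\,s_\alpha(\beta)<0}|\alpha^\vee||\beta^\vee|\,\widetilde s_\alpha\widetilde s_\beta\in\mathbb C[\widetilde W]^{\widetilde W}$, which acts on each irreducible $\widetilde\sigma$ by a scalar $\widetilde\sigma(\Omega_{\widetilde W})$. $\Psi$ is the known surjective map from the set of irreducible genuine $\widetilde W$-representations to $\mathcal T_0(G)$ with: (1) if $\Psi(\widetilde\sigma)=[(e,h,f)]$ then $\widetilde\sigma(\Omega_{\widetilde W})=\langle h,h\rangle$; (2) for every $[(e,h,f)]\in\mathcal T_0(G)$, every Springer representation $\sigma_{(e,\phi)}$ of $W$ (Springer correspondence normalized so that $\sigma_{(0,\mathrm{triv})}=\mathrm{sgn}$)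 and every simple $C(V)$-module $S$, some $\widetilde\sigma\in\Psi^{-1}[(e,h,f)]$ occurs in $\sigma_{(e,\phi)}\otimes S$, and conversely every $\widetilde\sigma\in\Psi^{-1}[(e,h,f)]$ occurs in some such $\sigma_{(e,\phi)}\otimes S$. *)

(* Defs.v *)
From HB Require Import structures.
From mathcomp Require Import all_boot all_order all_algebra.
From mathcomp Require Import reals complex mpoly.

Set Implicit Arguments.
Unset Strict Implicit.
Unset Printing Implicit Defensive.

Import Order.TTheory GRing.Theory Num.Theory.
Local Open Scope ring_scope.
Local Open Scope complex_scope.

Notation bas V i := ((vbasis {:V})`_i).
Notation crd V i v := (coord (vbasis {:V}) i v).

(* U tensor S for S finite-dimensional: the family x stands for
   \sum_j x j (x) (bas S j). *)
Notation tens U S := {ffun 'I_(\dim {:S}) -> U}.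

Section Modules.
Variable F : fieldType.

(* In this section K is an index type and G : K -> Prop selects the acting
   elements; the values of an action outside G are irrelevant. *)

Definition irreducible_act (K : Type) (G : K -> Prop) (U : vectType F)
    (a : K -> 'End(U)) : Prop :=
  (0 < \dim {:U})%N /\
  forall X : {vspace U},
    (forall k, G k -> (a k @: X <= X)%VS) -> X = 0%VS \/ X = fullv.

Definition intertwiner (K : Type) (G : K -> Prop) (U T : lmodType F)
    (aU : K -> U -> U) (aT : K -> T -> T) (f : U -> T) : Prop :=
  linear f /\ forall k, G k -> forall x, f (aU k x) = aT k (f x).

Definition hom_neq0 (K : Type) (G : K -> Prop) (U T : lmodType F)
    (aU : K -> U -> U) (aT : K -> T -> T) : Prop :=
  exists2 f, intertwiner G aU aT f & exists x, f x != 0.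

Definition isomorphic_act (K : Type) (G : K -> Prop) (U T : lmodType F)
    (aU : K -> U -> U) (aT : K -> T -> T) : Prop :=
  exists2 f, intertwiner G aU aT f & bijective f.

(* A homomorphism into the subquotient X/Y of T is given by a linear lift to X
   which is equivariant modulo Y; it is nonzero when some value is not in Y. *)
Definition occurs_in_subquotient (K : Type) (G : K -> Prop)
    (U T : lmodType F) (aU : K -> U -> U) (aT : K -> T -> T)
    (X Y : T -> Prop) : Prop :=
  exists f : U -> T,
    [/\ linear f, forall x, X (f x),
        forall k, G k -> forall x, Y (f (aU k x) - aT k (f x))
      & exists x, ~ Y (f x)].

(* The space P of maps U -> T has a basis indexed by J, i.e. \dim P is the
   cardinal of J. *)
Definition has_dim (U T : lmodType F) (P : (U -> T) -> Prop) (J : Type) :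
    Prop :=
  exists b : J -> U -> T,
    [/\ forall j, P (b j),
        forall f, P f -> exists (n : nat) (j : 'I_n -> J) (c : 'I_n -> F),
          forall x, f x = \sum_i c i *: b (j i) x
      & forall (n : nat) (j : 'I_n -> J) (c : 'I_n -> F), injective j ->
          (forall x, \sum_i c i *: b (j i) x = 0) -> forall i, c i = 0].

Definition pure (U : lmodType F) (S : vectType F) (u : U) (s : S) :
    tens U S := [ffun i => crd S i s *: u].

(* f (x) g, computed on the basis of S *)
Definition tmap (U : lmodType F) (S : vectType F) (f : U -> U) (g : S -> S)
    (x : tens U S) : tens U S :=
  \sum_j pure (f (x j)) (g (bas S j)).

(* U is a module over the subalgebra A of H *)
Definition is_module (H : algType F) (A : H -> Prop) (U : lmodType F)
    (act : H -> U -> U) : Prop :=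
  [/\ forall h, A h -> linear (act h),
      forall x, act 1 x = x,
      forall h h', A h -> A h' -> forall x, act (h * h') x = act h (act h' x)
    & forall c h h', A h -> A h' -> forall x,
        act (c *: h + h') x = c *: act h x + act h' x].

(* A map H x U -> T' which is bilinear and balanced over the subalgebra A *)
Definition balanced (H : algType F) (A : H -> Prop) (U T' : lmodType F)
    (act : H -> U -> U) (f : H -> U -> T') : Prop :=
  [/\ forall h, linear (f h), forall x, linear (f^~ x)
    & forall h m x, A m -> f (h * m) x = f h (act m x)].

(* (T, tau) is H \otimes_A U, with H acting on the left factor *)
Definition is_induced (H : algType F) (A : H -> Prop) (U T : lmodType F)
    (actU : H -> U -> U) (actT : H -> T -> T) (tau : H -> U -> T) : Prop :=
  [/\ is_module (fun=> True) actT,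
      balanced A actU tau,
      forall h h' x, actT h (tau h' x) = tau (h * h') x,
      forall (T' : lmodType F) (f : H -> U -> T'), balanced A actU f ->
        exists2 g : T -> T', linear g & forall h x, g (tau h x) = f h x
    & forall (T' : lmodType F) (g g' : T -> T'), linear g -> linear g' ->
        (forall h x, g (tau h x) = g' (tau h x)) -> g =1 g'].

End Modules.

(* The complexification of V, in coordinates on a fixed basis. *)
Notation cplx R V := ('rV[R[i]]_(\dim {:V})).

Definition emb (R : realType) (V : vectType R) (v : V) : cplx R V :=
  \row_i (crd V i v)%:C.

Section Roots.
Variables (R : realType) (V Vd : vectType R).
Variables (pr : V -> Vd -> R) (cor : V -> Vd).

Definition refl (a : V) : 'End(V) :=
  linfun (fun v => v - pr v (cor a) *: a).
Definition corefl (a : V) : 'End(Vd) :=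
  linfun (fun y => y - pr a y *: cor a).

Definition perfect_on (X : {vspace V}) (Y : {vspace Vd}) : Prop :=
  (forall x, x \in X -> (forall y, y \in Y -> pr x y = 0) -> x = 0) /\
  (forall y, y \in Y -> (forall x, x \in X -> pr x y = 0) -> y = 0).

Definition root_system (Phi : seq V) : Prop :=
  [/\ uniq Phi /\ {in Phi &, injective cor},
      {in Phi, forall a, pr a (cor a) = 2},
      {in Phi &, forall a b, refl a b \in Phi
                             /\ corefl a (cor b) \in map cor Phi},
      {in Phi &, forall a b, pr a (cor b) \is a Num.int}
    & {in Phi, forall a, a *+ 2 \notin Phi}].

(* for Pi free and a in its span: the coordinates of a on Pi are >= 0 *)
Definition nonneg (Pi : seq V) (a : V) : bool :=
  [forall i : 'I_(size Pi), 0 <= coord (in_tuple Pi) i a].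

Definition is_base (Phi Pi : seq V) : Prop :=
  [/\ free Pi, {subset Pi <= Phi}
    & {in Phi, forall a, [/\ a \in <<Pi>>%VS,
         forall i : 'I_(size Pi), coord (in_tuple Pi) i a \is a Num.int
       & nonneg Pi a || nonneg Pi (- a)]}].

Inductive refl_group (A : seq V) : 'End(V) -> Prop :=
| refl_group1 : refl_group A \1%VF
| refl_groupM a g :
    a \in A -> refl_group A g -> refl_group A (refl a \o g)%VF.

Definition pairC (x : cplx R V) (y : cplx R Vd) : R[i] :=
  \sum_i \sum_j x 0 i * y 0 j * (pr (bas V i) (bas Vd j))%:C.

End Roots.

Record rootData (R : realType) := RootData {
  rV : vectType R;
  rVd : vectType R;
  pr : rV -> rVd -> R;
  allroots : seq rV;
  cor : rV -> rVd;
  simples : seq rV;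
  ip : rV -> rV -> R;
  (* the identification of rVd with rV through ip *)
  sharp : rVd -> rV;
  (* an enumeration of the Weyl group *)
  weyl : seq 'End(rV);
  pr_scalarl : forall y, scalar (pr^~ y);
  pr_scalarr : forall x, scalar (pr x);
  pr_perfect : perfect_on pr fullv fullv;
  roots_system : root_system pr cor allroots;
  simples_base : is_base allroots simples;
  ip_scalar : forall x, scalar (ip x);
  ip_sym : forall x y, ip x y = ip y x;
  ip_pos : forall x, x != 0 -> 0 < ip x x;
  ip_inv : {in allroots, forall a x y,
    ip (refl pr cor a x) (refl pr cor a y) = ip x y};
  sharpP : forall x y, ip x (sharp y) = pr x y;
  weyl_uniq : uniq weyl;
  weylP : forall g, g \in weyl <-> refl_group pr cor allroots g }.

Section RootData.
Variables (R : realType) (X : rootData R).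
Notation V := (rV X).
Notation Vd := (rVd X).

Definition srefl (a : V) : 'End(V) := refl (@pr R X) (@cor R X) a.
Definition posroots : seq V := [seq a <- allroots X | nonneg (simples X) a].

Definition ipd (y y' : Vd) : R := ip (sharp y) (sharp y').
Definition norm (v : V) : R := Num.sqrt (ip v v).
Definition normd (y : Vd) : R := Num.sqrt (ipd y y).

Definition pC : cplx R V -> cplx R Vd -> R[i] := pairC (@pr R X).
Definition ipdC (y y' : cplx R Vd) : R[i] :=
  \sum_i \sum_j y 0 i * y' 0 j * (ipd (bas Vd i) (bas Vd j))%:C.

Definition symV := {mpoly R[i][\dim {:V}]}.
Definition linC (x : cplx R V) : symV := \sum_i x 0 i *: 'X_i.
Definition wact (w : 'End(V)) (p : symV) : symV :=
  p \mPo [tuple linC (emb (w (bas V i))) | i < \dim {:V}].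
Definition evalC (p : symV) (nu : cplx R Vd) : R[i] :=
  p.@[fun i => pC (emb (bas V i)) nu].

End RootData.

Record hecke (R : realType) (X : rootData R) := Hecke {
  hA :> algType R[i];
  hS : {lrmorphism {mpoly R[i][\dim {:rV X}]} -> hA};
  hW : 'End(rV X) -> hA;
  hW1 : hW \1%VF = 1;
  hWM : {in weyl X &, forall w w', hW (w \o w')%VF = hW w * hW w'};
  h_span : forall h : hA, exists p : 'End(rV X) -> symV X,
    h = \sum_(w <- weyl X) hS (p w) * hW w;
  h_free : forall p : 'End(rV X) -> symV X,
    \sum_(w <- weyl X) hS (p w) * hW w = 0 -> {in weyl X, forall w, p w = 0};
  h_cross : {in simples X, forall a x,
    hW (srefl a) * hS (linC x) - hS (wact (srefl a) (linC x)) * hW (srefl a)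
    = (pC x (emb (cor a)))%:A } }.

Section Hecke.
Variables (R : realType) (X : rootData R) (H : hecke X).
Notation V := (rV X).

Inductive hecke_sub (WM : 'End(V) -> Prop) : H -> Prop :=
| hecke_subS p : hecke_sub WM (hS H p)
| hecke_subW w : WM w -> hecke_sub WM (hW H w)
| hecke_subD h h' : hecke_sub WM h -> hecke_sub WM h' -> hecke_sub WM (h + h')
| hecke_subM h h' : hecke_sub WM h -> hecke_sub WM h' -> hecke_sub WM (h * h').

(* the anti-involution of the subalgebra generated by S(V_C) and WM, where pos
   is the set of positive roots attached to WM *)
Definition is_star (WM : 'End(V) -> Prop) (pos : seq V) (star : H -> H) :
    Prop :=
  let A := hecke_sub WM in
  [/\ forall h, A h -> A (star h) /\ star (star h) = h,
      forall c h h', A h -> A h' ->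
        star (c *: h + h') = (c^*)%R *: star h + star h',
      forall h h', A h -> A h' -> star (h * h') = star h' * star h,
      forall w, WM w -> star (hW H w) = hW H (w^-1)%VF
    & forall v : V, star (hS H (linC (emb v))) = - hS H (linC (emb v))
        + \sum_(b <- pos) (pr v (cor b))%:C *: hW H (srefl b)].

Definition unitary (WM : 'End(V) -> Prop) (pos : seq V) (U : lmodType R[i])
    (act : H -> U -> U) : Prop :=
  exists (star : H -> H) (form : U -> U -> R[i]),
    [/\ is_star WM pos star,
        forall y, scalar (form^~ y),
        forall x y, form y x = (form x y)^*%R,
        forall x, x != 0 -> 0 < form x x
      & forall h, hecke_sub WM h ->
          forall x y, form (act h x) y = form x (act (star h) y)].

Definition central_char (U : lmodType R[i]) (act : H -> U -> U)
    (nu : cplx R (rVd X)) : Prop :=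
  forall p : symV X, {in weyl X, forall w, wact w p = p} ->
    forall x, act (hS H p) x = evalC p nu *: x.

Definition wtilde (pos : seq V) (v : V) : H :=
  hS H (linC (emb v))
  - 2^-1 *: \sum_(b <- pos) (pr v (cor b))%:C *: hW H (srefl b).

End Hecke.

Record clifford (R : realType) (V : vectType R) (q : V -> V -> R) :=
  Clifford {
  clA :> algType R;
  gam : {linear V -> clA};
  gam_rel : forall x y, gam x * gam y + gam y * gam x = (- 2 * q x y)%:A;
  cl_ext : forall (B : algType R) (f : {linear V -> B}),
    (forall x y, f x * f y + f y * f x = (- 2 * q x y)%:A) ->
    exists g : {lrmorphism clA -> B}, forall v, g (gam v) = f v;
  cl_uniq : forall (B : algType R) (g g' : {lrmorphism clA -> B}),
    (forall v, g (gam v) = g' (gam v)) -> g =1 g';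
  eps : {lrmorphism clA -> clA};
  epsE : forall v, eps (gam v) = - gam v;
  tr : {linear clA -> clA};
  tr1 : tr 1 = 1;
  trM : forall a b, tr (a * b) = tr b * tr a;
  trE : forall v, tr (gam v) = - gam v }.

Section Clifford.
Variables (R : realType) (V : vectType R) (q : V -> V -> R).
Variable (A : clifford q).

Definition pin (a : A) : Prop :=
  [/\ a * tr A a = 1, tr A a * a = 1
    & forall v, exists v', eps A a * gam A v * tr A a = gam A v'].

Definition cl_module (S : vectType R[i]) (rho : A -> 'End(S)) : Prop :=
  [/\ rho 1 = \1%VF, forall a b, rho (a * b) = (rho a \o rho b)%VF
    & forall r a b, rho (r *: a + b) = r%:C *: rho a + rho b].

Definition cl_simple (S : vectType R[i]) (rho : A -> 'End(S)) : Prop :=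
  cl_module rho /\ irreducible_act (fun=> True) rho.

Definition is_spinor (S : vectType R[i]) (rho : A -> 'End(S)) : Prop :=
  if ~~ odd (\dim {:V}) then cl_simple rho else
  cl_module rho /\
  exists (S1 S2 : vectType R[i]) (r1 : A -> 'End(S1)) (r2 : A -> 'End(S2))
         (f1 : 'Hom(S1, S)) (f2 : 'Hom(S2, S)),
    [/\ cl_simple r1, cl_simple r2,
        ~ isomorphic_act (fun=> True) (fun a => r1 a : _ -> _)
            (fun a => r2 a : _ -> _),
        (forall a x, f1 (r1 a x) = rho a (f1 x)) /\
        (forall a x, f2 (r2 a x) = rho a (f2 x))
      & bijective (fun x : S1 * S2 => f1 x.1 + f2 x.2)].

Definition dual_bases (n : nat) (b b' : 'I_n -> V) : Prop :=
  [/\ basis_of fullv (codom b), basis_of fullv (codom b')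
    & forall i j, q (b i) (b' j) = (i == j)%:R].

End Clifford.

Section Spin.
Variables (R : realType) (X : rootData R) (H : hecke X).
Variable Cl : clifford (@ip R X).
Notation V := (rV X).

(* W~ as the set of pairs (a, p(a)) with a in Pin(V) and p(a) in W *)
Definition Wt (k : Cl * 'End(V)) : Prop :=
  [/\ pin k.1, k.2 \in weyl X
    & forall v, eps Cl k.1 * gam Cl v * tr Cl k.1 = gam Cl (k.2 v)].

Definition stilde (a : V) : Cl := (norm a)^-1 *: gam Cl a.

Definition spin_irrep (U : vectType R[i]) (s : Cl -> 'End(U)) : Prop :=
  [/\ s 1 = \1%VF,
      forall k k', Wt k -> Wt k' -> s (k.1 * k'.1) = (s k.1 \o s k'.1)%VF
    & irreducible_act Wt (fun k => s k.1)].

Definition genuine (U : vectType R[i]) (s : Cl -> 'End(U)) : Prop :=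
  forall x, s (- 1) x = - x.

Definition Omega (U : vectType R[i]) (s : Cl -> 'End(U)) (x : U) : U :=
  \sum_(a <- posroots X)
   \sum_(b <- posroots X | nonneg (simples X) (- srefl a b))
     (normd (cor a) * normd (cor b))%:C *: s (- 1 * (stilde a * stilde b)) x.

Definition spin_act (U : lmodType R[i]) (act : H -> U -> U)
    (S : vectType R[i]) (rho : Cl -> 'End(S)) (k : Cl * 'End(V)) :
    tens U S -> tens U S :=
  tmap (act (hW H k.2)) (rho k.1).

Definition dirac (U : lmodType R[i]) (act : H -> U -> U)
    (S : vectType R[i]) (rho : Cl -> 'End(S)) (n : nat) (b b' : 'I_n -> V)
    (x : tens U S) : tens U S :=
  \sum_i tmap (act (wtilde H (posroots X) (b i))) (rho (gam Cl (b' i))) x.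

Definition occurs_in_HD (W : vectType R[i]) (s : Cl -> 'End(W))
    (U : lmodType R[i]) (act : H -> U -> U)
    (S : vectType R[i]) (rho : Cl -> 'End(S)) (n : nat) (b b' : 'I_n -> V) :
    Prop :=
  let D := dirac act rho b b' in
  occurs_in_subquotient Wt (fun k => s k.1 : _ -> _) (spin_act act rho)
    (fun x => D x = 0) (fun x => D x = 0 /\ exists y, x = D y).

End Spin.

Record subsystem (R : realType) (X : rootData R) := Subsystem {
  VM : {vspace (rV X)};
  VMd : {vspace (rVd X)};
  rootsM : seq (rV X);
  simplesM : seq (rV X);
  M_perfect : perfect_on (@pr R X) VM VMd;
  M_root_system : root_system (@pr R X) (@cor R X) rootsM;
  M_roots : {subset rootsM <= allroots X};
  M_rootsV : {subset rootsM <= VM};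
  M_corootsV : {in rootsM, forall a, cor a \in VMd};
  M_base : is_base rootsM simplesM;
  M_simples : {subset simplesM <= simples X} }.

Section SpinM.
Variables (R : realType) (X : rootData R) (H : hecke X) (M : subsystem X).
Notation V := (rV X).

Definition posrootsM : seq V := [seq a <- rootsM M | nonneg (simples X) a].
Definition WM : 'End(V) -> Prop :=
  refl_group (@pr R X) (@cor R X) (simplesM M).
Definition ipM (x y : subvs_of (VM M)) : R := ip (vsval x) (vsval y).

Variable ClM : clifford ipM.

(* W~_M, as the preimage of W_M in Pin(V_M); an element of W_M is determined by
   its restriction to V_M, which contains the roots of the subsystem. *)
Definition WtM (k : ClM * 'End(V)) : Prop :=
  [/\ pin k.1, WM k.2
    & forall v, eps ClM k.1 * gam ClM v * tr ClM k.1
                = gam ClM (vsproj (VM M) (k.2 (vsval v)))].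

Definition spin_irrepM (U : vectType R[i]) (s : ClM -> 'End(U)) : Prop :=
  [/\ s 1 = \1%VF,
      forall k k', WtM k -> WtM k' -> s (k.1 * k'.1) = (s k.1 \o s k'.1)%VF
    & irreducible_act WtM (fun k => s k.1)].

Definition spin_actM (U : lmodType R[i]) (act : H -> U -> U)
    (S : vectType R[i]) (rho : ClM -> 'End(S)) (k : ClM * 'End(V)) :
    tens U S -> tens U S :=
  tmap (act (hW H k.2)) (rho k.1).

Definition diracM (U : lmodType R[i]) (act : H -> U -> U)
    (S : vectType R[i]) (rho : ClM -> 'End(S)) (n : nat)
    (b b' : 'I_n -> subvs_of (VM M)) (x : tens U S) : tens U S :=
  \sum_i tmap (act (wtilde H posrootsM (vsval (b i)))) (rho (gam ClM (b' i))) x.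

Definition occurs_in_HDM (W : vectType R[i]) (s : ClM -> 'End(W))
    (U : lmodType R[i]) (act : H -> U -> U)
    (S : vectType R[i]) (rho : ClM -> 'End(S)) (n : nat)
    (b b' : 'I_n -> subvs_of (VM M)) : Prop :=
  let D := diracM act rho b b' in
  occurs_in_subquotient WtM (fun k => s k.1 : _ -> _) (spin_actM act rho)
    (fun x => D x = 0) (fun x => D x = 0 /\ exists y, x = D y).

End SpinM.

(* A complex semisimple Lie algebra with Cartan subalgebra V_C^\vee and root
   system X *)
Record lieAlg (R : realType) (X : rootData R) := LieAlg {
  lg :> vectType R[i];
  br : lg -> lg -> lg;
  br_linear : forall x, linear (br x);
  br_alt : forall x, br x x = 0;
  br_jacobi : forall x y z,
    br x (br y z) + br y (br z x) + br z (br x y) = 0;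
  lg_semisimple : forall I : {vspace lg},
    (forall x y, y \in I -> br x y \in I) ->
    (forall x y, x \in I -> y \in I -> br x y = 0) -> I = 0%VS;
  ih : {linear cplx R (rVd X) -> lg};
  ih_inj : injective ih;
  ih_abelian : forall t t', br (ih t) (ih t') = 0;
  ih_centralizer : forall x, (forall t, br (ih t) x = 0) -> exists t, x = ih t;
  ih_diag : forall x, exists (n : nat) (v : 'I_n -> lg)
      (l : 'I_n -> cplx R (rV X)),
    x = \sum_i v i /\ forall i t, br (ih t) (v i) = pC (l i) t *: v i;
  ih_roots : forall l : cplx R (rV X), l != 0 ->
    ((exists2 x, x != 0 & forall t, br (ih t) x = pC l t *: x)
     <-> l \in map (@emb R (rV X)) (allroots X));
  ih_coroots : {in allroots X, forall a, exists x y : lg,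
    [/\ forall t, br (ih t) x = pC (emb a) t *: x,
        forall t, br (ih t) y = - pC (emb a) t *: y
      & br x y = ih (emb (cor a))]} }.

Section Lie.
Variables (R : realType) (X : rootData R) (g : lieAlg X).
Notation C := R[i].
Notation V := (rV X).
Notation hC := (cplx R (rVd X)).

(* The group of inner automorphisms, generated by the exp (ad x) with ad x
   nilpotent: the image of the simply connected group G in Aut(g). *)
Definition expad (x y : g) : g :=
  \sum_(k < (\dim {:g}).+1) (k`!%:R)^-1 *: iter k (br x) y.

Inductive inner : (g -> g) -> Prop :=
| inner1 : inner id
| innerM x phi : (forall y, iter (\dim {:g}) (br x) y = 0) ->
    inner phi -> inner (expad x \o phi).

Definition conj_triple (e : g) (h : hC) (f : g) (e' : g) (h' : hC) (f' : g) :
    Prop :=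
  exists2 phi, inner phi &
    [/\ phi e = e', phi (ih g h) = ih g h' & phi f = f'].

Definition ad_semisimple (z : g) : Prop :=
  forall y, exists (n : nat) (v : 'I_n -> g) (c : 'I_n -> C),
    y = \sum_i v i /\ forall i, br z (v i) = c i *: v i.

(* (e, h, f) represents an element of T_0(G) *)
Definition T0 (e : g) (h : hC) (f : g) : Prop :=
  [/\ br (ih g h) e = e *+ 2, br (ih g h) f = - (f *+ 2), br e f = ih g h
    & forall z, br z e = 0 -> br z (ih g h) = 0 -> br z f = 0 ->
        ad_semisimple z].

(* The Springer correspondence, in the Harish-Chandra / Hotta-Kashiwara form.
   Let tau be an irreducible representation of W and P a nonzero polynomial on
   h = V_C^\vee in a copy of tau.  Near a regular t in h there is a unique
   g-invariant holomorphic function F on g with restriction P / Delta to h,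
   Delta being the product of the positive roots.  It generates a D-module on g
   whose Fourier transform is supported on the closure of one nilpotent orbit,
   the Springer orbit of tau; this support is the zero set of the ideal of the
   q in S(g) with q(partial) F = 0.  The representations with Springer orbit
   G.e are the sigma_(e,phi), for varying phi.  For P = Delta one gets F = 1,
   so that sgn corresponds to e = 0.

   The germ F is encoded by the functional L : q |-> (q(partial) F)(t) on
   S(g). *)
Definition symg := {mpoly C[\dim {:g}]}.
Definition ling (y : g) : symg := \sum_i crd g i y *: 'X_i.

(* the derivation of S(g) extending ad u *)
Definition adS (u : g) (q : symg) : symg :=
  \sum_(i < \dim {:g}) ling (br u (bas g i)) * q^`M(i).

(* the polynomials P(t + s y) and Delta(t + s y) in s *)
Definition lineP (P : symV X) (t y : hC) : {poly C} :=
  mmap (@polyC C)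
    (fun i => (pC (emb (bas V i)) t)%:P + pC (emb (bas V i)) y *: 'X) P.
Definition lineDelta (t y : hC) : {poly C} :=
  \prod_(a <- posroots X) ((pC (emb a) t)%:P + pC (emb a) y *: 'X).

(* The second condition is the invariance of F: the vector field x |-> [u, x]
   annihilates F.  The third is Delta F = P along the lines t + s y in h. *)
Definition is_germ (t : hC) (P : symV X) (L : symg -> C) : Prop :=
  [/\ scalar L,
      forall u q, L (ling (br u (ih g t)) * q + adS u q) = 0
    & forall (y : hC) (k : nat),
        \sum_(i < k.+1) (lineDelta t y)`_i
           * (((k - i)`!)%:R^-1 * L (ling (ih g y) ^+ (k - i)))
        = (lineP P t y)`_k].

Definition killing (x y : g) : C :=
  \sum_(i < \dim {:g}) crd g i (br x (br y (bas g i))).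

(* evaluation of q in S(g) at the element of g^* given by x *)
Definition evalg (q : symg) (x : g) : C := q.@[fun i => killing x (bas g i)].

Definition w_irrep (U : vectType C) (tau : 'End(V) -> 'End(U)) : Prop :=
  [/\ tau \1%VF = \1%VF,
      {in weyl X &, forall w w', tau (w \o w')%VF = (tau w \o tau w')%VF}
    & irreducible_act (fun w => w \in weyl X) tau].

(* tau is one of the Springer representations sigma_(e,phi) *)
Definition springer (e : g) (U : vectType C) (tau : 'End(V) -> 'End(U)) :
    Prop :=
  w_irrep tau /\
  exists (t : hC) (phi : U -> symV X) (v : U) (L : symg -> C),
    [/\ {in allroots X, forall a, pC (emb a) t != 0},
        intertwiner (fun w => w \in weyl X) (fun w => tau w : _ -> _)
          (@wact R X) phi,
        phi v != 0,
        is_germ t (phi v) L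
      & forall x,
          (forall q, (forall q', L (q' * q) = 0) -> evalg q x = 0)
          <-> (forall q, (forall psi, inner psi -> evalg q (psi e) = 0) ->
                 evalg q x = 0)].

Variable Cl : clifford (@ip R X).

(* Psi U s e h f stands for: Psi(s) is the class of (e, h, f), with h in
   V_C^\vee. *)
Definition Psi_map :=
  forall U : vectType C, (Cl -> 'End(U)) -> g -> hC -> g -> Prop.

Definition is_Psi (Psi : Psi_map) : Prop :=
  [/\ (forall (U : vectType C) (s : Cl -> 'End(U)), spin_irrep s -> genuine s ->
         exists e h f, T0 e h f /\
           forall e' h' f', Psi U s e' h' f' <-> conj_triple e h f e' h' f') /\
      (forall (U U' : vectType C) (s : Cl -> 'End(U)) (s' : Cl -> 'End(U')),
         spin_irrep s -> genuine s -> spin_irrep s' -> genuine s' ->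
         isomorphic_act (@Wt R X Cl)
           (fun k => s k.1 : _ -> _) (fun k => s' k.1 : _ -> _) ->
         forall e h f, Psi U s e h f <-> Psi U' s' e h f),
      forall e h f, T0 e h f -> exists (U : vectType C) (s : Cl -> 'End(U)),
        [/\ spin_irrep s, genuine s & Psi U s e h f],
      forall (U : vectType C) (s : Cl -> 'End(U)) e h f, spin_irrep s -> genuine s ->
        Psi U s e h f -> forall x, Omega s x = ipdC h h *: x,
      forall e h f, T0 e h f ->
        forall (E : vectType C) (tau : 'End(V) -> 'End(E))
               (S : vectType C) (rho : Cl -> 'End(S)),
        springer e tau -> cl_simple rho ->
        exists (U : vectType C) (s : Cl -> 'End(U)),
          [/\ spin_irrep s, genuine s, Psi U s e h f
            & hom_neq0 (@Wt R X Cl) (fun k => s k.1 : _ -> _)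
                (fun k => tmap (tau k.2) (rho k.1))]
    & forall e h f, T0 e h f -> forall (U : vectType C) (s : Cl -> 'End(U)),
        spin_irrep s -> genuine s -> Psi U s e h f ->
        exists (E : vectType C) (tau : 'End(V) -> 'End(E))
               (S : vectType C) (rho : Cl -> 'End(S)),
          [/\ springer e tau, cl_simple rho
            & hom_neq0 (@Wt R X Cl) (fun k => s k.1 : _ -> _)
                (fun k => tmap (tau k.2) (rho k.1))]].

End Lie.

(* Main.v *)
(** Part (a) is Frobenius reciprocity combined with the multiplicity r of S_M in
    the restriction of S to C(V_M).  The algebra H is free as a right
    S(V_C)-module on W, and dropping the terms outside W_M is a right
    H_M-linear projection H -> H_M, equivariant under W_M on the left.  It
    induces epsilon : pi -> pi_M with sum_w w (1 (x) epsilon (w^-1 y)) = |W_M| y,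
    from which the two reciprocity maps are built, using lifts of the w to the
    pin cover.  The multiplicity r is found by compressing with products of the
    commuting idempotents (1 - i e e') / 2, for pairs (e, e') of orthonormal
    vectors: they turn the commutant of C(V_M) into a full matrix algebra, up to
    the chirality e of the unpaired vector when dim V_M is odd.

    For part (b), the form sum_w <epsilon (w^-1 y), epsilon (w^-1 y')> on pi is
    positive definite and makes every wtilde skew, as on pi_M, so that D and D_M
    are symmetric for suitable positive forms and ker D^2 = ker D.  Hence
    sigma_M occurs in ker D_M; averaging over W_M extends this occurrence to the
    restriction of sigma, and part (a) gives a nonzero F : sigma -> pi (x) S.
    Finally D^2 = - Casimir - Gam^2 / 4, where Gam^2 acts on the image of F by
    - sigma(Omega) = - <h, h>, while the central character chi_(h/2) makes the
    Casimir element act by <h, h> / 4.  So D^2 F = 0, and D F = 0. *)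

(* Three obstacles shape the proof. The modules [rhoM] and [rho] live over different algebras and on
   different spaces; both are embedded in [SM * S], where they become idempotents of one commutant,
   so that the multiplicity is read off from ranks. In odd dimension this requires both chiralities
   to have the same rank in [S]: a unit vector orthogonal to V_M exchanges them, and when V_M = V
   each occurs once. The Hecke algebra is given with polynomials on the left, whereas induction
   needs it as a right S(V_C)-module; comparing leading terms in the polynomial degree converts one
   normal form into the other. Finally [wtilde] of a vector does not lie in H_M, and epsilon does
   not carry it to its analogue for M: the defect is a sum over the positive roots b outside R_M. It
   disappears only in the averaged form, where the substitution w -> w s_b pairs its terms with
   opposite signs. The Hom spaces may be infinite-dimensional, so part (a) turns a basis indexed by
   any type [J] into one indexed by r copies of [J]. Part (a) also covers non-genuine sigma: -1 lies
   in both pin covers and acts by -1 on spinors. *)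
Require Import Defs.
From HB Require Import structures.
From mathcomp Require Import all_boot all_order all_algebra.
From mathcomp Require Import reals complex mpoly boolp.

Set Implicit Arguments.
Unset Strict Implicit.
Unset Printing Implicit Defensive.

Import Order.TTheory GRing.Theory Num.Theory.
Local Open Scope ring_scope.
Local Open Scope complex_scope.

(** * Idempotents in the commutant of anticommuting elements *)

Section Vacuum.
Variables (B : pzRingType) (ii h : B).
Hypotheses (ii_central : forall x, ii * x = x * ii) (ii2 : ii * ii = -1).
Hypotheses (h_central : forall x, h * x = x * h) (h2 : h + h = 1).

Definition anti (x y : B) : Prop := x * y = - (y * x).

Lemma antiC x y : anti x y -> anti y x.
Proof. by rewrite /anti => ->; rewrite opprK. Qed.

Fixpoint on_pairs (Q : B -> Prop) (l : seq (B * B)) : Prop :=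
  if l is (e, e') :: l' then [/\ Q e, Q e' & on_pairs Q l'] else True.

Lemma on_pairs_impl (Q Q' : B -> Prop) l :
  (forall x, Q x -> Q' x) -> on_pairs Q l -> on_pairs Q' l.
Proof. by move=> QQ'; elim: l => // -[e e'] l IH /= [? ? ?]; split; auto. Qed.

Fixpoint clifford_pairs (l : seq (B * B)) : Prop :=
  if l is (e, e') :: l' then
    [/\ e * e = -1, e' * e' = -1, anti e e',
        on_pairs (anti e) l' /\ on_pairs (anti e') l' & clifford_pairs l']
  else True.

(** Only the products [e * e'] enter [vac]. Both the elements commuting with all generators and
    those anticommuting with all of them satisfy this condition. *)
Fixpoint pairs_comm (g : B) (l : seq (B * B)) : Prop :=
  if l is (e, e') :: l' then
    GRing.comm g (e * e') /\ pairs_comm g l' else True.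

Lemma anti_pairs_comm g l : on_pairs (anti g) l -> pairs_comm g l.
Proof.
elim: l => // -[e e'] l IH /= [ge ge' gl]; split; last exact: IH.
by rewrite /GRing.comm mulrA ge mulNr -mulrA ge' mulrN opprK mulrA.
Qed.

Lemma comm_pairs_comm g l : on_pairs (GRing.comm g) l -> pairs_comm g l.
Proof.
elim: l => // -[e e'] l IH /= [ge ge' gl]; split; last exact: IH.
exact: commrM.
Qed.

(* locked, lest mulrA unfold the product *)
Fact vacp_key : unit. Proof. by []. Qed.
Definition vacp (e e' : B) : B := locked_with vacp_key (h * (1 - ii * (e * e'))).
Lemma vacpE e e' : vacp e e' = h * (1 - ii * (e * e')).
Proof. exact: locked_withE. Qed.

(** The image is the joint eigenspace on which every product [e * e'] acts as [ii]: the vacuum space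
    of a Fock representation, tensored with its multiplicity space. *)
Fixpoint vac (l : seq (B * B)) : B :=
  if l is (e, e') :: l' then vacp e e' * vac l' else 1.

(* Inverts compression by vac on the commutant of l: the commutant acts on the
   whole module through its action on the image of vac. *)
Fixpoint ext (l : seq (B * B)) (x : B) : B :=
  if l is (e, e') :: l' then ext l' x - e * ext l' x * e else x.

Section Pair.
Variables e e' : B.
Hypotheses (e2 : e * e = -1) (e'2 : e' * e' = -1) (ee' : anti e e').
Let c := ii * (e * e').
Let p := vacp e e'.

Lemma half2 x : h * x + h * x = x.
Proof. by rewrite -mulrDl h2 mul1r. Qed.

Lemma ee'2 : e * e' * (e * e') = -1.
Proof.
by rewrite mulrA -(mulrA e) -(opprK (e' * e)) -ee' mulrN mulrA e2 mulN1r opprK.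
Qed.

Lemma vac_cc : c * c = 1.
Proof.
by rewrite /c -mulrA (mulrA _ ii) -(ii_central (e * e')) -mulrA ee'2 mulrN1 mulrN ii2 opprK.
Qed.

Lemma vacp_c : p * c = - p.
Proof. by rewrite /p vacpE -/c -mulrA mulrBl mul1r vac_cc -opprB mulrN. Qed.

Lemma vacp_idem : p * p = p.
Proof.
rewrite {2}/p vacpE -/c mulrA -h_central -mulrA mulrBr mulr1 vacp_c opprK mulrDr.
exact: half2.
Qed.

Lemma vacp_ee' : p * (e * e') = ii * p.
Proof.
have := vacp_c; rewrite /c mulrA -(ii_central p) -mulrA => /(congr1 ( *%R (- ii))).
by rewrite (mulrA _ ii) (mulNr ii ii) ii2 opprK mul1r mulrN mulNr opprK.
Qed.

Lemma comm_vacp g : GRing.comm g (e * e') -> GRing.comm g p.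
Proof.
move=> cg; rewrite /p vacpE; apply: commrM; first exact/commr_sym/h_central.
by apply: commrB; [exact: commr1|apply: commrM => //; exact/commr_sym/ii_central].
Qed.

Lemma ee'_vacp : (e * e') * p = ii * p.
Proof.
by rewrite -vacp_ee'; exact: comm_vacp.
Qed.

Lemma e_ee' : e * (e * e') = - (e * e' * e).
Proof. by rewrite -mulrA -(opprK (e' * e)) -ee' mulrN opprK. Qed.

(** As [e] anticommutes with [e * e'], it exchanges the two eigenspaces of that product, onto which
    [p] and [1 - p] project. *)
Lemma e_vacp : e * p = (1 - p) * e.
Proof.
have ec : e * c = - (c * e).
  by rewrite /c mulrA -ii_central -mulrA e_ee' mulrN !mulrA.
have -> : 1 - p = h * (1 + c).
  by rewrite /p vacpE -/c mulrBr mulrDr mulr1 -{1}h2 opprB addrA addrAC addrK addrC.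
by rewrite /p vacpE -/c mulrA -h_central -!mulrA mulrBr mulr1 ec opprK mulrDl mul1r.
Qed.

Lemma vacp_e_vacp : p * e * p = 0.
Proof. by rewrite -mulrA e_vacp mulrA mulrBr mulr1 vacp_idem subrr mul0r. Qed.

(** On the image of [p] the product [e * e'] is the scalar [ii], so [e'] is there a scalar multiple
    of [e]. Commutation with [e] then yields commutation with [e']. *)
Lemma e'_vacp y : p * y = y -> e' * y = - ii * (e * y).
Proof.
move=> py; have : e * (e' * y) = ii * y.
  by rewrite -{1}py mulrA (mulrA _ p) ee'_vacp -mulrA py.
move=> /(congr1 ( *%R e)); rewrite mulrA e2 mulN1r mulrA -ii_central => /eqP.
by rewrite eqr_oppLR => /eqP ->; rewrite mulNr mulrA.
Qed.

Lemma vacp_e' y : y * p = y -> y * e' = ii * (y * e).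
Proof.
move=> py; have : (y * (e * e')) * e' = ii * y * e'.
  by rewrite -{1}py -(mulrA y p) vacp_ee' mulrA -(ii_central y) -(mulrA ii) py.
rewrite -!mulrA e'2 mulrN1 mulrN => /(congr1 ( *%R ii)).
by rewrite mulrN [RHS]mulrA ii2 mulN1r => /oppr_inj.
Qed.

End Pair.

Lemma vac_comm g l : pairs_comm g l -> GRing.comm g (vac l).
Proof.
elim: l => [_|[e e'] l IH /= [ge gl]]; first exact: commr1.
by apply: commrM; [exact: comm_vacp|exact: IH].
Qed.

Lemma comm_ee' e e' x : anti e x -> anti e' x -> GRing.comm (e * e') x.
Proof.
move=> ex e'x; apply/commr_sym; rewrite /GRing.comm.
by rewrite mulrA (antiC ex) mulNr -mulrA (antiC e'x) mulrN opprK mulrA.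
Qed.

Lemma comm_vacp_pairs e e' l : on_pairs (anti e) l -> on_pairs (anti e') l ->
  on_pairs (GRing.comm (vacp e e')) l.
Proof.
elim: l => // -[f f'] l IH /= [ef ef' el] [e'f e'f' e'l].
by split; [exact/commr_sym/comm_vacp/commr_sym/comm_ee'
          |exact/commr_sym/comm_vacp/commr_sym/comm_ee'|exact: IH].
Qed.

Lemma comm_vac_vacp e e' l : on_pairs (anti e) l -> on_pairs (anti e') l ->
  GRing.comm (vacp e e') (vac l).
Proof. by move=> el e'l; apply/vac_comm/comm_pairs_comm/comm_vacp_pairs. Qed.

Lemma comm_idem_absorbl (p v x : B) : p * p = p -> v * v = v ->
  GRing.comm p v -> p * v * x = x -> p * x = x /\ v * x = x.
Proof.
move=> pp vv pv px; split; rewrite -px !mulrA; first by rewrite pp.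
by rewrite -pv -(mulrA p) vv.
Qed.

Lemma comm_idem_absorbr (p v x : B) : p * p = p -> v * v = v ->
  GRing.comm p v -> x * (p * v) = x -> x * p = x /\ x * v = x.
Proof.
move=> pp vv pv px; split; rewrite -px -!mulrA; last by rewrite vv.
by rewrite -pv (mulrA p) pp.
Qed.

Lemma vac_idem l : clifford_pairs l -> vac l * vac l = vac l.
Proof.
elim: l => [_|[e e'] l IH /= [e2 e'2 ee' [el e'l] wl]]; first exact: mulr1.
rewrite mulrA -(mulrA _ (vac l)) -(comm_vac_vacp el e'l) mulrA vacp_idem //.
by rewrite -mulrA IH.
Qed.

Lemma ext_mull l z x : on_pairs (GRing.comm z) l ->
  z * ext l x = ext l (z * x).
Proof.
elim: l x => // -[e e'] l IH x /= [ze _ zl].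
by rewrite mulrBr -!IH // !mulrA ze -!mulrA.
Qed.

Lemma ext_mulr l z x : on_pairs (GRing.comm z) l ->
  ext l x * z = ext l (x * z).
Proof.
elim: l x => // -[e e'] l IH x /= [ze _ zl].
by rewrite mulrBl -!IH // -!mulrA ze.
Qed.

Lemma comm_anti_conj g e y : anti g e -> GRing.comm g y ->
  GRing.comm g (e * y * e).
Proof.
move=> ge gy; rewrite /GRing.comm !mulrA ge !mulNr -(mulrA e g) gy -(mulrA _ e g).
by rewrite (antiC ge) mulrN !mulrA.
Qed.

Lemma ext_comm_anti l g x : on_pairs (anti g) l -> GRing.comm g x ->
  GRing.comm g (ext l x).
Proof.
move=> + gx; elim: l => // -[e e'] l IH /= [ge _ gl].
by apply: commrB; [exact: IH|apply: comm_anti_conj => //; exact: IH].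
Qed.

(** Since [e] has inverse [- e], the element [y - e * y * e] is the sum of [y] and its conjugate by
    [e], hence invariant under [e]. Invariance under [e'] follows because [e'] is a multiple of [e]
    next to [y], and later pairs meet two sign changes that cancel. *)
Lemma ext_comm l x : clifford_pairs l -> vac l * x = x -> x * vac l = x ->
  on_pairs (fun e => GRing.comm e (ext l x)) l.
Proof.
elim: l x => // -[e e'] l IH x /= [e2 e'2 ee' [el e'l] wl] vx xv.
have cv := comm_vac_vacp el e'l.
have pp := vacp_idem e2 e'2 ee'; have vv := vac_idem wl.
have [vpx vlx] := comm_idem_absorbl pp vv cv vx.
have [xvp xvl] := comm_idem_absorbr pp vv cv xv.
have cl := comm_vacp_pairs el e'l.
set y := ext l x.
have vpy : vacp e e' * y = y by rewrite ext_mull // vpx.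
have yvp : y * vacp e e' = y by rewrite ext_mulr // xvp.
have com z : (e * y + y * e) = z -> GRing.comm e (y - e * y * e).
  move=> _; rewrite /GRing.comm mulrBr mulrBl !mulrA e2 -(mulrA (e * y)) e2.
  by rewrite mulN1r mulNr !opprK mulrN1 opprK addrC.
split.
- exact: com.
- have e'y := e'_vacp e2 e'2 ee' vpy; have ye' := vacp_e' e2 e'2 ee' yvp.
  have yee' : y * e * e' = ii * y.
    by rewrite -mulrA -{1}yvp -mulrA vacp_ee' // mulrA -ii_central -mulrA yvp.
  have e'ey : e' * e * y = - (ii * y).
    have ee'y : e * e' * y = ii * y.
      by rewrite -{1}vpy mulrA ee'_vacp // -mulrA vpy.
    by rewrite (antiC ee') mulNr ee'y.
  rewrite /GRing.comm mulrBr mulrBl e'y ye' -(mulrA e y e) (mulrA e') (mulrA (e' * e)).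
  rewrite e'ey -(mulrA e (y * e)) yee' (mulrA e ii) -ii_central.
  by rewrite !mulNr opprK addrC !mulrA.
- have /= := IH x wl vlx xvl; rewrite -/y.
  move: y {com vpy yvp} => y.
  elim: l el {IH vx xv wl cv vlx xvl cl e'l vv} => // -[f f'] l IH /= [ef ef' el].
  have aux g : anti e g -> GRing.comm g y -> GRing.comm g (y - e * y * e).
    move=> eg gy; apply: commrB => //.
    by apply: comm_anti_conj => //; exact: antiC.
  by move=> [fy f'y ly]; split; [exact: aux|exact: aux|exact: IH].
Qed.

(** By [e_vacp], conjugating [p] by [e] gives [1 - p], and the two add up to 1. *)
Lemma ext_vac l : clifford_pairs l -> ext l (vac l) = 1.
Proof.
elim: l => // -[e e'] l IH /= [e2 e'2 ee' [el e'l] wl].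
rewrite -ext_mull ?IH ?mulr1 //; last exact: comm_vacp_pairs.
by rewrite e_vacp // -mulrA e2 mulrN1 opprK addrC subrK.
Qed.

(** The mixed terms contain [p * e * p], which is 0 because [e] leaves the image of [p]. So [ext] is
    a ring homomorphism on the corner cut out by [vac l]. *)
Lemma ext_mul l x y : clifford_pairs l -> x * vac l = x -> vac l * y = y ->
  ext l (x * y) = ext l x * ext l y.
Proof.
elim: l x y => // -[e e'] l IH x y /= [e2 e'2 ee' [el e'l] wl] xv vy.
have cv := comm_vac_vacp el e'l.
have pp := vacp_idem e2 e'2 ee'; have vv := vac_idem wl.
have [vpy vly] := comm_idem_absorbl pp vv cv vy.
have [xvp xvl] := comm_idem_absorbr pp vv cv xv.
have cl := comm_vacp_pairs el e'l.
rewrite (IH x y) //; set X := ext l x; set Y := ext l y.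
have Xp : X * vacp e e' = X by rewrite ext_mulr // xvp.
have pY : vacp e e' * Y = Y by rewrite ext_mull // vpy.
have z : X * e * Y = 0.
  by rewrite -Xp -pY !mulrA -(mulrA X) -(mulrA X) vacp_e_vacp // mulr0 mul0r.
rewrite mulrBl !mulrBr !mulrA z mul0r subr0 -(mulrA e X e) -(mulrA e (X * e) Y) z.
rewrite mulr0 sub0r -!mulrA (mulrA e e) e2 mulN1r !mulrN !opprK.
by rewrite !mulrA.
Qed.

Lemma vac_ext l x : clifford_pairs l -> vac l * x = x -> x * vac l = x ->
  vac l * ext l x * vac l = x.
Proof.
elim: l x => [x _ _ _|[e e'] l IH x /= [e2 e'2 ee' [el e'l] wl] vx xv].
  by rewrite mulr1 mul1r.
have cv := comm_vac_vacp el e'l.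
have pp := vacp_idem e2 e'2 ee'; have vv := vac_idem wl.
have [vpx vlx] := comm_idem_absorbl pp vv cv vx.
have [xvp xvl] := comm_idem_absorbr pp vv cv xv.
have cl := comm_vacp_pairs el e'l.
have vpy : vacp e e' * ext l x = ext l x by rewrite ext_mull // vpx.
have yvp : ext l x * vacp e e' = ext l x by rewrite ext_mulr // xvp.
set z := ext l x - _.
have -> : vacp e e' * vac l * z * (vacp e e' * vac l)
    = vac l * (vacp e e' * z * vacp e e') * vac l by rewrite {1}cv !mulrA.
have -> : vacp e e' * z * vacp e e' = ext l x; last exact: IH.
rewrite mulrBr vpy mulrBl yvp -[X in e * X * e]vpy !mulrA vacp_e_vacp //.
by rewrite !mul0r subr0.
Qed.

End Vacuum.

(** A copy of the endomorphism type with composition as multiplication. It is a possibly zero ring,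
    so that [W] may be the zero space. *)
Definition endo (F : fieldType) (W : vectType F) : Type := 'End(W).

Section Endo.
Variables (F : fieldType) (W : vectType F).
HB.instance Definition _ := GRing.Lmodule.on (endo W).
HB.instance Definition _ := GRing.Zmodule_isPzRing.Build (endo W)
  (@comp_lfunA F W W W W) (@comp_lfun1l F W W) (@comp_lfun1r F W W)
  (@comp_lfunDl F W W W) (@comp_lfunDr F W W W).
End Endo.

(** * Equivalence of idempotents in a full endomorphism algebra *)

Section Frames.
Variable B : pzRingType.

(* p is equivalent to the sum of r orthogonal copies of the idempotent p'. *)
Definition frame (p' p : B) (r : nat) (u v : 'I_r -> B) : Prop :=
  [/\ forall t, p * u t = u t /\ u t * p' = u t,
      forall t, p' * v t = v t /\ v t * p = v t,
      forall t t', v t * u t' = if t == t' then p' else 0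
    & \sum_t u t * v t = p].

Lemma frame_add (p1' p1 p2' p2 : B) r (u1 v1 u2 v2 : 'I_r -> B) :
  p1' * p2' = 0 -> p2' * p1' = 0 -> p1 * p2 = 0 -> p2 * p1 = 0 ->
  frame p1' p1 u1 v1 -> frame p2' p2 u2 v2 ->
  frame (p1' + p2') (p1 + p2) (fun t => u1 t + u2 t) (fun t => v1 t + v2 t).
Proof.
move=> a1 a2 a3 a4 [u1P v1P uv1 s1] [u2P v2P uv2 s2].
have z (a b x y : B) : a * b = 0 -> x * a = x -> b * y = y -> x * y = 0.
  by move=> ab <- <-; rewrite -mulrA (mulrA a) ab mul0r mulr0.
have zl (a b y : B) : a * b = 0 -> b * y = y -> a * y = 0.
  by move=> ab <-; rewrite mulrA ab mul0r.
have zr (a b x : B) : a * b = 0 -> x * a = x -> x * b = 0.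
  by move=> ab <-; rewrite -mulrA ab mulr0.
split=> [t|t|t t'|].
- have [? ?] := u1P t; have [? ?] := u2P t.
  rewrite !mulrDl !mulrDr (zl p1 p2 (u2 t)) ?(zl p2 p1 (u1 t)) //.
  by rewrite (zr p1' p2' (u1 t)) ?(zr p2' p1' (u2 t)) // !addr0 !add0r; split; congr (_ + _).
- have [? ?] := v1P t; have [? ?] := v2P t.
  rewrite !mulrDl !mulrDr (zl p1' p2' (v2 t)) ?(zl p2' p1' (v1 t)) //.
  by rewrite (zr p1 p2 (v1 t)) ?(zr p2 p1 (v2 t)) // !addr0 !add0r; split; congr (_ + _).
- have [? ?] := u1P t'; have [? ?] := u2P t'; have [? ?] := v1P t; have [? ?] := v2P t.
  rewrite mulrDl !mulrDr (z p1 p2 (v1 t) (u2 t')) // (z p2 p1 (v2 t) (u1 t')) // addr0 add0r uv1 uv2.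
  by case: eqP => // _; rewrite addr0.
- rewrite -s1 -s2 -big_split; apply: eq_bigr => t _ /=.
  have [? ?] := u1P t; have [? ?] := u2P t; have [? ?] := v1P t; have [? ?] := v2P t.
  by rewrite mulrDl !mulrDr (z p1' p2' (u1 t) (v2 t)) // (z p2' p1' (u2 t) (v1 t)) // addr0 add0r.
Qed.

Definition primitive_in (K : B -> Prop) (q : B) : Prop :=
  [/\ q * q = q, K q, q != 0 & forall x, K x -> x * x = x -> q * x = x ->
      x * q = x -> x = 0 \/ x = q].

End Frames.

Lemma linfunE (F : fieldType) (U T : vectType F) (f : U -> T) :
  linear f -> linfun f =1 f.
Proof.
move=> fl; pose g : {linear U -> T} := HB.pack f (GRing.isLinear.Build F U T _ f fl).
exact: (lfunE g).
Qed.

Section Rank.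
Variables (F : fieldType) (W : vectType F).
Notation B := (endo W).

Definition rank (p : B) : nat := \dim (limg (p : 'End(W))).

Lemma mulE (f g : B) x : (f * g : 'End(W)) x = (f : 'End(W)) ((g : 'End(W)) x).
Proof. exact: comp_lfunE. Qed.

Lemma endoP (f g : B) : (forall x, (f : 'End(W)) x = (g : 'End(W)) x) -> f = g.
Proof. by move=> fg; apply/lfunP. Qed.

Definition rank1 (l : 'Hom(W, F^o)) (w : W) : B :=
  linfun (fun x => (l x : F) *: w).

Lemma rank1E l w x : (rank1 l w : 'End(W)) x = (l x : F) *: w.
Proof. by rewrite linfunE // => a y z; rewrite linearP /= scalerDl scalerA. Qed.

Lemma addE (f g : B) x : (f + g : 'End(W)) x = (f : 'End(W)) x + (g : 'End(W)) x.
Proof. exact: add_lfunE. Qed.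

Lemma sumE (I : Type) (s : seq I) (f : I -> B) x :
  ((\sum_(i <- s) f i : B) : 'End(W)) x = \sum_(i <- s) (f i : 'End(W)) x.
Proof.
by elim: s => [|i s IH]; rewrite ?big_nil ?zero_lfunE // !big_cons addE IH.
Qed.

Lemma idem_limg (p : B) x : p * p = p -> x \in limg (p : 'End(W)) ->
  (p : 'End(W)) x = x.
Proof. by move=> pp /memv_imgP[y _ ->]; rewrite -mulE pp. Qed.

Definition coordp (p : B) (t : 'I_(\dim (limg (p : 'End(W))))) : 'Hom(W, F^o) :=
  linfun (fun x : W => (coord (vbasis (limg (p : 'End(W)))) t ((p : 'End(W)) x) : F^o)).

Lemma coordpE (p : B) t x :
  @coordp p t x = coord (vbasis (limg (p : 'End(W)))) t ((p : 'End(W)) x).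
Proof. by rewrite linfunE // => a y z; rewrite !linearP. Qed.

Lemma coordp_basis (p : B) (t t' : 'I_(\dim (limg (p : 'End(W))))) : p * p = p ->
  @coordp p t (vbasis (limg (p : 'End(W))))`_t' = (t == t')%:R.
Proof.
move=> pp; rewrite coordpE idem_limg ?vbasis_mem ?mem_nth ?size_tuple //.
by rewrite coord_free ?(basis_free (vbasisP _)) // eq_sym.
Qed.

Lemma sum_coordp (p : B) x : p * p = p ->
  \sum_t (@coordp p t x : F) *: (vbasis (limg (p : 'End(W))))`_t = (p : 'End(W)) x.
Proof.
move=> pp; rewrite [RHS](coord_vbasis (memv_img p (memvf x))).
by apply: eq_bigr => t _; rewrite coordpE.
Qed.

(** With [w] spanning the image of [p'], each [u t] sends [w] to the t-th basis vector of the image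
    of [p], and [v t] reads off the t-th coordinate as a multiple of [w]. *)
Lemma frame_exists (p' p : B) r : p' * p' = p' -> p * p = p ->
  rank p' = 1%N -> rank p = r -> exists u v : 'I_r -> B, frame p' p u v.
Proof.
move=> pp' pp rp' <-; rewrite /rank in rp' *.
set t0 : 'I_(\dim (limg (p' : 'End(W)))) := cast_ord (esym rp') ord0.
have t0P t : t = t0 by apply: val_inj; case: t => -[|n] //=; rewrite rp'.
pose w := (vbasis (limg (p' : 'End(W))))`_t0; pose l := coordp t0.
have lw : l w = 1 by rewrite /l coordp_basis // eqxx.
have p'E x : (p' : 'End(W)) x = (l x : F) *: w.
  rewrite -sum_coordp // (bigD1 t0) //= big1 ?addr0 // => t.
  by rewrite (t0P t) eqxx.
have lp' x : l ((p' : 'End(W)) x) = l x by rewrite p'E linearZ /= lw; exact: mulr1.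
have p'w : (p' : 'End(W)) w = w by rewrite p'E lw scale1r.
exists (fun t => rank1 l (vbasis (limg (p : 'End(W))))`_t), (fun t => rank1 (coordp t) w).
have pb (t : 'I_(\dim (limg (p : 'End(W))))) : (p : 'End(W)) (vbasis (limg (p : 'End(W))))`_t = (vbasis (limg (p : 'End(W))))`_t.
  by apply: idem_limg => //; apply: vbasis_mem; rewrite mem_nth // size_tuple.
split=> [t|t|t t'|].
- by split; apply: endoP => x; rewrite mulE !rank1E ?linearZ /= ?pb ?lp'.
- split; apply: endoP => x; rewrite mulE !rank1E ?linearZ /= ?p'w //.
  by rewrite !coordpE -mulE pp.
- apply: endoP => x; rewrite mulE !rank1E linearZ /= coordp_basis //.
  case: eqP => _; last by rewrite [_ *: _%:R]mulr0 scale0r zero_lfunE.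
  by rewrite p'E; congr (_ *: _); exact: mulr1.
- apply: endoP => x; rewrite -[RHS]sum_coordp // sumE; apply: eq_bigr => t _.
  by rewrite mulE !rank1E linearZ /= lw; congr (_ *: _); exact: mulr1.
Qed.

Lemma primitive_rank1 (p : B) : primitive_in (fun=> True) p -> rank p = 1%N.
Proof.
case=> pp _ p0 pmin.
have t : 'I_(\dim (limg (p : 'End(W)))).
  have d : (0 < \dim (limg (p : 'End(W))))%N.
    rewrite lt0n dimv_eq0; apply: contraNneq p0 => p0; apply/eqP/endoP => x.
    by apply/eqP; rewrite zero_lfunE -memv0 -p0 memv_img ?memvf.
  exact: Ordinal d.
pose b := (vbasis (limg (p : 'End(W))))`_t.
have bl : b \in limg (p : 'End(W)) by apply: vbasis_mem; rewrite mem_nth // size_tuple.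
have pb : (p : 'End(W)) b = b by rewrite idem_limg.
have tb : coordp t b = 1 by rewrite coordp_basis // eqxx.
have b0 : b != 0.
  by apply: contra_eq_neq tb => ->; rewrite linear0 eq_sym oner_eq0.
(* The projection onto the line of one basis vector lies below [p] and is not 0, so minimality makes
   it equal to [p]. *)
pose x : B := rank1 (coordp t) b.
have [||||x0|xp] := pmin x.
- by [].
- by apply: endoP => y; rewrite mulE !rank1E linearZ /= tb; congr (_ *: _); exact: mulr1.
- by apply: endoP => y; rewrite mulE !rank1E linearZ /= pb.
- by apply: endoP => y; rewrite mulE !rank1E !coordpE -mulE pp.
- have := rank1E (coordp t) b b; rewrite -/x x0 zero_lfunE tb scale1r => /esym/eqP.
  by rewrite (negPf b0).
rewrite /rank; have -> : limg (p : 'End(W)) = <[b]>%VS.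
  apply/eqP; rewrite eqEsubv -memvE bl andbT; apply/subvP => _ /memv_imgP[y _ ->].
  by rewrite -xp rank1E memvZ // memv_line.
by rewrite dim_vline b0.
Qed.

End Rank.

(** * Transport between a Clifford commutant and the corner cut out by the vacuum projection *)

Section Commutant.
Variables (C : numClosedFieldType) (W : vectType C).
Notation B := (endo W).

Definition iiW : B := 'i *: (1 : B).
Definition halfW : B := 2^-1 *: (1 : B).

Lemma scaleE (c : C) (f : B) x : ((c *: f : B) : 'End(W)) x = c *: (f : 'End(W)) x.
Proof. exact: scale_lfunE. Qed.

Lemma oneE x : ((1 : B) : 'End(W)) x = x.
Proof. exact: id_lfunE. Qed.

Lemma oppE (f : B) x : ((- f : B) : 'End(W)) x = - (f : 'End(W)) x.
Proof. exact: opp_lfunE. Qed.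

Lemma scalar_central (c : C) (x : B) : (c *: (1 : B)) * x = x * (c *: (1 : B)).
Proof. by apply: endoP => y; rewrite !mulE !scaleE !oneE linearZ. Qed.

Lemma iiW_central (x : B) : iiW * x = x * iiW.
Proof. exact: scalar_central. Qed.

Lemma iiW2 : iiW * iiW = -1.
Proof.
apply: endoP => x; rewrite mulE !scaleE !oneE oppE oneE scalerA.
by rewrite -expr2 sqrCi scaleN1r.
Qed.

Lemma halfW_central (x : B) : halfW * x = x * halfW.
Proof. exact: scalar_central. Qed.

Lemma halfWD : halfW + halfW = 1.
Proof.
by rewrite -scalerDl -mulr2n -[_ *+ 2]mulr_natr mulVf ?pnatr_eq0 // scale1r.
Qed.

Notation vac := (vac iiW halfW).
Notation vac_comm := (vac_comm iiW_central halfW_central).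
Notation vac_idem := (vac_idem iiW_central iiW2 halfW_central halfWD).
Notation ext_comm := (ext_comm iiW_central iiW2 halfW_central halfWD).
Notation ext_vac := (ext_vac iiW_central halfW_central halfWD).
Notation ext_mul := (ext_mul iiW_central iiW2 halfW_central halfWD).
Notation vac_ext := (vac_ext iiW_central iiW2 halfW_central halfWD).

Variable l : seq (B * B).
Hypothesis wl : clifford_pairs l.
Variable G : B -> Prop.
Hypothesis G_anti : forall g, G g -> on_pairs (anti g) l.

Definition commG (x : B) : Prop := forall g, G g -> GRing.comm g x.
(** When [l] pairs up the images of an orthonormal basis and [G] holds the unpaired one (nothing in
    even dimension), this is the commutant of the Clifford algebra. *)
Definition comml (x : B) : Prop :=
  on_pairs (fun e => GRing.comm x e) l /\ commG x.

Lemma vacq_comm q : comml q -> GRing.comm q (vac l).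
Proof. by case=> /comm_pairs_comm /vac_comm. Qed.

Lemma commG_vac : commG (vac l).
Proof. by move=> g /G_anti /anti_pairs_comm /vac_comm. Qed.

Lemma commG_mul x y : commG x -> commG y -> commG (x * y).
Proof. by move=> cx cy g gG; apply: commrM; [exact: cx|exact: cy]. Qed.

Lemma commG_add x y : commG x -> commG y -> commG (x + y).
Proof. by move=> cx cy g gG; apply: commrD; [exact: cx|exact: cy]. Qed.

Lemma ext0 : ext l 0 = 0.
Proof.
by elim: (l) => // -[e e'] l' IH /=; rewrite IH mulr0 mul0r subr0.
Qed.

Lemma comml_ext x : commG x -> vac l * x = x -> x * vac l = x -> comml (ext l x).
Proof.
move=> Gx vx xv; split.
  by apply: on_pairs_impl (ext_comm wl vx xv) => e; exact: commr_sym.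
by move=> g gG; apply: ext_comm_anti; [exact: G_anti|exact: Gx].
Qed.

Lemma ext_vacq q : comml q -> ext l (vac l * q) = q.
Proof.
by move=> Kq; rewrite -(vacq_comm Kq) -ext_mull ?ext_vac ?mulr1 //; case: Kq.
Qed.

(** An idempotent below [vac l * q] in the corner is carried by [ext l] to one below [q] in the
    commutant, where primitivity of [q] decides; compressing by [vac l] brings the answer back. *)
Lemma primitive_vac q : primitive_in comml q -> primitive_in commG (vac l * q).
Proof.
case=> qq Kq q0 qmin; have cq := vacq_comm Kq.
split.
- by rewrite mulrA -(mulrA _ q) cq mulrA vac_idem // -mulrA qq.
- by apply: commG_mul; [exact: commG_vac|case: Kq].
- by apply: contraNneq q0 => v0; rewrite -(ext_vacq Kq) v0 ext0.
move=> x Gx xx vqx xvq.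
have cvq : GRing.comm (vac l) q by exact: commr_sym.
have [vx qx] := comm_idem_absorbl (vac_idem wl) qq cvq vqx.
have [xv xq] := comm_idem_absorbr (vac_idem wl) qq cvq xvq.
have [|||x0|xQ] := qmin _ (comml_ext Gx vx xv).
- by rewrite -ext_mul // xx.
- by rewrite ext_mull ?qx //; case: Kq.
- by rewrite ext_mulr ?xq //; case: Kq.
- by left; rewrite -(vac_ext wl vx xv) x0 mulr0 mul0r.
- by right; rewrite -(vac_ext wl vx xv) xQ -mulrA cq mulrA vac_idem.
Qed.

Definition comm_frame (q' q : B) r (u v : 'I_r -> B) : Prop :=
  frame q' q u v /\ forall t, comml (u t) /\ comml (v t).

(** Frames found in the corner lift to the commutant: [ext l] is multiplicative there, respects
    sums, and inverts multiplication by [vac l] on the commutant. *)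
Lemma frame_ext q' q r (u v : 'I_r -> B) : comml q' -> comml q ->
  q' * q' = q' -> q * q = q ->
  frame (vac l * q') (vac l * q) u v ->
  (forall t, commG (u t) /\ commG (v t)) ->
  comm_frame q' q (fun t => ext l (u t)) (fun t => ext l (v t)).
Proof.
move=> Kq' Kq qq' qq [uP vP uv suv] uvG.
have vv := vac_idem wl.
have c1 := commr_sym (vacq_comm Kq); have c2 := commr_sym (vacq_comm Kq').
have aux t : [/\ vac l * u t = u t, q * u t = u t, u t * vac l = u t & u t * q' = u t].
  have [a b] := uP t.
  by have [? ?] := comm_idem_absorbl vv qq c1 a; have [? ?] := comm_idem_absorbr vv qq' c2 b.
have aux' t : [/\ vac l * v t = v t, q' * v t = v t, v t * vac l = v t & v t * q = v t].
  have [a b] := vP t.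
  by have [? ?] := comm_idem_absorbl vv qq' c2 a; have [? ?] := comm_idem_absorbr vv qq c1 b.
have [lq _] := Kq; have [lq' _] := Kq'.
split; last first.
  move=> t; have [? _ ? _] := aux t; have [? _ ? _] := aux' t; have [? ?] := uvG t.
  by split; apply: comml_ext.
split=> [t|t|t t'|].
- by have [_ a _ b] := aux t; rewrite ext_mull // ext_mulr // a b.
- by have [_ a _ b] := aux' t; rewrite ext_mull // ext_mulr // a b.
- have [? _ ? _] := aux t'; have [? _ ? _] := aux' t.
  rewrite -ext_mul // uv; case: eqP => _; last exact: ext0.
  exact: ext_vacq.
- rewrite -(ext_vacq Kq) -suv.
  have extD x y : ext l (x + y) = ext l x + ext l y.
    elim: (l) => // -[e e'] l' IH /=; rewrite IH mulrDr mulrDl opprD.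
    by rewrite addrACA.
  rewrite (big_morph _ extD ext0); apply: eq_bigr => t _.
  by have [? _ ? _] := aux t; have [? _ ? _] := aux' t; rewrite ext_mul.
Qed.

End Commutant.

(** * Multiplicities in even dimension, and by chirality in odd dimension *)

Section Multiplicity.
Variables (C : numClosedFieldType) (W : vectType C).
Notation B := (endo W).
Variable l : seq (B * B).
Hypothesis wl : clifford_pairs l.
Notation vac := (vac (iiW W) (halfW W)).

Lemma vacq_idem (G : B -> Prop) q : comml l G q -> q * q = q ->
  vac l * q * (vac l * q) = vac l * q.
Proof.
move=> Kq qq; rewrite mulrA -(mulrA _ q) (vacq_comm Kq) mulrA.
by rewrite (vac_idem (@iiW_central _ _) (@iiW2 _ _) (@halfW_central _ _) (@halfWD _ _) wl) -mulrA qq.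
Qed.

(** Without an unpaired generator the corner is that of the full endomorphism algebra, so a
    primitive idempotent has rank one there and ranks alone classify. *)
Lemma even_frame (q' q : B) : primitive_in (comml l (fun=> False)) q' ->
  comml l (fun=> False) q -> q * q = q ->
  exists u v : 'I_(rank (vac l * q)) -> B, comm_frame l (fun=> False) q' q u v.
Proof.
move=> pq' Kq qq; have [qq' Kq' _ _] := pq'.
have nG : forall g : B, False -> on_pairs (anti g) l by [].
have [pp0 _ n0 m0] := primitive_vac wl nG pq'.
have r1 : rank (vac l * q') = 1%N.
  by apply: primitive_rank1; split=> // x _; apply: m0.
have [u [v f]] := frame_exists pp0 (vacq_idem Kq qq) r1 erefl.
exists (fun t => ext l (u t)), (fun t => ext l (v t)).
by apply: (frame_ext wl nG Kq' Kq qq' qq f) => t; split.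
Qed.

Variable e : B.
Hypotheses (e2 : e * e = -1) (el : on_pairs (anti e) l).
Notation K := (comml l (eq e)).
Notation ii := (iiW W).
Notation h := (halfW W).

Lemma e_anti g : e = g -> on_pairs (anti g) l. Proof. by move=> <-. Qed.

Let c := ii * e.

Lemma chirality_cc : c * c = 1.
Proof. by rewrite /c -mulrA (mulrA e) -iiW_central -mulrA e2 mulrA mulrN1 iiW2 opprK. Qed.

Fact chir_key : unit. Proof. by []. Qed.
(** The projection onto the eigenspace of [ii * e] with eigenvalue [(-1) ^+ s], where [e] is the
    unpaired generator; locked like [vacp]. *)
Definition chir (s : bool) : B := locked_with chir_key (h * (1 + (-1) ^+ s * c)).
Lemma chirE s : chir s = h * (1 + (-1) ^+ s * c).
Proof. exact: locked_withE. Qed.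

Lemma chir_sum : chir false + chir true = 1.
Proof.
rewrite !chirE -mulrDr expr0 expr1 mul1r mulN1r addrACA subrr addr0.
by rewrite mulrDr mulr1 halfWD.
Qed.

Lemma c_chir s : c * chir s = (-1) ^+ s * chir s.
Proof.
rewrite chirE mulrA -halfW_central -[LHS]mulrA [RHS]mulrA -(halfW_central ((-1) ^+ s)).
rewrite -[RHS]mulrA; congr (h * _); rewrite !mulrDr !mulr1.
by case: s; rewrite ?expr0 ?expr1 ?mul1r ?mulN1r ?mulrN chirality_cc ?opprK addrC.
Qed.

Lemma comm_chir x s : GRing.comm e x -> GRing.comm (chir s) x.
Proof.
move=> ex; rewrite chirE; apply/commr_sym; apply: commrM.
  exact/commr_sym/halfW_central.
apply: commrD; first exact: commr1.
apply: commrM; first by case: s; [rewrite expr1; exact: commrN1|exact: commr1].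
by apply: commrM; [exact/commr_sym/iiW_central|exact: commr_sym].
Qed.

Lemma chir_idem s : chir s * chir s = chir s.
Proof.
rewrite {1}chirE -mulrA mulrDl mul1r -mulrA c_chir mulrA -signr_addb addbb mul1r.
by rewrite mulrDr -mulrDl halfWD mul1r.
Qed.

Lemma chir_orth s : chir s * chir (~~ s) = 0.
Proof.
have : chir s * (chir s + chir (~~ s)) = chir s.
  suff -> : chir s + chir (~~ s) = 1 by rewrite mulr1.
  by case: s; rewrite /= ?chir_sum // addrC chir_sum.
by rewrite mulrDr chir_idem => /(canRL (addKr _)); rewrite addNr.
Qed.

Lemma e_chir s : e * chir s = - ((-1) ^+ s * ii * chir s).
Proof.
have := c_chir s; rewrite /c -mulrA => /(congr1 ( *%R ii)).
rewrite mulrA iiW2 mulN1r => /(canRL (@opprK _)) ->; congr (- _).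
by rewrite !mulrA iiW_central.
Qed.

(** Within one chirality [e] acts as a scalar. Hence every endomorphism supported there commutes
    with it, and the classification by rank applies to each chirality separately. *)
Lemma chir_comm p s : chir s * p = p -> p * chir s = p -> GRing.comm e p.
Proof.
move=> zp pz; have cs x : GRing.comm x ((-1) ^+ s : B).
  by case: (s); [rewrite expr1; exact: commrN1|exact: commr1].
have cp : GRing.comm p ((-1) ^+ s * ii).
  by apply: commrM; [exact: cs|exact/commr_sym/iiW_central].
have ec : GRing.comm e (chir s) by exact/commr_sym/comm_chir.
rewrite /GRing.comm -{1}zp mulrA e_chir mulNr -(mulrA _ (chir s)) zp.
by rewrite -[in RHS]pz -(mulrA p) -ec e_chir mulrN mulrA cp -(mulrA _ p) pz.
Qed.

(** The component [chir false * p] is an idempotent below [p], so it is 0 or [p]: a primitive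
    idempotent has a single chirality. *)
Lemma primitive_chir p : primitive_in (commG (eq e)) p ->
  exists s, [/\ rank p = 1%N, chir s * p = p & chir (~~ s) * p = 0].
Proof.
case=> pp Gp p0 pmin; have ep := Gp _ erefl.
have aux s : chir s * p = p ->
    exists s, [/\ rank p = 1%N, chir s * p = p & chir (~~ s) * p = 0].
  move=> zp; exists s; split=> //; last first.
    by rewrite -zp mulrA -{2}(negbK s) chir_orth mul0r.
  apply: primitive_rank1; split=> // x _ xx px xp; apply: pmin => // _ <-.
  apply: (@chir_comm _ s); first by rewrite -px mulrA zp.
  by rewrite -{1}xp -mulrA -(comm_chir s ep) zp.
have [||||z0|zp] := pmin (chir false * p).
- by move=> g <-; apply: commrM => //; apply/commr_sym/comm_chir.
- by rewrite mulrA -(mulrA _ p) -(comm_chir false ep) mulrA chir_idem -mulrA pp.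
- by rewrite mulrA -(comm_chir false ep) -mulrA pp.
- by rewrite -mulrA pp.
- by apply: (aux true); rewrite -[RHS]mul1r -chir_sum mulrDl z0 add0r.
- exact: aux zp.
Qed.

Lemma primitive_type q : primitive_in K q -> exists s,
  rank (vac l * q) = 1%N /\ chir s * (vac l * q) = vac l * q.
Proof.
by move=> /(primitive_vac wl e_anti)/primitive_chir[s [? ? _]]; exists s.
Qed.

Lemma comm_chir_vacq s q : K q -> GRing.comm (chir s) (vac l * q).
Proof.
move=> [_ Kq]; apply/comm_chir/commrM; last exact: Kq.
exact: (commG_vac e_anti).
Qed.

(** Used contrapositively: inequivalent simple modules must have different chiralities. *)
Lemma same_type_frame s q1 q2 : primitive_in K q1 -> primitive_in K q2 ->
  chir s * (vac l * q1) = vac l * q1 -> chir s * (vac l * q2) = vac l * q2 ->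
  exists u v : 'I_1 -> B, comm_frame l (eq e) q1 q2 u v.
Proof.
move=> P1 P2 z1 z2; have [_ [r1 _]] := primitive_type P1; have [_ [r2 _]] := primitive_type P2.
have [qq1 K1 _ _] := P1; have [qq2 K2 _ _] := P2.
have [u [v f]] := frame_exists (vacq_idem K1 qq1) (vacq_idem K2 qq2) r1 r2.
exists (fun t => ext l (u t)), (fun t => ext l (v t)).
have c1 := comm_chir_vacq s K1; have c2 := comm_chir_vacq s K2.
apply: (frame_ext wl e_anti K1 K2 qq1 qq2 f) => t; have [/(_ t)[a b] /(_ t)[a' b'] _ _] := f.
split=> _ <-; apply: (@chir_comm _ s).
- by rewrite -a mulrA z2.
- by rewrite -b -mulrA -c1 z1.
- by rewrite -a' mulrA z1.
- by rewrite -b' -mulrA -c2 z2.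
Qed.

(** Each chirality of [q] is framed over the primitive idempotent of the same chirality, and the two
    frames are added. The common rank [r] is what lets one index set serve both. *)
Lemma odd_frame s1 s2 q1 q2 q r : s1 != s2 ->
  primitive_in K q1 -> primitive_in K q2 ->
  chir s1 * (vac l * q1) = vac l * q1 -> chir s2 * (vac l * q2) = vac l * q2 ->
  q1 * q2 = 0 -> q2 * q1 = 0 -> K q -> q * q = q ->
  (forall s, rank (chir s * (vac l * q)) = r) ->
  exists u v : 'I_r -> B, comm_frame l (eq e) (q1 + q2) q u v.
Proof.
move=> s12 P1 P2 z1 z2 q12 q21 Kq qq rk.
have [_ [r1 _]] := primitive_type P1; have [_ [r2 _]] := primitive_type P2.
have [qq1 K1 _ _] := P1; have [qq2 K2 _ _] := P2.
have cz s := comm_chir_vacq s Kq.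
have zz s : chir s * (vac l * q) * (chir s * (vac l * q)) = chir s * (vac l * q).
  by rewrite mulrA -(mulrA (chir s)) -cz mulrA chir_idem -mulrA (vacq_idem Kq qq).
have s21 : ~~ s1 = s2 by move: s12; case: s1 s2 {z1 z2} => -[].
have [u1 [v1 f1]] := frame_exists (vacq_idem K1 qq1) (zz s1) r1 (rk s1).
have [u2 [v2 f2]] := frame_exists (vacq_idem K2 qq2) (zz s2) r2 (rk s2).
have c1 s := comm_chir_vacq s K1; have c2 s := comm_chir_vacq s K2.
have o12 : chir s1 * chir s2 = 0 by rewrite -s21 chir_orth.
have o21 : chir s2 * chir s1 = 0 by rewrite -s21 -{2}(negbK s1) chir_orth.
have z (a b : B) (s s' : bool) : chir s * a = a -> chir s' * b = b ->
    GRing.comm (chir s) a -> chir s * chir s' = 0 -> a * b = 0.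
  by move=> ea eb ca zz'; rewrite -ea -eb ca -!mulrA (mulrA (chir s)) zz' mul0r mulr0.
have zzl s : chir s * (chir s * (vac l * q)) = chir s * (vac l * q).
  by rewrite mulrA chir_idem.
have czz s : GRing.comm (chir s) (chir s * (vac l * q)).
  by apply: commrM; [|exact: cz].
have := frame_add (z _ _ _ _ z1 z2 (c1 _) o12) (z _ _ _ _ z2 z1 (c2 _) o21)
  (z _ _ _ _ (zzl s1) (zzl s2) (czz _) o12) (z _ _ _ _ (zzl s2) (zzl s1) (czz _) o21) f1 f2.
have -> : chir s1 * (vac l * q) + chir s2 * (vac l * q) = vac l * q.
  rewrite -mulrDl -s21; suff -> : chir s1 + chir (~~ s1) = 1 by rewrite mul1r.
  by case: (s1); rewrite /= ?chir_sum // addrC chir_sum.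
rewrite -mulrDr => f.
have K12 : K (q1 + q2).
  have [a b] := K1; have [a' b'] := K2; split; last exact: commG_add.
  have aux (x y : B) : forall l', on_pairs (fun e => GRing.comm x e) l' ->
      on_pairs (fun e => GRing.comm y e) l' -> on_pairs (fun e => GRing.comm (x + y) e) l'.
    elim=> // -[g g'] l' IH /= [? ? ?] [? ? ?]; split; last exact: IH.
      by apply/commr_sym/commrD; exact/commr_sym.
    by apply/commr_sym/commrD; exact/commr_sym.
  exact: aux.
have qq12 : (q1 + q2) * (q1 + q2) = q1 + q2.
  by rewrite mulrDl !mulrDr q12 q21 qq1 qq2 addr0 add0r.
exists (fun t => ext l (u1 t + u2 t)), (fun t => ext l (v1 t + v2 t)).
apply: (frame_ext wl e_anti K12 Kq qq12 qq f) => t.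
have [/(_ t)[a1 b1] /(_ t)[a1' b1'] _ _] := f1.
have [/(_ t)[a2 b2] /(_ t)[a2' b2'] _ _] := f2.
split; apply: commG_add => _ <-.
- by apply: (@chir_comm _ s1); [rewrite -a1 mulrA zzl|rewrite -b1 -mulrA -c1 z1].
- by apply: (@chir_comm _ s2); [rewrite -a2 mulrA zzl|rewrite -b2 -mulrA -c2 z2].
- by apply: (@chir_comm _ s1); [rewrite -a1' mulrA z1|rewrite -b1' -mulrA -czz zzl].
- by apply: (@chir_comm _ s2); [rewrite -a2' mulrA z2|rewrite -b2' -mulrA -czz zzl].
Qed.

(** The second hypothesis makes [g] injective on the image of [p1], and the first sends that image
    into the image of [p2]. *)
Lemma rank_conj (g p1 p2 : B) : g * p1 = p2 * g -> g * g * p1 = - p1 ->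
  (rank p1 <= rank p2)%N.
Proof.
move=> gp ggp; rewrite /rank -(@limg_dim_eq _ _ _ (g : 'End(W))).
  apply/dimvS/subvP => _ /memv_imgP[_ /memv_imgP[x _ ->] ->].
  by rewrite -mulE gp mulE memv_img ?memvf.
apply/eqP; rewrite -subv0; apply/subvP => y; rewrite memv_cap memv0.
case/andP => /memv_imgP[x _ ->]; rewrite memv_ker => /eqP gz.
have /(congr1 (fun f : B => (f : 'End(W)) x)) := ggp.
by rewrite !mulE gz linear0 oppE => /esym/eqP; rewrite oppr_eq0.
Qed.

(** Anticommuting with [e], the element [g] exchanges the chiralities; anticommuting with both
    members of every pair, it commutes with [vac l]. *)
Lemma rank_chir g q : K q -> q * q = q -> g * g = - q -> GRing.comm g q ->
  anti g e -> on_pairs (anti g) l ->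
  rank (chir false * (vac l * q)) = rank (chir true * (vac l * q)).
Proof.
move=> Kq qq gg gq ge gl.
have gz s : g * chir s = chir (~~ s) * g.
  rewrite !chirE mulrA -halfW_central -!mulrA; congr (_ * _).
  rewrite mulrDl mulrDr mulr1 mul1r; congr (_ + _).
  have gc : g * c = - (c * g).
    by rewrite /c mulrA -(iiW_central g) -(mulrA _ g) ge mulrN mulrA.
  by case: s; rewrite /= ?expr0 ?expr1 ?mul1r ?mulN1r ?mulrN gc ?mulNr ?opprK.
have gv : GRing.comm g (vac l).
  exact: (vac_comm (@iiW_central _ _) (@halfW_central _ _) (anti_pairs_comm gl)).
have main s : (rank (chir s * (vac l * q))%R <= rank (chir (~~ s) * (vac l * q))%R)%N.
  apply: (@rank_conj g).
    by rewrite mulrA gz -!mulrA (mulrA g) gv -mulrA gq.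
  have -> : g * g * (chir s * (vac l * q)) = chir s * (vac l * q) * (g * g).
    rewrite mulrA -(mulrA g g (chir s)) gz (mulrA g) gz negbK -!mulrA; congr (_ * _).
    by rewrite (mulrA g (vac l)) gv -(mulrA (vac l)) gq (mulrA g (vac l)) gv -(mulrA (vac l) g) (mulrA g q) gq -(mulrA q).
  by rewrite gg mulrN -mulrA -mulrA qq.
by apply/eqP; rewrite eqn_leq (main false) (main true).
Qed.

End Multiplicity.

(** * Clifford algebras and the restriction of spinors *)

Section GramSchmidt.
Variables (R : rcfType) (V : vectType R) (q : V -> V -> R).
Hypotheses (q_scalar : forall x, scalar (q x)) (q_sym : forall x y, q x y = q y x).
Hypothesis (q_pos : forall x, x != 0 -> 0 < q x x).

Lemma qDr x y z : q x (y + z) = q x y + q x z.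
Proof. by rewrite -{1}(scale1r y) q_scalar mul1r. Qed.
Lemma q0r x : q x 0 = 0.
Proof. by apply: (addrI (q x 0)); rewrite -qDr !addr0. Qed.
Lemma qZr a x y : q x (a *: y) = a * q x y.
Proof. by rewrite -[a *: y]addr0 q_scalar q0r addr0. Qed.
Lemma qNr x y : q x (- y) = - q x y.
Proof. by rewrite -scaleN1r qZr mulN1r. Qed.
Lemma qsumr (I : Type) (s : seq I) (f : I -> V) x :
  q x (\sum_(i <- s) f i) = \sum_(i <- s) q x (f i).
Proof. exact: (big_morph (q x) (qDr x) (q0r x)). Qed.
Lemma qDl x y z : q (y + z) x = q y x + q z x.
Proof. by rewrite q_sym qDr !(q_sym x). Qed.
Lemma qZl a x y : q (a *: y) x = a * q y x.
Proof. by rewrite q_sym qZr q_sym. Qed.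
Lemma qNl x y : q (- y) x = - q y x.
Proof. by rewrite q_sym qNr q_sym. Qed.
Lemma qsuml (I : Type) (s : seq I) (f : I -> V) x :
  q (\sum_(i <- s) f i) x = \sum_(i <- s) q (f i) x.
Proof. by rewrite q_sym qsumr; apply: eq_bigr => i _; rewrite q_sym. Qed.
Lemma q_eq0 x : q x x = 0 -> x = 0.
Proof.
move=> qx; apply/eqP; apply: contra_eqT (qx) => /q_pos.
by rewrite lt0r => /andP[].
Qed.
Lemma q_inj x y : (forall z, q x z = q y z) -> x = y.
Proof.
move=> xy; apply/eqP; rewrite -subr_eq0; apply/eqP/q_eq0.
by rewrite qDl qNl xy subrr.
Qed.

Fixpoint orthonormal_seq (es : seq V) : Prop :=
  if es is e :: es' then
    [/\ q e e = 1, {in es', forall f, q e f = 0} & orthonormal_seq es'] else True.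

Lemma on_projP es v : orthonormal_seq es ->
  {in es, forall e, q (v - \sum_(f <- es) q v f *: f) e = 0}.
Proof.
elim: es v => // e es IH v [ee eo on] f; rewrite inE big_cons => /orP[/eqP->|fes].
  rewrite qDl qNl qDl qZl ee mulr1 qsuml big_seq big1 ?addr0 ?subrr // => g ges.
  by rewrite qZl (q_sym g) eo // mulr0.
have -> : v - (q v e *: e + \sum_(j <- es) q v j *: j)
    = (v - \sum_(j <- es) q v j *: j) - q v e *: e by rewrite opprD addrA addrAC.
by rewrite qDl IH // qNl qZl eo // mulr0 oppr0 addr0.
Qed.

Lemma on_ortho_span es v w : {in es, forall e, q v e = 0} -> w \in <<es>>%VS ->
  q v w = 0.
Proof.
move=> vo ws; rewrite (@coord_span _ _ _ (in_tuple es) w ws) qsumr big1 // => i _.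
by rewrite qZr vo ?mulr0 // mem_nth.
Qed.

Lemma on_expand es v : orthonormal_seq es -> v \in <<es>>%VS ->
  v = \sum_(e <- es) q v e *: e.
Proof.
move=> on vs; apply/eqP; rewrite -subr_eq0; apply/eqP/q_eq0.
apply: on_ortho_span (on_projP v on) _; apply: rpredB => //.
by rewrite big_seq; apply: rpred_sum => e ees; rewrite rpredZ // memv_span.
Qed.

Lemma on_free es : orthonormal_seq es -> free es.
Proof.
elim: es => [|e es IH] /=; first by rewrite nil_free.
case=> ee eo on; rewrite free_cons IH // andbT; apply/negP => /(on_ortho_span _) h.
by have /eqP := h e eo; rewrite ee oner_eq0.
Qed.

Lemma gram_schmidt (vs : seq V) : exists es, orthonormal_seq es /\ <<es>>%VS = <<vs>>%VS.
Proof.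
elim: vs => [|v vs [es [on sp]]]; first by exists [::].
pose w := v - \sum_(f <- es) q v f *: f.
have wo : {in es, forall e, q w e = 0} by exact: on_projP.
have vw : (<[v]> + <<vs>> = <[w]> + <<vs>>)%VS.
  have sv : \sum_(f <- es) q v f *: f \in <<vs>>%VS.
    by rewrite -sp big_seq; apply: rpred_sum => e ees; rewrite rpredZ // memv_span.
  apply/eqP; rewrite eqEsubv !subv_add !addvSr !andbT -!memvE.
  rewrite -{1}(subrK (\sum_(f <- es) q v f *: f) v) -/w memv_add ?memv_line //=.
  by rewrite memv_add ?memv_line // rpredN.
case: (eqVneq w 0) => [w0|w0].
  exists es; split=> //; rewrite span_cons vw w0 sp.
  by rewrite (_ : <[0]> = 0)%VS ?add0v //; apply/eqP; rewrite -dimv_eq0 dim_vline eqxx.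
have ww := q_pos w0; pose s := (Num.sqrt (q w w))^-1.
have s0 : s != 0 by rewrite invr_eq0 sqrtr_eq0 -ltNge.
exists (s *: w :: es); split=> /=.
  split=> //; last by move=> f fes; rewrite qZl wo // mulr0.
  by rewrite qZl qZr mulrA -expr2 exprVn sqr_sqrtr ?ltW // mulVf ?gt_eqF.
rewrite !span_cons vw sp; congr (_ + _)%VS; apply/eqP; rewrite eqEsubv -!memvE.
by rewrite memvZ ?memv_line // -{1}(scalerK s0 w) memvZ ?memv_line.
Qed.

Lemma orthonormal_basis (U : {vspace V}) :
  exists es, orthonormal_seq es /\ <<es>>%VS = U.
Proof.
have [es [on sp]] := gram_schmidt (vbasis U).
by exists es; rewrite sp (span_basis (vbasisP U)).
Qed.

End GramSchmidt.

(** * Clifford algebras from their universal property: generation, the kernel of the pin cover *)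

Section Generation.
Variables (R : realType) (V : vectType R) (A : algType R) (g : V -> A).

Inductive generated : A -> Prop :=
| generated1 : generated 1
| generatedV v : generated (g v)
| generatedL r a b : generated a -> generated b -> generated (r *: a + b)
| generatedM a b : generated a -> generated b -> generated (a * b).

Definition genp : {pred A} := fun a => `[< generated a >].

Fact genp_subalg : GRing.subalg_closed genp.
Proof.
split=> [|r|]; first exact/asboolP/generated1.
  by move=> a b /asboolP ga /asboolP gb; apply/asboolP; exact: generatedL.
by move=> a b /asboolP ga /asboolP gb; apply/asboolP; exact: generatedM.
Qed.
HB.instance Definition _ := GRing.isSubalgClosed.Build R A genp genp_subalg.

Record gensub := Gensub { genval : A; _ : genval \in genp }.
HB.instance Definition _ := [isSub for genval].
HB.instance Definition _ := [Choice of gensub by <:].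
HB.instance Definition _ := [SubChoice_isSubAlgebra of gensub by <:].

End Generation.

Section Clifford.
Variables (R : realType) (V : vectType R) (q : V -> V -> R) (A : clifford q).
Notation gam := (gam A).

(** The universal property lifts [gam] to the generated subalgebra. Followed by the inclusion, this
    lift agrees with the identity on vectors, hence everywhere by uniqueness. *)
Lemma cl_generated (a : A) : generated gam a.
Proof.
pose g0 v : gensub gam := Gensub (asboolT (generatedV gam v) : gam v \in genp gam).
have g0l : linear g0 by move=> r v w; apply: val_inj; rewrite /= linearP.
pose g : {linear V -> gensub gam} := HB.pack g0 (GRing.isLinear.Build _ _ _ _ g0 g0l).
have [x y|G GE] := @cl_ext _ _ _ A (gensub gam) g.
  by apply: val_inj; rewrite /= gam_rel.
pose f0 x := val (G x).
have f0l : linear f0 by move=> r x y; rewrite /f0 !linearP.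
have f0m : monoid_morphism f0 by split=> [|x y]; rewrite /f0 ?rmorph1 ?rmorphM.
pose f : {lrmorphism A -> A} := HB.pack f0 (GRing.isLinear.Build _ _ _ _ f0 f0l)
  (GRing.isMonoidMorphism.Build _ _ f0 f0m).
have fE := @cl_uniq _ _ _ A A f idfun.
rewrite -[a](fE _ a) => [|v]; last by rewrite /= /f0 GE.
by apply/asboolP; exact: valP (G a).
Qed.

Lemma cl_ind (Q : A -> Prop) : Q 1 -> (forall v, Q (gam v)) ->
  (forall r a b, Q a -> Q b -> Q (r *: a + b)) ->
  (forall a b, Q a -> Q b -> Q (a * b)) -> forall a, Q a.
Proof. by move=> Q1 QV QL QM a; elim: {a}(cl_generated a); auto. Qed.

Lemma gam_anti x y : q x y = 0 -> gam x * gam y = - (gam y * gam x).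
Proof.
move=> xy; apply/eqP; rewrite -addr_eq0 gam_rel xy mulr0; apply/eqP.
exact: scale0r.
Qed.

Lemma gam_sqr x : gam x * gam x = - (q x x)%:A.
Proof.
have h : 2^-1 *: (gam x * gam x + gam x * gam x) = gam x * gam x.
  by rewrite -mulr2n -scaler_nat scalerA mulVf ?scale1r // pnatr_eq0.
rewrite -h gam_rel scalerA mulrA mulrN mulVf ?pnatr_eq0 // mulN1r.
by rewrite scaleNr.
Qed.

Lemma trK a : tr A (tr A a) = a.
Proof.
move: a; apply: cl_ind => [|v|r a b ha hb|a b ha hb].
- by rewrite !tr1.
- by rewrite trE linearN /= trE opprK.
- by rewrite !linearP /= ha hb.
- by rewrite !trM ha hb.
Qed.

Lemma pin1 : pin (1 : A).
Proof.
rewrite /pin tr1 mulr1; split=> // v; exists v.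
by rewrite rmorph1 mul1r mulr1.
Qed.

Lemma pinM (a b : A) : pin a -> pin b -> pin (a * b).
Proof.
move=> [a1 a2 a3] [b1 b2 b3]; split; rewrite ?trM.
- by rewrite mulrA -(mulrA a) b1 mulr1.
- by rewrite mulrA -(mulrA (tr A b)) a2 mulr1.
move=> v; have [w bw] := b3 v; have [u au] := a3 w; exists u.
by rewrite -au -bw rmorphM /= !mulrA.
Qed.

Hypotheses (q_scalar : forall x, scalar (q x)) (q_sym : forall x y, q x y = q y x).
Hypothesis (q_pos : forall x, x != 0 -> 0 < q x x).

(** As a unit vector squares to -1, two-sided multiplication by it is the reflection without any
    extra sign. *)
Lemma gam_conj e v : q e e = 1 ->
  gam e * gam v * gam e = gam (v - 2 * q v e *: e).
Proof.
move=> ee; have h := gam_rel A e v.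
have -> : gam e * gam v = (- 2 * q e v)%:A - gam v * gam e by rewrite -h addrK.
rewrite mulrBl -mulrA gam_sqr ee scale1r mulrN1 opprK mulr_algl.
by rewrite linearB linearZ /= addrC q_sym mulNr scaleNr.
Qed.

Lemma pin_unit e : q e e = 1 -> pin (gam e).
Proof.
move=> ee; have g2 : gam e * gam e = -1 by rewrite gam_sqr ee scale1r.
split; rewrite ?trE ?mulrN ?mulNr ?g2 ?opprK // => v.
exists (v - 2 * q v e *: e).
by rewrite epsE mulrN !mulNr opprK gam_conj.
Qed.

(** Combinations of the ordered monomials in [es], splitting off one generator at a time.
    Independence of the monomials is not asserted. *)
Fixpoint reduced (es : seq V) (a : A) : Prop :=
  if es is e :: es' then
    exists b c, [/\ reduced es' b, reduced es' c & a = b + gam e * c]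
  else exists r : R, a = r%:A.

Lemma reducedL es r a b : reduced es a -> reduced es b -> reduced es (r *: a + b).
Proof.
elim: es a b => [|e es IH] a b /=.
  move=> [s ->] [t ->]; exists (r * s + t).
  by rewrite scalerA -scalerDl.
move=> [a1 [a2 [ra1 ra2 ->]]] [b1 [b2 [rb1 rb2 ->]]].
exists (r *: a1 + b1), (r *: a2 + b2); split; [exact: IH|exact: IH|].
by rewrite mulrDr -scalerAr scalerDr addrACA.
Qed.

Lemma reduced0 es : reduced es 0.
Proof.
elim: es => [|e es IH] /=; first by exists 0; rewrite scale0r.
by exists 0, 0; split=> //; rewrite mulr0 addr0.
Qed.

Lemma reduced1 es : reduced es 1.
Proof.
elim: es => [|e es IH] /=; first by exists 1; rewrite scale1r.
by exists 1, 0; split=> //; [exact: reduced0|rewrite mulr0 addr0].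
Qed.

Lemma reducedZ es r a : reduced es a -> reduced es (r *: a).
Proof. by move=> ra; rewrite -[r *: a]addr0; apply: reducedL => //; exact: reduced0. Qed.

Lemma reducedN es a : reduced es a -> reduced es (- a).
Proof. by rewrite -scaleN1r; exact: reducedZ. Qed.

Lemma reduced_gam es e a : orthonormal_seq q es -> e \in es -> reduced es a ->
  reduced es (gam e * a).
Proof.
elim: es a => // f es IH a /= [ff fo on] + [b [c [rb rc ->]]].
rewrite inE => /orP[/eqP->|ees].
  exists (- c), b; split=> //; first exact: reducedN.
  by rewrite mulrDr mulrA gam_sqr ff scale1r mulN1r addrC.
exists (gam e * b), (- (gam e * c)).
split; [exact: IH|apply: reducedN; exact: IH|].
by rewrite mulrDr mulrA gam_anti 1?q_sym ?fo // mulNr mulrN mulrA.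
Qed.

Lemma reduced_all es a : orthonormal_seq q es -> <<es>>%VS = fullv -> reduced es a.
Proof.
move=> on sp; suff h : forall b, reduced es b -> reduced es (a * b).
  by rewrite -[a]mulr1; apply/h/reduced1.
move: a; apply: cl_ind => [b|v b rb|r a a' ha ha' b rb|a a' ha ha' b rb].
- by rewrite mul1r.
- rewrite (on_expand q_scalar q_sym q_pos on (_ : v \in _)) ?sp ?memvf //.
  rewrite linear_sum mulr_suml big_seq.
  elim/big_ind: _ => [|x y rx ry|e ees]; first exact: reduced0.
    by rewrite -[x]scale1r; apply: reducedL.
  by rewrite linearZ /= -scalerAl; apply/reducedZ/reduced_gam.
- by rewrite mulrDl -scalerAl; apply: reducedL; [exact: ha|exact: ha'].
- by rewrite -mulrA; apply: ha; exact: ha'.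
Qed.

Lemma reduced_supercomm es e a : {in es, forall f, q e f = 0} -> reduced es a ->
  eps A a * gam e = gam e * a.
Proof.
elim: es a => [|f es IH] a eo /=.
  by move=> [r ->]; rewrite linearZ /= rmorph1 mulr_algl mulr_algr.
move=> [b [c [rb rc ->]]].
have eo' : {in es, forall f, q e f = 0} by move=> g ges; apply: eo; rewrite inE ges orbT.
rewrite rmorphD rmorphM /= epsE mulrDl IH // -mulrA IH // mulrA mulNr.
by rewrite -gam_anti ?eo ?mem_head // -mulrA mulrDr.
Qed.

(** Write [a = b + gam e * c] with [b] and [c] free of [e]. Supercommutation with [gam e] holds for
    [b] and produces [c] on one side and [- c] on the other, so [c = 0]; induction removes every
    generator. *)
Lemma supercentral a : (forall v, eps A a * gam v = gam v * a) ->
  exists r : R, a = r%:A.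
Proof.
have [es [on sp]] := orthonormal_basis q_scalar q_sym q_pos fullv.
have := reduced_all a on sp; move: on {sp} => + + ca.
elim: es => //= e es IH [ee eo on] [b [c [rb rc aE]]].
suff c0 : c = 0 by apply: IH => //; rewrite aE c0 mulr0 addr0.
have := ca e; rewrite aE rmorphD rmorphM /= epsE mulrDl -mulrA.
rewrite !(reduced_supercomm eo) // mulrDr => /addrI.
rewrite !mulrA mulNr gam_sqr ee scale1r opprK mul1r mulN1r => /eqP.
rewrite -addr_eq0 -mulr2n -scaler_nat scaler_eq0 pnatr_eq0 /=.
by move/eqP.
Qed.

Lemma pin_kernel (a : A) : pin a -> (forall v, eps A a * gam v * tr A a = gam v) ->
  a = 1 \/ a = -1.
Proof.
move=> [a1 a2 _] ca.
have [v|r aE] := @supercentral a.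
  by rewrite -[in RHS]ca -!mulrA a2 mulr1.
move: a1; rewrite aE linearZ /= tr1 mulr_algl scalerA => /eqP.
rewrite -subr_eq0 -{2}(scale1r 1) -scalerBl scaler_eq0 => /orP[|/eqP e10].
  by rewrite subr_eq0 -expr2 sqrf_eq1 => /orP[]/eqP->; [left|right]; rewrite ?scaleN1r ?scale1r.
(* Here [1 = 0] in the algebra, a case that the universal property as stated leaves open; then all
   elements coincide. *)
by left; rewrite -[LHS]mulr1 e10 mulr0.
Qed.

End Clifford.

Section Inclusion.
Variables (R : realType) (V1 V2 : vectType R) (q1 : V1 -> V1 -> R) (q2 : V2 -> V2 -> R).
Variables (A1 : clifford q1) (A2 : clifford q2) (i : V1 -> V2).
Variables (j : {lrmorphism A1 -> A2}) (jE : forall v, j (gam A1 v) = gam A2 (i v)).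

Lemma incl_eps a : j (eps A1 a) = eps A2 (j a).
Proof.
move: a; apply: cl_ind => [|v|r a b ha hb|a b ha hb].
- by rewrite !rmorph1.
- by rewrite epsE rmorphN /= jE epsE.
- by rewrite !linearP /= ha hb.
- by rewrite !rmorphM /= ha hb.
Qed.

Lemma incl_tr a : j (tr A1 a) = tr A2 (j a).
Proof.
move: a; apply: cl_ind => [|v|r a b ha hb|a b ha hb].
- by rewrite tr1 !rmorph1 tr1.
- by rewrite trE rmorphN /= jE trE.
- by rewrite !linearP /= ha hb.
- by rewrite trM !rmorphM /= ha hb trM.
Qed.

(** A vector orthogonal to the smaller space anticommutes with each of its vectors, hence
    supercommutes with the algebra that they generate. *)
Lemma incl_ortho a w : (forall v, q2 (i v) w = 0) ->
  eps A2 (j a) * gam A2 w = gam A2 w * j a.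
Proof.
move=> wo; rewrite -incl_eps; move: a; apply: cl_ind => [|v|r a b ha hb|a b ha hb].
- by rewrite !rmorph1 mul1r mulr1.
- by rewrite epsE rmorphN /= jE mulNr (gam_anti A2 (wo v)) opprK.
- by rewrite !linearP /= mulrDl mulrDr -scalerAl -scalerAr ha hb.
- by rewrite !rmorphM /= -mulrA hb mulrA ha mulrA.
Qed.

End Inclusion.

Section Pairs.
Variable B : pzRingType.

Fixpoint pairs (s : seq B) : seq (B * B) :=
  if s is a :: s' then if s' is b :: s'' then (a, b) :: pairs s'' else [::] else [::].

Fixpoint unpaired (s : seq B) : seq B :=
  if s is a :: s' then if s' is b :: s'' then unpaired s'' else [:: a] else [::].

Lemma pair_ind (Q : seq B -> Prop) : Q [::] -> (forall a, Q [:: a]) ->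
  (forall a b s, Q s -> Q (a :: b :: s)) -> forall s, Q s.
Proof.
move=> Q0 Q1 Q2 s; suff: Q s /\ forall a, Q (a :: s) by case.
by elim: s => // a s [? ?]; split=> // b; exact: Q2.
Qed.

Fixpoint anticommuting (s : seq B) : Prop :=
  if s is e :: s' then
    [/\ e * e = -1, {in s', forall f, anti e f} & anticommuting s'] else True.

Lemma on_pairsP (Q : B -> Prop) s : {in s, forall e, Q e} -> on_pairs Q (pairs s).
Proof.
elim/pair_ind: s => // a b s IH Qs /=; split.
- by apply: Qs; rewrite mem_head.
- by apply: Qs; rewrite !inE eqxx orbT.
- by apply: IH => e es; apply: Qs; rewrite !inE es !orbT.
Qed.

Lemma on_pairs_all (Q : B -> Prop) s : on_pairs Q (pairs s) ->
  {in unpaired s, forall e, Q e} -> {in s, forall e, Q e}.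
Proof.
elim/pair_ind: s => // a b s IH /= [Qa Qb Qs] Qu e.
by rewrite !inE => /or3P[/eqP->|/eqP->|] //; exact: IH.
Qed.

Lemma sub_unpaired s : {subset unpaired s <= s}.
Proof.
elim/pair_ind: s => [|a|a b s IH] // e /IH; rewrite !inE => ->.
by rewrite !orbT.
Qed.

Lemma size_unpaired s : size (unpaired s) = odd (size s).
Proof. by elim/pair_ind: s => // a b s -> /=; rewrite negbK. Qed.

Lemma anticommuting_pairs s : anticommuting s ->
  clifford_pairs (pairs s) /\ {in unpaired s, forall e,
    e * e = -1 /\ on_pairs (anti e) (pairs s)}.
Proof.
elim/pair_ind: s => // [a [a2 _ _]|a b s IH /= [a2 an [b2 bn /IH[cs us]]]].
  by split=> // e; rewrite inE => /eqP->; split.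
have an' : {in s, forall f, anti a f} by move=> f fs; apply: an; rewrite inE fs orbT.
split; first split=> //.
- by apply: an; rewrite mem_head.
- by split; apply: on_pairsP.
move=> e eu; have es := sub_unpaired eu; have [e2 eo] := us _ eu.
by split=> //; split=> //; apply/antiC; [exact: an'|exact: bn].
Qed.

End Pairs.

(** * Simple Clifford modules as primitive idempotents *)

Section Modules.
Variables (R : realType) (V : vectType R) (q : V -> V -> R) (A : clifford q).
Notation C := R[i].

Lemma cl_moduleZ (T : vectType C) (s : A -> 'End(T)) r a :
  cl_module s -> s (r *: a) = r%:C *: s a.
Proof.
move=> [_ _ sl]; have s0 : s 0 = 0.
  apply/eqP; rewrite -(subrr (s 0)) -[X in _ == X - _](_ : s (1 *: 0 + 0) = _).
    by rewrite sl scale1r addrK.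
  by rewrite scaler0 addr0.
by rewrite -[r *: a]addr0 sl s0 addr0.
Qed.

Lemma cl_module0 (T : vectType C) (s : A -> 'End(T)) : cl_module s -> s 0 = 0.
Proof. by move=> /cl_moduleZ h; rewrite -(scale0r 0) h scale0r. Qed.

Lemma cl_moduleD (T : vectType C) (s : A -> 'End(T)) a b :
  cl_module s -> s (a + b) = s a + s b.
Proof. by move=> [_ _ sl]; rewrite -{1}(scale1r a) sl scale1r. Qed.

Lemma cl_moduleN (T : vectType C) (s : A -> 'End(T)) a : cl_module s -> s (- a) = - s a.
Proof. by move=> ms; rewrite -scaleN1r cl_moduleZ // rmorphN rmorph1 scaleN1r. Qed.

(** A form of Schur's lemma for idempotents: the image of [f] is a submodule, hence zero or
    everything. *)
Lemma cl_simple_idem (T : vectType C) (s : A -> 'End(T)) (f : 'End(T)) :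
  cl_simple s -> (f \o f)%VF = f -> (forall a, (f \o s a)%VF = (s a \o f)%VF) ->
  f = 0 \/ f = \1%VF.
Proof.
move=> [_ [_ irr]] ff fs; have [a _|f0|f1] := irr (limg f).
- apply/subvP => _ /memv_imgP[_ /memv_imgP[x _ ->] ->].
  by rewrite -comp_lfunE -fs comp_lfunE memv_img ?memvf.
- left; apply/lfunP => x; apply/eqP.
  by rewrite zero_lfunE -memv0 -f0 memv_img ?memvf.
- right; apply/lfunP => x; rewrite id_lfunE.
  have : x \in limg f by rewrite f1 memvf.
  by case/memv_imgP => y _ ->; rewrite -comp_lfunE ff.
Qed.

Variables (W : vectType C) (big : A -> 'End(W)).

Definition commutes (x : endo W) : Prop := forall a, GRing.comm x (big a : endo W).

(** An idempotent of the commutant below the projection onto [T] restricts to an idempotent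
    endomorphism [f] of the simple module [T], which is 0 or the identity. *)
Lemma simple_primitive (T : vectType C) (s : A -> 'End(T)) (i : 'Hom(T, W))
    (p : 'Hom(W, T)) : cl_simple s -> (p \o i)%VF = \1%VF ->
  (forall a, (i \o s a)%VF = (big a \o i)%VF) ->
  (forall a, (s a \o p)%VF = (p \o big a)%VF) ->
  primitive_in commutes ((i \o p)%VF : endo W).
Proof.
move=> ss pi is_ sp; split.
- by rewrite /GRing.mul /= comp_lfunA -(comp_lfunA i) pi comp_lfun1r.
- move=> a; rewrite /GRing.comm /GRing.mul /= -comp_lfunA -sp !comp_lfunA is_ //.
- apply/negP => /eqP ip0; have [_ [dT _]] := ss.
  have : (\1%VF : 'End(T)) = 0.
    rewrite -(comp_lfun1l \1%VF) -{1}pi -{1}pi comp_lfunA -(comp_lfunA p).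
    by rewrite [(i \o p)%VF]ip0 comp_lfun0r comp_lfun0l.
  move=> /lfunP e; have : (fullv : {vspace T}) = 0%VS.
    apply/eqP; rewrite -subv0; apply/subvP => x _.
    by have := e x; rewrite id_lfunE zero_lfunE memv0 => ->.
  by move=> f0; rewrite f0 dimv0 in dT.
move=> x cx xx qx xq.
pose f := (p \o (x : 'End(W)) \o i)%VF.
have xE : x = (i \o f \o p)%VF.
  by rewrite -{1}qx -{1}xq /GRing.mul /= !comp_lfunA.
have [||f0|f1] := @cl_simple_idem _ s f ss.
- rewrite /f -!comp_lfunA; congr (_ \o _)%VF; rewrite !comp_lfunA; congr (_ \o _)%VF.
  have qx' : ((i \o p) \o (x : 'End(W)))%VF = x := qx.
  by rewrite -(comp_lfunA _ i p) -comp_lfunA qx'; exact: xx.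
- move=> a; rewrite /f -!comp_lfunA is_ !comp_lfunA sp; congr (_ \o _)%VF.
  by rewrite -!comp_lfunA; congr (_ \o _)%VF; exact: cx.
- by left; rewrite xE f0 comp_lfun0r comp_lfun0l.
- by right; rewrite xE f1 comp_lfun1r.
Qed.

Lemma frame_iso (T1 T2 : vectType C) (s1 : A -> 'End(T1)) (s2 : A -> 'End(T2))
    (i1 : 'Hom(T1, W)) (p1 : 'Hom(W, T1)) (i2 : 'Hom(T2, W)) (p2 : 'Hom(W, T2))
    (u v : 'I_1 -> endo W) :
  (p1 \o i1)%VF = \1%VF -> (p2 \o i2)%VF = \1%VF ->
  (forall a, (i1 \o s1 a)%VF = (big a \o i1)%VF) ->
  (forall a, (s2 a \o p2)%VF = (p2 \o big a)%VF) ->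
  frame ((i1 \o p1)%VF : endo W) ((i2 \o p2)%VF : endo W) u v ->
  commutes (u ord0) ->
  isomorphic_act (fun=> True) (fun a => s1 a : _ -> _) (fun a => s2 a : _ -> _).
Proof.
move=> pi1 pi2 is1 sp2 [uP vP uv suv] cu.
pose f := (p2 \o (u ord0 : 'End(W)) \o i1)%VF.
pose g := (p1 \o (v ord0 : 'End(W)) \o i2)%VF.
have pi1E x : p1 (i1 x) = x by rewrite -comp_lfunE pi1 id_lfunE.
have pi2E x : p2 (i2 x) = x by rewrite -comp_lfunE pi2 id_lfunE.
have [u1 u2] := uP ord0; have [v1 v2] := vP ord0.
have uE x : i2 (p2 ((u ord0 : 'End(W)) x)) = (u ord0 : 'End(W)) x.
  by rewrite -{2}u1 mulE comp_lfunE.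
have vE x : i1 (p1 ((v ord0 : 'End(W)) x)) = (v ord0 : 'End(W)) x.
  by rewrite -{2}v1 mulE comp_lfunE.
exists f; first split=> [|a _ x]; first exact: linearP.
  rewrite /f !comp_lfunE -[s2 a _]comp_lfunE sp2 -[i1 _]comp_lfunE is1 !comp_lfunE.
  by congr (p2 _); rewrite -!mulE cu.
exists g => x; rewrite /f /g !comp_lfunE.
  by rewrite uE -mulE uv eqxx comp_lfunE !pi1E.
rewrite vE -mulE; move: suv; rewrite big_ord_recl big_ord0 addr0 => ->.
by rewrite comp_lfunE !pi2E.
Qed.

End Modules.

Section OddSplit.
Variables (R : realType) (V : vectType R) (q : V -> V -> R) (A : clifford q).
Notation C := R[i].

(* The direct sum decomposition in is_spinor for odd dimension *)
Definition two_simples (T : vectType C) (s : A -> 'End(T)) : Prop :=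
  exists (S1 S2 : vectType C) (r1 : A -> 'End(S1)) (r2 : A -> 'End(S2))
         (f1 : 'Hom(S1, T)) (f2 : 'Hom(S2, T)),
    [/\ cl_simple r1, cl_simple r2,
        ~ isomorphic_act (fun=> True) (fun a => r1 a : _ -> _)
            (fun a => r2 a : _ -> _),
        (forall a x, f1 (r1 a x) = s a (f1 x)) /\
        (forall a x, f2 (r2 a x) = s a (f2 x))
      & bijective (fun x : S1 * S2 => f1 x.1 + f2 x.2)].

Variables (W : vectType C) (big : A -> 'End(W)).
Variables (l : seq (endo W * endo W)) (e : endo W).
Hypotheses (wl : clifford_pairs l) (e2 : e * e = -1) (el : on_pairs (anti e) l).
Notation K := (comml l (eq e)).
Hypothesis (KP : forall x, K x <-> commutes big x).

Lemma primitive_ext (B : pzRingType) (K1 K2 : B -> Prop) x :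
  (forall y, K1 y <-> K2 y) -> primitive_in K1 x -> primitive_in K2 x.
Proof. by move=> h [a /h b c d]; split=> // y /h; exact: d. Qed.

(** The two primitive idempotents project onto the two simple summands; their chiralities differ
    because the summands are inequivalent. *)
Lemma odd_split (T : vectType C) (s : A -> 'End(T)) (i : 'Hom(T, W)) (p : 'Hom(W, T)) :
  two_simples s -> (p \o i)%VF = \1%VF ->
  (forall a, (i \o s a)%VF = (big a \o i)%VF) ->
  (forall a, (s a \o p)%VF = (p \o big a)%VF) ->
  exists (b1 b2 : bool) q1 q2, [/\ b1 != b2, primitive_in K q1 /\ primitive_in K q2,
    chir e b1 * (vac (iiW W) (halfW W) l * q1) = vac (iiW W) (halfW W) l * q1 /\
    chir e b2 * (vac (iiW W) (halfW W) l * q2) = vac (iiW W) (halfW W) l * q2,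
    q1 * q2 = 0 /\ q2 * q1 = 0 & q1 + q2 = (i \o p)%VF].
Proof.
move=> [S1 [S2 [r1 [r2 [f1 [f2 [s1 s2 niso [f1s f2s] [h hK Kh]]]]]]]] pi is_ sp.
pose F (x : S1 * S2) := f1 x.1 + f2 x.2.
have Finj : injective F by exact: can_inj hK.
have Flin : linear F.
  by move=> a x y; rewrite /F /= !linearP /= scalerDr addrACA.
have hlin : linear h.
  by move=> a x y; apply: Finj; rewrite Flin /F !Kh.
have h1lin : linear (fun x => (h x).1) by move=> a x y; rewrite hlin.
have h2lin : linear (fun x => (h x).2) by move=> a x y; rewrite hlin.
pose p1 : 'Hom(T, S1) := linfun (fun x => (h x).1).
pose p2 : 'Hom(T, S2) := linfun (fun x => (h x).2).
have p1E x : p1 x = (h x).1 by rewrite linfunE.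
have p2E x : p2 x = (h x).2 by rewrite linfunE.
have hf1 x : h (f1 x) = (x, 0) by rewrite -(hK (x, 0)) /= linear0 addr0.
have hf2 x : h (f2 x) = (0, x) by rewrite -(hK (0, x)) /= linear0 add0r.
have hs a x : h (s a x) = (r1 a (h x).1, r2 a (h x).2).
  by apply: Finj; rewrite /F Kh /= f1s f2s -linearD Kh.
have p1f1 : (p1 \o f1)%VF = \1%VF by apply/lfunP => x; rewrite comp_lfunE id_lfunE p1E hf1.
have p2f2 : (p2 \o f2)%VF = \1%VF by apply/lfunP => x; rewrite comp_lfunE id_lfunE p2E hf2.
have p1f2 x : p1 (f2 x) = 0 by rewrite p1E hf2.
have p2f1 x : p2 (f1 x) = 0 by rewrite p2E hf1.
have f1r a : (f1 \o r1 a)%VF = (s a \o f1)%VF.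
  by apply/lfunP => x; rewrite !comp_lfunE f1s.
have f2r a : (f2 \o r2 a)%VF = (s a \o f2)%VF.
  by apply/lfunP => x; rewrite !comp_lfunE f2s.
have rp1 a : (r1 a \o p1)%VF = (p1 \o s a)%VF.
  by apply/lfunP => x; rewrite !comp_lfunE !p1E hs.
have rp2 a : (r2 a \o p2)%VF = (p2 \o s a)%VF.
  by apply/lfunP => x; rewrite !comp_lfunE !p2E hs.
have pi1 : ((p1 \o p) \o (i \o f1))%VF = \1%VF.
  by rewrite comp_lfunA -(comp_lfunA p1) pi comp_lfun1r.
have pi2 : ((p2 \o p) \o (i \o f2))%VF = \1%VF.
  by rewrite comp_lfunA -(comp_lfunA p2) pi comp_lfun1r.
have i1s a : ((i \o f1) \o r1 a)%VF = (big a \o (i \o f1))%VF.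
  by rewrite -comp_lfunA f1r !comp_lfunA is_.
have i2s a : ((i \o f2) \o r2 a)%VF = (big a \o (i \o f2))%VF.
  by rewrite -comp_lfunA f2r !comp_lfunA is_.
have sp1 a : (r1 a \o (p1 \o p))%VF = ((p1 \o p) \o big a)%VF.
  by rewrite comp_lfunA rp1 -!comp_lfunA sp.
have sp2 a : (r2 a \o (p2 \o p))%VF = ((p2 \o p) \o big a)%VF.
  by rewrite comp_lfunA rp2 -!comp_lfunA sp.
have piE x : p (i x) = x by rewrite -comp_lfunE pi id_lfunE.
have := simple_primitive s1 pi1 i1s sp1; have := simple_primitive s2 pi2 i2s sp2.
set q1 : endo W := ((i \o f1) \o (p1 \o p))%VF.
set q2 : endo W := ((i \o f2) \o (p2 \o p))%VF.
have KP' x : commutes big x <-> K x by rewrite KP.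
move=> /(primitive_ext KP') P2 /(primitive_ext KP') P1.
have [b1 [_ z1]] := primitive_type wl e2 el P1.
have [b2 [_ z2]] := primitive_type wl e2 el P2.
exists b1, b2, q1, q2; split=> //; last first.
- apply: endoP => x; rewrite addE /q1 /q2 !comp_lfunE -linearD; congr (i _).
  by rewrite p1E p2E Kh.
- by split; apply: endoP => x; rewrite mulE /q1 /q2 !comp_lfunE piE ?p1f2 ?p2f1 !linear0 zero_lfunE.
(* Equal chiralities would give a frame of size one between the summands, that is, an
   isomorphism. *)
apply/eqP => b12; rewrite -b12 in z2.
have [u [v [uv uvK]]] := same_type_frame wl e2 el P1 P2 z1 z2.
apply: niso; apply: (frame_iso pi1 pi2 i1s sp2 uv).
by apply/KP; case: (uvK ord0).
Qed.

End OddSplit.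

(** * The restriction of a spinor module to a smaller Clifford algebra *)

Section SpinorRestriction.
Variables (R : realType) (V1 V2 : vectType R).
Variables (q1 : V1 -> V1 -> R) (q2 : V2 -> V2 -> R).
Hypotheses (q1_scalar : forall x, scalar (q1 x)) (q1_sym : forall x y, q1 x y = q1 y x)
  (q1_pos : forall x, x != 0 -> 0 < q1 x x).
Hypotheses (q2_scalar : forall x, scalar (q2 x)) (q2_sym : forall x y, q2 x y = q2 y x)
  (q2_pos : forall x, x != 0 -> 0 < q2 x x).
Variables (A1 : clifford q1) (A2 : clifford q2).
Variables (incl : {linear V1 -> V2}) (incl_q : forall x y, q2 (incl x) (incl y) = q1 x y).
Variables (j : {lrmorphism A1 -> A2}) (jE : forall v, j (gam A1 v) = gam A2 (incl v)).
Variables (S1 S2 : vectType R[i]) (rho1 : A1 -> 'End(S1)) (rho2 : A2 -> 'End(S2)).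
Hypotheses (spin1 : is_spinor rho1) (spin2 : is_spinor rho2).

Lemma is_spinor_module (V : vectType R) (q : V -> V -> R) (A : clifford q)
  (T : vectType R[i]) (s : A -> 'End(T)) : is_spinor s -> cl_module s.
Proof. by rewrite /is_spinor; case: ifP => _ []. Qed.

Lemma incl_inj : injective incl.
Proof.
move=> x y xy; apply: (q_inj q1_scalar q1_sym q1_pos) => z.
by rewrite -!incl_q xy.
Qed.

Let m1 := is_spinor_module spin1.
Let m2 := is_spinor_module spin2.

(** Both modules are placed in one space with an action [big] of the smaller algebra, so that they
    can be compared as idempotents of a single commutant. *)
Let W : vectType R[i] := (S1 * S2)%type.
Let in1 : 'Hom(S1, W) := linfun (fun x => (x, 0)).
Let in2 : 'Hom(S2, W) := linfun (fun x => (0, x)).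
Let pr1 : 'Hom(W, S1) := linfun (fun x => x.1).
Let pr2 : 'Hom(W, S2) := linfun (fun x => x.2).
Let big (a : A1) : 'End(W) := linfun (fun x => (rho1 a x.1, rho2 (j a) x.2)).

Let in1E x : in1 x = (x, 0).
Proof. by rewrite linfunE // => a y z; congr (_, _); rewrite /= scaler0 addr0. Qed.
Let in2E x : in2 x = (0, x).
Proof. by rewrite linfunE // => a y z; congr (_, _); rewrite /= scaler0 addr0. Qed.
Let pr1E x : pr1 x = x.1. Proof. by rewrite linfunE. Qed.
Let pr2E x : pr2 x = x.2. Proof. by rewrite linfunE. Qed.
Let bigE a x : big a x = (rho1 a x.1, rho2 (j a) x.2).
Proof. by rewrite linfunE // => r y z; congr (_, _); rewrite /= linearP. Qed.

Let pi1 : (pr1 \o in1)%VF = \1%VF.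
Proof. by apply/lfunP => x; rewrite comp_lfunE in1E pr1E id_lfunE. Qed.
Let pi2 : (pr2 \o in2)%VF = \1%VF.
Proof. by apply/lfunP => x; rewrite comp_lfunE in2E pr2E id_lfunE. Qed.
Let in1_big a : (in1 \o rho1 a)%VF = (big a \o in1)%VF.
Proof. by apply/lfunP => x; rewrite !comp_lfunE !in1E bigE /= linear0. Qed.
Let in2_big a : (in2 \o rho2 (j a))%VF = (big a \o in2)%VF.
Proof. by apply/lfunP => x; rewrite !comp_lfunE !in2E bigE /= linear0. Qed.
Let big_pr1 a : (rho1 a \o pr1)%VF = (pr1 \o big a)%VF.
Proof. by apply/lfunP => x; rewrite !comp_lfunE !pr1E bigE. Qed.
Let big_pr2 a : (rho2 (j a) \o pr2)%VF = (pr2 \o big a)%VF.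
Proof. by apply/lfunP => x; rewrite !comp_lfunE !pr2E bigE. Qed.

Let bigM a b : (big (a * b) : endo W) = (big a : endo W) * (big b : endo W).
Proof.
apply: endoP => x; rewrite mulE !bigE rmorphM /=.
by have [_ -> _] := m1; have [_ -> _] := m2; rewrite !comp_lfunE.
Qed.
Let bigone : (big 1 : endo W) = 1.
Proof.
apply: endoP => x; rewrite bigE oneE rmorph1.
by have [-> _ _] := m1; have [-> _ _] := m2; rewrite !id_lfunE; case: x.
Qed.
Let bigL r a b : big (r *: a + b) = r%:C *: big a + big b.
Proof.
apply/lfunP => x; rewrite bigE linearP /=.
have [_ _ ->] := m1; have [_ _ ->] := m2.
by rewrite !add_lfunE !scale_lfunE !bigE.
Qed.
Let bigN a : (big (- a) : endo W) = - (big a : endo W).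
Proof.
apply: endoP => x; rewrite oppE !bigE rmorphN /= !cl_moduleN // !opp_lfunE.
by [].
Qed.

Lemma commutes_gen (es : seq V1) (x : endo W) : <<es>>%VS = fullv ->
  orthonormal_seq q1 es ->
  {in map (fun v => big (gam A1 v) : endo W) es, forall e, GRing.comm x e} ->
  commutes big x.
Proof.
move=> sp on ce; apply: cl_ind => [|v|r a b ha hb|a b ha hb].
- by rewrite bigone; exact: commr1.
- rewrite (on_expand q1_scalar q1_sym q1_pos on (_ : v \in _)) ?sp ?memvf //.
  rewrite linear_sum big_seq.
  elim/big_ind: _ => [|a b ha hb|f fes].
  + have -> : big 0 = 0.
      by apply/lfunP => y; rewrite bigE rmorph0 !cl_module0 // !zero_lfunE.
    exact: commr0.
  + by rewrite -[a]scale1r bigL scale1r; exact: commrD.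
  + have -> : big (gam A1 (q1 v f *: f)) = (q1 v f)%:C *: big (gam A1 f).
      apply/lfunP => y; rewrite scale_lfunE !bigE linearZ /= linearZ /=.
      by rewrite !cl_moduleZ // !scale_lfunE.
    have cx := ce _ (map_f _ fes).
    have cxy y : (x : 'End(W)) (big (gam A1 f) y) = big (gam A1 f) ((x : 'End(W)) y).
      by rewrite -!mulE cx.
    by apply: endoP => y; rewrite !mulE !scale_lfunE linearZ /= cxy.
- rewrite /GRing.comm; apply: endoP => y.
  have /(congr1 (fun f : endo W => (f : 'End(W)) y)) := ha.
  have /(congr1 (fun f : endo W => (f : 'End(W)) y)) := hb.
  by rewrite !mulE bigL !add_lfunE !scale_lfunE linearP /= => hb' ha'; rewrite ha' hb'.
- by rewrite bigM; exact: commrM.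
Qed.

(** The restriction of [S2] is a direct sum of [r] copies of [S1], recorded by its inclusions and
    projections, since these are what later acts on intertwiners. *)
Definition restricted_sum (r : nat) : Prop :=
  exists (iota : 'I_r -> 'Hom(S1, S2)) (pi : 'I_r -> 'Hom(S2, S1)),
  [/\ forall t a, (iota t \o rho1 a)%VF = (rho2 (j a) \o iota t)%VF,
      forall t a, (pi t \o rho2 (j a))%VF = (rho1 a \o pi t)%VF,
      forall t t', (pi t \o iota t')%VF = if t == t' then \1%VF else 0
    & \sum_t (iota t \o pi t)%VF = \1%VF].

Lemma frame_restricted_sum r (u v : 'I_r -> endo W) :
  frame ((in1 \o pr1)%VF : endo W) ((in2 \o pr2)%VF : endo W) u v ->
  (forall t, commutes big (u t) /\ commutes big (v t)) -> restricted_sum r.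
Proof.
move=> [uP vP uv suv] c.
exists (fun t => pr2 \o (u t : 'End(W)) \o in1)%VF, (fun t => pr1 \o (v t : 'End(W)) \o in2)%VF.
have cu t a x : (u t : 'End(W)) (big a x) = big a ((u t : 'End(W)) x).
  by have [h _] := c t; rewrite -!mulE h.
have cv t a x : (v t : 'End(W)) (big a x) = big a ((v t : 'End(W)) x).
  by have [_ h] := c t; rewrite -!mulE h.
have in1b a x : in1 (rho1 a x) = big a (in1 x) by rewrite -!comp_lfunE in1_big.
have in2b a x : in2 (rho2 (j a) x) = big a (in2 x) by rewrite -!comp_lfunE in2_big.
have pr1b a x : pr1 (big a x) = rho1 a (pr1 x) by rewrite -!comp_lfunE big_pr1.
have pr2b a x : pr2 (big a x) = rho2 (j a) (pr2 x) by rewrite -!comp_lfunE big_pr2.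
have uE t x : in2 (pr2 ((u t : 'End(W)) x)) = (u t : 'End(W)) x.
  by have [h _] := uP t; rewrite -{2}h mulE comp_lfunE.
have vE t x : in1 (pr1 ((v t : 'End(W)) x)) = (v t : 'End(W)) x.
  by have [h _] := vP t; rewrite -{2}h mulE comp_lfunE.
have pr1in x : pr1 (in1 x) = x by rewrite -comp_lfunE pi1 id_lfunE.
have pr2in x : pr2 (in2 x) = x by rewrite -comp_lfunE pi2 id_lfunE.
split=> [t a|t a|t t'|]; apply/lfunP => x.
- by rewrite !comp_lfunE in1b cu pr2b.
- by rewrite !comp_lfunE in2b cv pr1b.
- rewrite !comp_lfunE uE -mulE uv; case: eqP => _; last by rewrite !zero_lfunE linear0.
  by rewrite comp_lfunE !pr1in id_lfunE.
- rewrite sum_lfunE id_lfunE -[RHS]pr2in -[in RHS](pr2in x).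
  have /(congr1 (fun f : endo W => (f : 'End(W)) (in2 x))) := suv.
  rewrite comp_lfunE sumE => <-; rewrite linear_sum.
  by apply: eq_bigr => t _; rewrite !comp_lfunE vE.
Qed.

Let gens (es : seq V1) : seq (endo W) := map (fun v => big (gam A1 v) : endo W) es.

Lemma gens_anticommuting es : orthonormal_seq q1 es -> anticommuting (gens es).
Proof.
elim: es => //= e es IH [ee eo on]; split; last exact: IH.
- by rewrite -bigM gam_sqr ee scale1r bigN bigone.
- by move=> _ /mapP[v ves ->]; rewrite /anti -!bigM (gam_anti _ (eo v ves)) bigN.
Qed.

Lemma comml_big es (G : endo W -> Prop) x : orthonormal_seq q1 es ->
  <<es>>%VS = fullv -> (forall e, G e <-> e \in unpaired (gens es)) ->
  comml (pairs (gens es)) G x <-> commutes big x.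
Proof.
move=> on sp GP; split.
  move=> [cl cG]; apply: (commutes_gen sp on); apply: (on_pairs_all cl).
  by move=> e /GP Ge; exact/commr_sym/cG.
move=> cx; split; first by apply: on_pairsP => _ /mapP[v _ ->]; exact: cx.
by move=> e /GP /sub_unpaired /mapP[v _ ->]; apply/commr_sym; exact: cx.
Qed.

Let id2_commutes : commutes big ((in2 \o pr2)%VF : endo W).
Proof.
move=> a; rewrite /GRing.comm /GRing.mul /= -comp_lfunA -big_pr2 !comp_lfunA.
by rewrite in2_big.
Qed.

Let id2_idem : ((in2 \o pr2)%VF : endo W) * ((in2 \o pr2)%VF : endo W) = (in2 \o pr2)%VF.
Proof. by rewrite /GRing.mul /= comp_lfunA -(comp_lfunA in2) pi2 comp_lfun1r. Qed.

Lemma orthogonal_unit (es : seq V1) : orthonormal_seq q1 es -> <<es>>%VS = fullv ->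
  \dim {:V1} != \dim {:V2} -> exists w, q2 w w = 1 /\ forall v, q2 (incl v) w = 0.
Proof.
move=> on sp dV.
have on2 : orthonormal_seq q2 (map incl es).
  elim: es on {sp} => //= e es IH [ee eo on]; split; rewrite ?incl_q //; last exact: IH.
  by move=> _ /mapP[f fes ->]; rewrite incl_q eo.
have /subvPn[w _ wn] : ~~ (fullv <= <<map incl es>>)%VS.
  apply: contra dV => h; rewrite -sp (eqP (on_free q1_scalar on)).
  have -> : fullv = <<map incl es>>%VS by apply/eqP; rewrite eqEsubv h subvf.
  by rewrite (eqP (on_free q2_scalar on2)) size_map.
pose u := w - \sum_(f <- map incl es) q2 w f *: f.
have uo := on_projP q2_scalar q2_sym w on2; rewrite -/u in uo.
have u0 : u != 0.
  apply: contraNneq wn => /eqP; rewrite subr_eq0 => /eqP ->.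
  by rewrite big_seq; apply: rpred_sum => f fes; rewrite rpredZ // memv_span.
have uu := q2_pos u0; pose s := (Num.sqrt (q2 u u))^-1.
exists (s *: u); split=> [|v].
  by rewrite (qZl q2_scalar q2_sym) (qZr q2_scalar) mulrA -expr2 exprVn sqr_sqrtr ?ltW // mulVf ?gt_eqF.
rewrite (qZr q2_scalar) q2_sym (on_expand q1_scalar q1_sym q1_pos on (_ : v \in _)) ?sp ?memvf //.
rewrite linear_sum (qsumr q2_scalar) big_seq big1 ?mulr0 // => f fes.
by rewrite linearZ /= (qZr q2_scalar) uo ?mulr0 // map_f.
Qed.

Theorem spinor_restriction : exists r, restricted_sum r.
Proof.
have [es [on sp]] := orthonormal_basis q1_scalar q1_sym q1_pos fullv.
have [wl wu] := anticommuting_pairs (gens_anticommuting on).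
have sz : size (gens es) = \dim {:V1}.
  by rewrite size_map -sp (eqP (on_free q1_scalar on)).
have szu := size_unpaired (gens es); rewrite sz in szu.
case: (boolP (odd (\dim {:V1}))) => dV1; rewrite ?dV1 ?(negPf dV1) /= in szu; last first.
  have nG e : False <-> e \in unpaired (gens es) by rewrite (size0nil szu).
  have KP := comml_big _ on sp nG.
  have simple1 : cl_simple rho1 by move: spin1; rewrite /is_spinor dV1.
  have KP' x : commutes big x <-> comml (pairs (gens es)) (fun=> False) x by rewrite KP.
  have P1 := primitive_ext KP' (simple_primitive simple1 pi1 in1_big big_pr1).
  have [u [v [uv c]]] := even_frame wl P1 ((KP' _).1 id2_commutes) id2_idem.
  by eexists; apply: (frame_restricted_sum uv) => t; have [/KP ? /KP ?] := c t.
have [e uE] : exists e, unpaired (gens es) = [:: e].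
  by move: szu; case: (unpaired _) => [|e []] //; exists e.
have eG f : e = f <-> f \in unpaired (gens es).
  by rewrite uE inE; split=> [->|/eqP].
have KP x := comml_big x on sp eG.
have [e2 el] : e * e = -1 /\ on_pairs (anti e) (pairs (gens es)).
  by apply: wu; rewrite uE mem_head.
have ts1 : two_simples rho1 by move: spin1; rewrite /is_spinor dV1 => -[].
have [b1 [b2 [p1 [p2 [b12 [P1 P2] [z1 z2] [p12 p21] p1D]]]]] :=
  odd_split wl e2 el KP ts1 pi1 in1_big big_pr1.
set q : endo W := (in2 \o pr2)%VF.
have Kq : comml (pairs (gens es)) (eq e) q by apply/KP.
(* As [S1] contains each chirality once, a whole number of copies of it requires both chiralities to
   be equally frequent in [S2]. *)
suff [r rk] : exists r, forall s,
    rank (chir e s * (vac (iiW W) (halfW W) (pairs (gens es)) * q)) = r.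
  have [u [v [uv c]]] := odd_frame wl e2 el b12 P1 P2 z1 z2 p12 p21 Kq id2_idem rk.
  rewrite p1D in uv.
  by exists r; apply: (frame_restricted_sum uv) => t; have [/KP ? /KP ?] := c t.
have [dV|dV] := eqVneq (\dim {:V1}) (\dim {:V2}); last first.
  have [w [ww wo]] := orthogonal_unit on sp dV.
  (* A unit vector orthogonal to [V1], acting on the summand [S2] and by zero on [S1], anticommutes
     with all of [V1] and so exchanges the chiralities. *)
  pose g : endo W := (in2 \o rho2 (gam A2 w) \o pr2)%VF.
  have gE x : (g : 'End(W)) x = (0, rho2 (gam A2 w) x.2).
    by rewrite !comp_lfunE in2E pr2E.
  have qE x : (q : 'End(W)) x = (0, x.2) by rewrite comp_lfunE in2E pr2E.
  have gv v : anti g (big (gam A1 v)).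
    apply: endoP => x; rewrite oppE !mulE gE !bigE gE /= linear0 jE.
    have [_ h _] := m2; rewrite -!comp_lfunE -!h.
    rewrite (gam_anti A2 (_ : q2 w (incl v) = 0)); last by rewrite q2_sym wo.
    by rewrite cl_moduleN // opp_lfunE; congr (_, _); rewrite oppr0.
  exists (rank (chir e true * (vac (iiW W) (halfW W) (pairs (gens es)) * q))).
  suff h : rank (chir e false * (vac (iiW W) (halfW W) (pairs (gens es)) * q)) =
      rank (chir e true * (vac (iiW W) (halfW W) (pairs (gens es)) * q)) by case.
  apply: (rank_chir (g := g)) => //.
  - apply: endoP => x; rewrite oppE mulE !gE qE /=.
    have [_ h _] := m2; rewrite -comp_lfunE -h gam_sqr ww scale1r cl_moduleN //.
    by have [-> _ _] := m2; rewrite opp_lfunE id_lfunE; congr (_, _); rewrite oppr0.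
  - by apply: endoP => x; rewrite !mulE !qE !gE.
  - have : e \in gens es by apply: sub_unpaired; rewrite uE mem_head.
    by case/mapP => v _ ->.
  - by apply: on_pairsP => _ /mapP[v _ ->].
(* In equal dimensions [j] is onto, so the two simple summands of [S2] remain simple and
   inequivalent over the smaller algebra: one of each chirality, both of rank one. *)
have jsurj a : exists a1, j a1 = a.
  have isurj v : exists v1, incl v1 = v.
    have h : limg (linfun incl) = fullv.
      apply/eqP; rewrite eqEdim subvf /= limg_dim_eq ?dV //.
      apply/eqP; rewrite -subv0; apply/subvP => x; rewrite memv_cap memv_ker memv0 lfunE /=.
      by rewrite -(linear0 incl) => /andP[_ /eqP/incl_inj ->].
    have : v \in limg (linfun incl) by rewrite h memvf.
    by case/memv_imgP => v1 _ ->; exists v1; rewrite lfunE.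
  move: a; apply: cl_ind => [|v|r a b [a' <-] [b' <-]|a b [a' <-] [b' <-]].
  - by exists 1; rewrite rmorph1.
  - by have [v1 <-] := isurj v; exists (gam A1 v1); rewrite jE.
  - by exists (r *: a' + b'); rewrite linearP.
  - by exists (a' * b'); rewrite rmorphM.
have ts2 : two_simples (fun a => rho2 (j a)).
  have : two_simples rho2 by move: spin2; rewrite /is_spinor -dV dV1 => -[].
  have simple_j (T : vectType R[i]) (s : A2 -> 'End(T)) : cl_simple s -> cl_simple (fun a => s (j a)).
    move=> [[s1 sM sL] [dT irr]]; split; last first.
      split=> // X h; apply: irr => a _; have [a1 <-] := jsurj a; exact: h.
    by split=> [|a b|r a b]; rewrite ?rmorph1 ?rmorphM ?linearP.
  move=> [T1 [T2 [r1 [r2 [f1 [f2 [s1 s2 niso [f1s f2s] bij]]]]]]].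
  exists T1, T2, (fun a => r1 (j a)), (fun a => r2 (j a)), f1, f2.
  split=> //; [exact: simple_j|exact: simple_j|].
  move=> [f [fl fs] fb]; apply: niso; exists f => //; split=> // a _ x.
  by have [a1 <-] := jsurj a; exact: fs.
have [c1 [c2 [t1 [t2 [c12 [Q1 Q2] [y1 y2] _ t1D]]]]] :=
  odd_split wl e2 el KP ts2 pi2 in2_big big_pr2.
exists 1%N => s; rewrite /q -t1D mulrDr.
have [_ [r1 _]] := primitive_type wl e2 el Q1; have [_ [r2 _]] := primitive_type wl e2 el Q2.
have z (b b' : bool) (x : endo W) : chir e b' * x = x -> b != b' -> chir e b * x = 0.
  move=> <- bb'; have -> : b' = ~~ b by move: bb'; case: b b' => -[].
  by rewrite mulrA chir_orth // mul0r.
rewrite mulrDr; have [sc1|sc1] := eqVneq s c1.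
  by rewrite sc1 y1 (z c1 c2) // addr0.
rewrite (z s c1) // add0r; have -> : s = c2 by move: sc1 c12; case: (s) (c1) (c2) => -[] [].
by rewrite y2.
Qed.

Lemma restricted_sum_dim r : restricted_sum r -> (r * \dim {:S1})%N = \dim {:S2}.
Proof.
move=> [iota [pi [_ _ ip ips]]].
pose F (x : {ffun 'I_r -> S1}) := \sum_t iota t (x t).
have Fl : linear F.
  move=> a x y; rewrite /F scaler_sumr -big_split; apply: eq_bigr => t _ /=.
  by rewrite !ffunE linearP.
have Fb : bijective F.
  exists (fun y => [ffun t => pi t y]) => x.
    apply/ffunP => t; rewrite ffunE /F linear_sum (bigD1 t) //= -comp_lfunE ip eqxx.
    rewrite id_lfunE big1 ?addr0 // => t' tt'.
    by rewrite -comp_lfunE ip eq_sym (negPf tt') zero_lfunE.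
  rewrite /F -[RHS](id_lfunE x) -ips sum_lfunE; apply: eq_bigr => t _.
  by rewrite ffunE comp_lfunE.
have -> : \dim {:S2} = \dim {:{ffun 'I_r -> S1}}.
  have [G FG GF] := Fb; rewrite -(@limg_dim_eq _ _ _ (linfun F) fullv).
    congr (\dim _); apply/eqP; rewrite eqEsubv subvf andbT; apply/subvP => y _.
    by rewrite -[y]GF -(linfunE Fl) memv_img ?memvf.
  apply/eqP; rewrite -subv0; apply/subvP => x; rewrite memv_cap memv_ker memv0 linfunE //.
  have F0 : F 0 = 0 by rewrite /F big1 // => t _; rewrite ffunE linear0.
  by rewrite -F0 => /andP[_ /eqP/(can_inj FG) ->].
rewrite !dimvf; have -> : dim {ffun 'I_r -> S1} = (#|'I_r| * dim S1)%N by [].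
by rewrite card_ord.
Qed.

End SpinorRestriction.

(** * Roots and parabolic subgroups *)

Section Roots.
Variables (R : realType) (X : rootData R).
Notation V := (rV X).
Notation ip := (@ip R X).
Notation pr := (@pr R X).
Notation cor := (@cor R X).
Notation roots := (allroots X).
Notation simp := (simples X).
Notation pos := (nonneg simp).
Notation rgroup := (refl_group pr cor).

Let ips := @ip_scalar R X.
Let ipy := @ip_sym R X.
Let ipp := @ip_pos R X.

Lemma prDl x y z : pr (x + y) z = pr x z + pr y z.
Proof. by rewrite -[x]scale1r pr_scalarl mul1r !scale1r. Qed.
Lemma pr0l z : pr 0 z = 0.
Proof. by apply: (addrI (pr 0 z)); rewrite -prDl !addr0. Qed.
Lemma prZl a x z : pr (a *: x) z = a * pr x z.
Proof. by rewrite -[a *: x]addr0 pr_scalarl pr0l addr0. Qed.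
Lemma prNl x z : pr (- x) z = - pr x z.
Proof. by rewrite -scaleN1r prZl mulN1r. Qed.

Lemma sreflE a v : srefl a v = v - pr v (cor a) *: a.
Proof.
rewrite /srefl /refl linfunE // => r x y.
rewrite prDl prZl scalerDl opprD scalerBr -scalerA addrACA //.
Qed.

Lemma root2 a : a \in roots -> pr a (cor a) = 2.
Proof. by case: (roots_system X) => _ h _ _ _; exact: h. Qed.

Lemma root_refl a b : a \in roots -> b \in roots -> srefl a b \in roots.
Proof. by case: (roots_system X) => _ _ h _ _ ha hb; case: (h a b ha hb). Qed.

Lemma root_int a b : a \in roots -> b \in roots -> pr a (cor b) \is a Num.int.
Proof. by case: (roots_system X) => _ _ _ h _; exact: h. Qed.

Lemma root_neq0 a : a \in roots -> a != 0.
Proof. by move=> /root2; apply: contra_eqN => /eqP->; rewrite pr0l eq_sym pnatr_eq0. Qed.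

Lemma ip_root_gt0 a : a \in roots -> 0 < ip a a.
Proof. by move/root_neq0; exact: ipp. Qed.

Lemma srefl_ip a x y : a \in roots -> ip (srefl a x) (srefl a y) = ip x y.
Proof. by move=> aR; exact: ip_inv. Qed.

Lemma srefl_root a : a \in roots -> srefl a a = - a.
Proof.
by move=> aR; rewrite sreflE root2 // scaler_nat mulr2n opprD addrA subrr add0r.
Qed.

(** Invariance of the inner product applied to [v] and [a], with [a] sent to [- a], identifies the
    coroot with 2a / <a, a>. *)
Lemma cor_ip a v : a \in roots -> pr v (cor a) * ip a a = 2 * ip v a.
Proof.
move=> aR; have := srefl_ip v a aR; rewrite srefl_root // sreflE.
rewrite (qNr ips) (qDl ips ipy) (qNl ips ipy) (qZl ips ipy) => /eqP.
rewrite opprB subr_eq => /eqP ->.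
by rewrite mulr_natl mulr2n.
Qed.

Lemma corE a v : a \in roots -> pr v (cor a) = 2 * ip v a / ip a a.
Proof.
by move=> aR; rewrite -cor_ip // mulfK // gt_eqF ?ip_root_gt0.
Qed.

Lemma root_opp a : a \in roots -> - a \in roots.
Proof. by move=> aR; rewrite -srefl_root // root_refl. Qed.

Lemma cor_opp a v : a \in roots -> pr v (cor (- a)) = - pr v (cor a).
Proof.
move=> aR; rewrite !corE ?root_opp // !(qNr ips) (qNl ips ipy) opprK.
by rewrite mulrN mulNr.
Qed.

Lemma srefl_opp a : a \in roots -> srefl (- a) = srefl a.
Proof.
move=> aR; apply/lfunP => v.
by rewrite !sreflE cor_opp // scaleNr scalerN opprK.
Qed.

Lemma sreflK a : a \in roots -> (srefl a \o srefl a)%VF = \1%VF.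
Proof.
move=> aR; apply/lfunP => v; rewrite comp_lfunE id_lfunE !sreflE.
rewrite prDl prNl prZl root2 // mulr_natr mulr2n opprD addNKr.
by rewrite scaleNr opprK subrK.
Qed.

Lemma rgroup_sub A B g : {subset A <= B} -> rgroup A g -> rgroup B g.
Proof.
by move=> AB; elim=> [|a h aA _ IH]; [exact: refl_group1|apply: refl_groupM => //; exact: AB].
Qed.

Lemma rgroup_comp A g h : rgroup A g -> rgroup A h -> rgroup A (g \o h)%VF.
Proof.
move=> + Ah; elim=> [|a k aA _ IH]; first by rewrite comp_lfun1l.
by rewrite -comp_lfunA; exact: refl_groupM.
Qed.

Lemma rgroup_refl A a : a \in A -> rgroup A (srefl a).
Proof.
by move=> aA; rewrite -[srefl a]comp_lfun1r; apply: refl_groupM => //; exact: refl_group1.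
Qed.

Section Subset.
Variable A : seq V.
Hypothesis AR : {subset A <= roots}.

Lemma rgroup_ip g x y : rgroup A g -> ip (g x) (g y) = ip x y.
Proof.
move=> Ag; elim: Ag x y => [|a h aA _ IH] x y; first by rewrite !id_lfunE.
by rewrite !comp_lfunE srefl_ip ?IH // AR.
Qed.

Lemma rgroup_root g b : rgroup A g -> b \in roots -> g b \in roots.
Proof.
move=> Ag bR; elim: Ag => [|a h aA _ IH]; first by rewrite id_lfunE.
by rewrite comp_lfunE root_refl // AR.
Qed.

Lemma rgroup_inv g : rgroup A g ->
  [/\ rgroup A (g^-1)%VF, (g^-1 \o g)%VF = \1%VF & (g \o g^-1)%VF = \1%VF].
Proof.
move=> Ag; have [h [Ah hg]] : exists h, rgroup A h /\ (h \o g)%VF = \1%VF.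
  elim: Ag => [|a k aA _ [h [Ah hk]]].
    by exists \1%VF; split; [exact: refl_group1|rewrite comp_lfun1l].
  exists (h \o srefl a)%VF; split; first by apply: rgroup_comp => //; exact: rgroup_refl.
  by rewrite -comp_lfunA (comp_lfunA (srefl a)) sreflK ?AR // comp_lfun1l.
have k0 : lker g == 0%VS.
  rewrite -subv0; apply/subvP => x; rewrite memv_ker memv0 => /eqP gx.
  by rewrite -[x]id_lfunE -hg comp_lfunE gx linear0.
have gV := lker0_compVf k0; have Vg := lker0_compfV k0.
split=> //; suff -> : (g^-1)%VF = h by [].
by rewrite -[RHS]comp_lfun1r -Vg comp_lfunA hg comp_lfun1l.
Qed.

Lemma rgroup_cor g b v : rgroup A g -> b \in roots -> pr (g v) (cor (g b)) = pr v (cor b).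
Proof.
by move=> Ag bR; rewrite !corE ?rgroup_root // !rgroup_ip.
Qed.

Lemma rgroup_conj g b : rgroup A g -> b \in roots ->
  (g \o srefl b)%VF = (srefl (g b) \o g)%VF.
Proof.
move=> Ag bR; apply/lfunP => v; rewrite !comp_lfunE !sreflE linearB linearZ /=.
by rewrite rgroup_cor.
Qed.

End Subset.

Lemma simples_sub : {subset simp <= roots}.
Proof. by case: (simples_base X). Qed.

Notation crdS i := (coord (in_tuple simp) i).

Lemma simp_root (i : 'I_(size simp)) : simp`_i \in roots.
Proof. by apply/simples_sub/mem_nth. Qed.

Lemma crdS_simp (i k : 'I_(size simp)) : crdS i (simp`_k) = (i == k)%:R.
Proof.
have [fr _ _] := simples_base X.
by rewrite (coord_free k i (X := in_tuple simp)) // eq_sym.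
Qed.

Lemma root_expand b : b \in roots -> b = \sum_i crdS i b *: simp`_i.
Proof.
have [_ _ h] := simples_base X => /h[bs _ _].
exact: (@coord_span _ _ _ (in_tuple simp)).
Qed.

Lemma crdS_int b i : b \in roots -> crdS i b \is a Num.int.
Proof. by have [_ _ h] := simples_base X => /h[]. Qed.

Lemma posP b : reflect (forall i, 0 <= crdS i b) (pos b).
Proof. exact: forallP. Qed.

Lemma posN b : b \in roots -> pos (- b) = ~~ pos b.
Proof.
move=> bR; have [_ _ h] := simples_base X; have [_ _] := h b bR.
case: posP => [p _|p /= ->] //; apply/negbTE/posP => n.
have := root_neq0 bR; rewrite [b]root_expand // big1 ?eqxx // => i _.
suff -> : crdS i b = 0 by rewrite scale0r.
by apply/eqP; rewrite eq_le p andbT -oppr_ge0 -linearN; exact: n.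
Qed.

Lemma simp_pos a : a \in simp -> pos a.
Proof.
move=> aS; apply/posP => i; pose k := Ordinal (etrans (index_mem a simp) aS).
have -> : crdS i a = (i == k)%:R by rewrite -crdS_simp /= nth_index.
exact: ler0n.
Qed.

(** Both [t] and [2 / t] are integers, the first as a coordinate and the second as a pairing of
    roots; [t = 2] is excluded because the root system is reduced. *)
Lemma root_multiple (i : 'I_(size simp)) b (t : R) : b \in roots -> b = t *: simp`_i ->
  0 <= t -> b = simp`_i.
Proof.
move=> bR bE t0; have aR := simp_root i; have a0 := ip_root_gt0 aR.
have tint : t \is a Num.int.
  have := crdS_int i bR; rewrite bE linearZ /= crdS_simp eqxx mulr1 //.
have tn : t != 0.
  by apply: contraNneq (root_neq0 bR) => t0'; rewrite bE t0' scale0r.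
have := root_int aR bR; rewrite corE // bE !(qZl ips ipy) !(qZr ips).
have -> : 2 * (t * ip simp`_i simp`_i) / (t * (t * ip simp`_i simp`_i)) = 2 / t.
  by rewrite mulrCA -mulf_div divff // mul1r -mulf_div divff ?gt_eqF // mulr1.
move=> t2; have /natrP[k tk] : t \is a Num.nat by rewrite natrEint tint.
have /natrP[l tl] : 2 / t \is a Num.nat by rewrite natrEint t2 divr_ge0.
have kl : (k * l = 2)%N.
  by apply/eqP; rewrite -(eqr_nat R) natrM -tk -tl mulrCA divff // mulr1.
case: k kl tk => [|[|[|k]]] //= kl tk.
- by rewrite tk scale1r.
- have [_ _ _ _ h] := roots_system X.
  by have := h _ aR; rewrite -scaler_nat -tk -bE bR.
- have : (k.+3 %| 2)%N by rewrite -kl dvdn_mulr.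
  by move=> /dvdn_leq-/(_ isT).
Qed.

(** The reflection changes only the coordinate at [a]. A negative image would force all other
    coordinates of [b] to vanish, making [b] a multiple of [a]. *)
Lemma simple_refl_pos a b : a \in simp -> b \in roots -> pos b -> b != a ->
  pos (srefl a b).
Proof.
move=> aS bR pb; apply: contraNT; have aR := simples_sub aS.
rewrite -posN ?root_refl // => /posP n.
pose i := Ordinal (etrans (index_mem a simp) aS).
have aE : a = simp`_i by rewrite /= nth_index.
have c0 k : k != i -> crdS k b = 0.
  move=> ki; apply/eqP; rewrite eq_le (posP _ pb) andbT.
  have := n k; rewrite sreflE opprB linearB linearZ /= {2}aE crdS_simp (negPf ki).
  by rewrite mulr0 sub0r oppr_ge0.
rewrite aE; apply/eqP/(root_multiple bR (t := crdS i b)); last exact: (posP _ pb).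
rewrite {1}[b]root_expand // (bigD1 i) //= big1 ?addr0 // => k ki.
by rewrite c0 ?scale0r.
Qed.

Section Parabolic.
Variable Pi : seq V.
Hypothesis PiS : {subset Pi <= simp}.

Lemma crdS_notin b (i : 'I_(size simp)) : b \in <<Pi>>%VS -> simp`_i \notin Pi ->
  crdS i b = 0.
Proof.
move=> bP iP; rewrite (@coord_span _ _ _ (in_tuple Pi) b bP) linear_sum big1 // => k _.
have kP : Pi`_k \in Pi by apply: mem_nth.
have kS := PiS kP; rewrite linearZ /=.
have -> : Pi`_k = simp`_(Ordinal (etrans (index_mem Pi`_k simp) kS)) by rewrite /= nth_index.
rewrite crdS_simp; case: eqP => [ik|]; last by rewrite mulr0.
by move: iP; rewrite ik /= nth_index // kP.
Qed.

(** Induction on the height. As <b, b> > 0, some simple root has both a positive coordinate in [b]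
    and a positive product with [b]; it lies in [Pi], and reflecting in it lowers the height by a
    positive integer. *)
Lemma parabolic_root b : b \in roots -> pos b -> b \in <<Pi>>%VS ->
  exists w a, [/\ rgroup Pi w, a \in Pi & b = w a].
Proof.
pose ht v := \sum_i crdS i v.
suff main n : forall b, b \in roots -> pos b -> b \in <<Pi>>%VS -> ht b <= n%:R ->
    exists w a, [/\ rgroup Pi w, a \in Pi & b = w a].
  move=> bR pb bP; have /natrP[n hn] : ht b \is a Num.nat.
    by rewrite natrEint rpred_sum ?sumr_ge0 // => i _; [exact: (posP _ pb)|exact: crdS_int].
  by apply: (main n) => //; rewrite hn.
elim: n => [|n IH] {}b bR pb bP hb.
  have := root_neq0 bR; rewrite [b]root_expand // big1 ?eqxx // => i _.
  suff -> : crdS i b = 0 by rewrite scale0r.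
  have hb0 : ht b = 0 by apply/eqP; rewrite eq_le hb sumr_ge0 // => k _; exact: (posP _ pb).
  by apply: (psumr_eq0P (F := fun i => crdS i b)) hb0 i isT => k _; exact: (posP _ pb).
have [i [ci ipi]] : exists i, 0 < crdS i b /\ 0 < ip b simp`_i.
  apply: contrapT => no; have := ip_root_gt0 bR; rewrite {2}[b]root_expand //.
  rewrite (qsumr ips) ltNge => /negP; apply; apply: sumr_le0 => i _.
  rewrite (qZr ips); have := posP _ pb i; rewrite le_eqVlt => /orP[/eqP<-|ci].
    by rewrite mul0r.
  rewrite pmulr_rle0 // leNgt; apply/negP => h; apply: no; exists i => //.
have iP : simp`_i \in Pi.
  by apply: contraTT ci => iP; rewrite crdS_notin ?ltxx.
have aR := simp_root i; have [bi|bi] := eqVneq b simp`_i.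
  by exists \1%VF, simp`_i; rewrite id_lfunE; split=> //; exact: refl_group1.
have sb : srefl simp`_i b = b - pr b (cor simp`_i) *: simp`_i by exact: sreflE.
have [||||w [a [wP aP sbE]]] := IH (srefl simp`_i b).
- exact: root_refl.
- by apply: simple_refl_pos => //; exact: PiS.
- by rewrite sb rpredB // rpredZ // memv_span.
- have c1 : 1 <= pr b (cor simp`_i).
    have cpos : 0 < pr b (cor simp`_i).
      by rewrite corE // divr_gt0 ?ip_root_gt0 // mulr_gt0.
    have /natrP[k kE] : pr b (cor simp`_i) \is a Num.nat.
      by rewrite natrEint root_int // ltW.
    by move: cpos; rewrite kE ltr0n ler1n.
  have -> : ht (srefl simp`_i b) = ht b - pr b (cor simp`_i).
    rewrite /ht sb; under eq_bigr do rewrite linearB linearZ /= crdS_simp.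
    rewrite sumrB; congr (_ - _); rewrite (bigD1 i) //= eqxx mulr1 big1 ?addr0 // => k ki.
    by rewrite (negPf ki) mulr0.
  rewrite lerBlDr; apply: le_trans hb _; rewrite -natr1 lerD2l //.
exists (srefl simp`_i \o w)%VF, a; split=> //; first exact: refl_groupM.
by rewrite comp_lfunE -sbE -comp_lfunE sreflK ?id_lfunE.
Qed.

Lemma Pi_sub : {subset Pi <= roots}.
Proof. by move=> a /PiS/simples_sub. Qed.

Lemma parabolic_refl b : b \in roots -> b \in <<Pi>>%VS -> rgroup Pi (srefl b).
Proof.
have main c : c \in roots -> pos c -> c \in <<Pi>>%VS -> rgroup Pi (srefl c).
  move=> cR pc cP; have [w [a [wP aP ->]]] := parabolic_root cR pc cP.
  have [wVP Vw wV] := rgroup_inv Pi_sub wP.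
  have -> : srefl (w a) = (w \o (srefl a \o w^-1))%VF.
    rewrite comp_lfunA (rgroup_conj Pi_sub wP) ?Pi_sub //.
    by rewrite -comp_lfunA wV comp_lfun1r.
  apply: rgroup_comp => //; apply: rgroup_comp => //; exact: rgroup_refl.
move=> bR bP; have [pb|nb] := boolP (pos b); first exact: main.
by rewrite -srefl_opp //; apply: main; rewrite ?root_opp ?posN ?rpredN.
Qed.

End Parabolic.

(** The enumeration [weyl] refers to reflections in all roots. Taking all simple roots for [Pi] in
    [parabolic_refl] shows that the simple ones generate. *)
Lemma weyl_simple w : w \in weyl X <-> rgroup simp w.
Proof.
rewrite weylP; split; last exact/rgroup_sub/simples_sub.
elim=> [|a g aR _ IH]; first exact: refl_group1.
apply: rgroup_comp => //; apply: parabolic_refl => //.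
by have [_ _ h] := simples_base X; have [] := h a aR.
Qed.

Lemma weyl_refl a : a \in roots -> srefl a \in weyl X.
Proof. by move=> aR; apply/weylP/rgroup_refl. Qed.

Lemma weyl1 : \1%VF \in weyl X.
Proof. by apply/weylP; exact: refl_group1. Qed.

Lemma weylM g h : g \in weyl X -> h \in weyl X -> (g \o h)%VF \in weyl X.
Proof. by move=> /weylP ? /weylP ?; apply/weylP/rgroup_comp. Qed.

Let rr : {subset roots <= roots} := fun x h => h.

Lemma weylV g : g \in weyl X -> (g^-1)%VF \in weyl X.
Proof. by move=> /weylP /(rgroup_inv rr)[? _ _]; apply/weylP. Qed.

Lemma weylKV g : g \in weyl X -> (g^-1 \o g)%VF = \1%VF.
Proof. by move=> /weylP /(rgroup_inv rr)[]. Qed.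

Lemma weylVK g : g \in weyl X -> (g \o g^-1)%VF = \1%VF.
Proof. by move=> /weylP /(rgroup_inv rr)[]. Qed.

Lemma weyl_ip g x y : g \in weyl X -> ip (g x) (g y) = ip x y.
Proof. by move=> /weylP; exact: (rgroup_ip rr). Qed.

Lemma weyl_root g b : g \in weyl X -> b \in roots -> g b \in roots.
Proof. by move=> /weylP; exact: (rgroup_root rr). Qed.

Lemma weyl_cor g b v : g \in weyl X -> b \in roots -> pr (g v) (cor (g b)) = pr v (cor b).
Proof. by move=> /weylP; exact: (rgroup_cor rr). Qed.

Lemma weyl_conj g b : g \in weyl X -> b \in roots ->
  (g \o srefl b)%VF = (srefl (g b) \o g)%VF.
Proof. by move=> /weylP; exact: (rgroup_conj rr). Qed.

Lemma weyl_inj g : g \in weyl X -> injective g.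
Proof.
move=> gW x y gxy; have /lfunP e := weylKV gW.
by have := e x; have := e y; rewrite !comp_lfunE !id_lfunE gxy => -> ->.
Qed.

Section Sums.
Variable T : zmodType.

Lemma sum_weyl_mull u (F : 'End(V) -> T) : u \in weyl X ->
  \sum_(w <- weyl X) F (u \o w)%VF = \sum_(w <- weyl X) F w.
Proof.
move=> uW; rewrite -(big_map (fun w => (u \o w)%VF) xpredT F); apply: perm_big.
apply: uniq_perm => [||g]; last 1 first.
- apply/mapP/idP => [[h hW ->]|gW]; first exact: weylM.
  exists (u^-1 \o g)%VF; first by apply: weylM => //; exact: weylV.
  by rewrite comp_lfunA weylVK // comp_lfun1l.
- rewrite map_inj_in_uniq ?weyl_uniq // => g h _ _ e.
  by rewrite -[g]comp_lfun1l -[h]comp_lfun1l -(weylKV uW) -!comp_lfunA e.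
- exact: weyl_uniq.
Qed.

Lemma sum_weyl_mulr u (F : 'End(V) -> T) : u \in weyl X ->
  \sum_(w <- weyl X) F (w \o u)%VF = \sum_(w <- weyl X) F w.
Proof.
move=> uW; rewrite -(big_map (fun w => (w \o u)%VF) xpredT F); apply: perm_big.
apply: uniq_perm => [||g]; last 1 first.
- apply/mapP/idP => [[h hW ->]|gW]; first exact: weylM.
  exists (g \o u^-1)%VF; first by apply: weylM => //; exact: weylV.
  by rewrite -comp_lfunA weylKV // comp_lfun1r.
- rewrite map_inj_in_uniq ?weyl_uniq // => g h _ _ e.
  by rewrite -[g]comp_lfun1r -[h]comp_lfun1r -(weylVK uW) !comp_lfunA e.
- exact: weyl_uniq.
Qed.

Lemma roots_uniq : uniq roots.
Proof. by case: (roots_system X) => -[]. Qed.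

Lemma mem_posroots b : (b \in posroots X) = pos b && (b \in roots).
Proof. by rewrite mem_filter. Qed.

Lemma sum_roots (F : V -> T) :
  \sum_(b <- roots) F b = \sum_(b <- posroots X) (F b + F (- b)).
Proof.
rewrite (bigID pos) /= big_split /= -big_filter; congr (_ + _).
rewrite -(big_map -%R xpredT F) -big_filter; apply: perm_big.
apply: uniq_perm => [||b]; rewrite ?filter_uniq ?roots_uniq //.
  by rewrite map_inj_uniq ?filter_uniq ?roots_uniq //; exact: oppr_inj.
rewrite mem_filter; apply/andP/mapP => [[nb bR]|[c]].
  by exists (- b); rewrite ?opprK // mem_posroots posN // nb root_opp.
by rewrite mem_posroots => /andP[pc cR] ->; rewrite posN // negbK root_opp.
Qed.

Lemma sum_roots_weyl g (F : V -> T) : g \in weyl X ->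
  \sum_(b <- roots) F (g b) = \sum_(b <- roots) F b.
Proof.
move=> gW; rewrite -(big_map g xpredT F); apply: perm_big.
apply: uniq_perm => [||b]; rewrite ?roots_uniq //.
  by rewrite map_inj_uniq ?roots_uniq //; exact: weyl_inj.
apply/mapP/idP => [[c cR ->]|bR]; first exact: weyl_root.
exists ((g^-1)%VF b); first by rewrite weyl_root ?weylV.
by rewrite -comp_lfunE weylVK // id_lfunE.
Qed.

(** A simple reflection permutes the positive roots other than [a] and sends [a] to [- a]. *)
Lemma sum_pos_simple a (F : V -> T) : a \in simp ->
  \sum_(b <- posroots X) F (srefl a b) = \sum_(b <- posroots X) F b - F a + F (- a).
Proof.
move=> aS; have aR := simples_sub aS.
have aP : a \in posroots X by rewrite mem_posroots simp_pos.
have up : uniq (posroots X) by rewrite filter_uniq ?roots_uniq.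
rewrite !(big_rem a aP) /= srefl_root // [F a + _]addrC addrK addrC; congr (_ + _).
rewrite -(big_map (srefl a) xpredT F); apply: perm_big.
have sI : injective (srefl a) by exact/weyl_inj/weyl_refl.
have stable b : b \in rem a (posroots X) -> srefl a b \in rem a (posroots X).
  rewrite !mem_rem_uniq // !inE !mem_posroots => /and3P[ba pb bR].
  rewrite simple_refl_pos // root_refl // !andbT; apply: contraTneq pb => sb.
  have -> : b = - a by apply: sI; rewrite sb linearN /= srefl_root ?opprK.
  by rewrite posN // simp_pos.
apply: uniq_perm => [||b]; rewrite ?rem_uniq //; first by rewrite map_inj_uniq ?rem_uniq.
apply/mapP/idP => [[c cP ->]|bP]; first exact: stable.
exists (srefl a b); first exact: stable.
by rewrite -comp_lfunE sreflK // id_lfunE.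
Qed.

End Sums.

Variable M : subsystem X.

Lemma simplesM_rootsM : {subset simplesM M <= rootsM M}.
Proof. by case: (M_base M). Qed.

Lemma rootsM_refl a b : a \in rootsM M -> b \in rootsM M -> srefl a b \in rootsM M.
Proof. by case: (M_root_system M) => _ _ h _ _ ha hb; case: (h a b ha hb). Qed.

Lemma rootsM_span b : b \in rootsM M -> b \in <<simplesM M>>%VS.
Proof. by case: (M_base M) => _ _ h /h[]. Qed.

Lemma WM_rootsM w b : WM M w -> b \in rootsM M -> w b \in rootsM M.
Proof.
elim=> [|a g aM _ IH] bM; first by rewrite id_lfunE.
by rewrite comp_lfunE rootsM_refl ?IH // simplesM_rootsM.
Qed.

Lemma WM_weyl w : WM M w -> w \in weyl X.
Proof. by move=> /(rgroup_sub (@M_simples _ _ M)) ?; apply/weyl_simple. Qed.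

Let sMR : {subset simplesM M <= roots} := fun x h => simples_sub (M_simples h).

Lemma WM1 : WM M \1%VF. Proof. exact: refl_group1. Qed.

Lemma WMM g h : WM M g -> WM M h -> WM M (g \o h)%VF.
Proof. exact: rgroup_comp. Qed.

Lemma WMV g : WM M g -> WM M (g^-1)%VF.
Proof. by case/(rgroup_inv sMR). Qed.

Lemma WM_mull g h : WM M g -> WM M (g \o h)%VF <-> WM M h.
Proof.
move=> gM; split=> [ghM|]; last exact: WMM.
rewrite -[h]comp_lfun1l -(weylKV (WM_weyl gM)) -comp_lfunA.
by apply: WMM => //; exact: WMV.
Qed.

Lemma WM_mulr g h : WM M h -> WM M (g \o h)%VF <-> WM M g.
Proof.
move=> hM; split=> [ghM|gM]; last exact: WMM.
rewrite -[g]comp_lfun1r -(weylVK (WM_weyl hM)) comp_lfunA.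
by apply: WMM => //; exact: WMV.
Qed.

Lemma WM_fix w v : WM M w -> (forall a, a \in rootsM M -> ip v a = 0) -> w v = v.
Proof.
move=> wM vo; elim: wM => [|a g aM _ IH]; first by rewrite id_lfunE.
rewrite comp_lfunE IH sreflE corE ?sMR // vo ?simplesM_rootsM //.
by rewrite mulr0 mul0r scale0r subr0.
Qed.

Lemma span_simplesM_root b : b \in roots -> b \in <<simplesM M>>%VS -> b \in rootsM M.
Proof.
have main c : c \in roots -> pos c -> c \in <<simplesM M>>%VS -> c \in rootsM M.
  move=> cR pc cP; have [w [a [wP aP ->]]] := parabolic_root (@M_simples _ _ M) cR pc cP.
  by apply: WM_rootsM => //; exact: simplesM_rootsM.
move=> bR bP; have [pb|nb] := boolP (pos b); first exact: main.
have nbM : - b \in rootsM M by apply: main; rewrite ?root_opp ?posN ?rpredN.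
by rewrite -[b]opprK -srefl_root ?root_opp // rootsM_refl.
Qed.

(** The component [b1] of [b] orthogonal to the span of Pi_M is fixed by W_M, hence by s_b.
    Therefore <b1, b> = <b1, b1> vanishes, [b] lies in that span, and the roots in the span are
    those of R_M. *)
Lemma WM_srefl b : b \in roots -> WM M (srefl b) <-> b \in rootsM M.
Proof.
move=> bR; split=> [sM|bM]; last first.
  by apply: (parabolic_refl (@M_simples _ _ M)) => //; exact: rootsM_span.
apply: span_simplesM_root => //.
have [es [on sp]] := orthonormal_basis ips ipy ipp <<simplesM M>>%VS.
pose b1 := b - \sum_(f <- es) ip b f *: f.
have b1o w : w \in <<simplesM M>>%VS -> ip b1 w = 0.
  by rewrite -sp => ws; exact: (on_ortho_span ips (on_projP ips ipy b on) ws).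
have : srefl b b1 = b1 by apply: (WM_fix sM) => a /rootsM_span; exact: b1o.
rewrite sreflE => /eqP; rewrite addrC -subr_eq0 addrK oppr_eq0 scaler_eq0.
rewrite (negPf (root_neq0 bR)) orbF corE // mulf_eq0 invr_eq0 (gt_eqF (ip_root_gt0 bR)) orbF.
rewrite mulf_eq0 pnatr_eq0 /= => /eqP b1b.
have sM' : \sum_(f <- es) ip b f *: f \in <<simplesM M>>%VS.
  by rewrite -sp big_seq; apply: rpred_sum => f fes; rewrite rpredZ // memv_span.
have b10 : b1 = 0.
  apply: (q_eq0 ipp); rewrite {2}/b1 (qDr ips) (qNr ips) b1b b1o //.
  by rewrite subrr.
by rewrite -(subrK (\sum_(f <- es) ip b f *: f) b) -/b1 b10 add0r.
Qed.

(** A simple reflection of W_M changes the sign of no root outside R_M, because the only positive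
    root that it makes negative belongs to R_M. *)
Lemma WM_pos w b : WM M w -> b \in roots -> b \notin rootsM M -> pos (w b) = pos b.
Proof.
move=> wM bR bM; elim: wM => [|a g aM gM IH]; first by rewrite id_lfunE.
rewrite comp_lfunE; have gbR : g b \in roots by exact: weyl_root (WM_weyl gM) bR.
have aS := M_simples aM; have aR := simples_sub aS.
have gbM : g b \notin rootsM M.
  apply: contra bM => gbM; rewrite -[b]id_lfunE -(weylKV (WM_weyl gM)) comp_lfunE.
  exact: WM_rootsM (WMV gM) gbM.
have na c : c \in roots -> c \notin rootsM M -> pos c -> pos (srefl a c).
  move=> cR cM pc; apply: simple_refl_pos => //.
  by apply: contraNneq cM => ->; exact: simplesM_rootsM.
rewrite -IH; apply/idP/idP => [|pg]; last exact: na.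
apply: contraTT => ng; rewrite -posN ?root_refl // -linearN /=.
apply: na; rewrite ?root_opp ?posN //.
apply: contra gbM => h; rewrite -[g b]opprK -srefl_root ?root_opp //.
by rewrite rootsM_refl.
Qed.

Lemma WM_VM w v : WM M w -> v \in VM M -> w v \in VM M.
Proof.
move=> + vM; elim=> [|a g aM _ IH]; first by rewrite id_lfunE.
rewrite comp_lfunE sreflE rpredB // rpredZ // M_rootsV //.
exact: simplesM_rootsM.
Qed.

End Roots.

(** * The graded Hecke algebra *)

Section Degree.
Variables (F : idomainType) (d : nat).
Notation P := {mpoly F[d]}.

Lemma msizeL (c : F) (p q : P) n : (msize p <= n)%N -> (msize q <= n)%N ->
  (msize (c *: p + q) <= n)%N.
Proof.
move=> pn qn; apply: leq_trans (mmeasureD_le _ _ _) _; rewrite geq_max qn andbT.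
exact: leq_trans (msizeZ_le _ _) pn.
Qed.

Lemma msizeM_bound (p q : P) n m : (msize p <= n)%N -> (msize q <= m)%N ->
  (msize (p * q) <= (n + m).-1)%N.
Proof.
move=> pn qm; have [->|p0] := eqVneq p 0; first by rewrite mul0r mmeasure0.
have [->|q0] := eqVneq q 0; first by rewrite mulr0 mmeasure0.
by rewrite msizeM // -!subn1 leq_sub2r // leq_add.
Qed.

(** Here [n] bounds the degree: [msize] is the degree plus one, which explains [n.+1] in the
    conclusion. *)
Lemma degree_ind (Q : nat -> P -> Prop) :
  (forall n c p q, Q n p -> Q n q -> Q n (c *: p + q)) -> (forall n, Q n 0) ->
  Q 0%N 1 -> (forall n i p, Q n p -> Q n.+1 ('X_i * p)) ->
  (forall n p, Q n p -> Q n.+1 p) -> forall n p, (msize p <= n.+1)%N -> Q n p.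
Proof.
move=> QL Q0 Q1 QX QS n p pn.
have Qle a b r : (a <= b)%N -> Q a r -> Q b r.
  by move=> /subnK <- Qa; elim: (b - a)%N => // k IH; rewrite addSn; exact: QS.
have mon k m : mdeg m = k -> Q k 'X_[m].
  elim: k m => [|k IH] m mk.
    by have -> : m = 0%MM by [apply/eqP; rewrite -mdeg_eq0 mk]; rewrite mpolyX0.
  have [i mi] : exists i, m i != 0%N.
    apply/existsP; apply: contraTT isT => /existsPn h; exfalso.
    move: mk; rewrite mdegE big1 // => i _; apply/eqP.
    by have := h i; rewrite negbK.
  have mE : m = (U_(i) + (m - U_(i)))%MM by rewrite addmC submK // lep1mP.
  rewrite mE mpolyXD; apply: QX; apply: IH; move: mk; rewrite {1}mE mdegD mdeg1.
  by case.
rewrite [p]mpolyE big_seq; elim/big_ind: _ => [||m mp]; first exact: Q0.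
  by move=> x y Qx Qy; rewrite -[x]scale1r; exact: QL.
rewrite -[_ *: _]addr0; apply: QL; last exact: Q0.
apply: Qle (mon _ _ erefl); rewrite -ltnS; apply: leq_trans pn.
exact: msize_mdeg_lt.
Qed.

Lemma mpoly_gen_ind (Q : P -> Prop) :
  (forall c p q, Q p -> Q q -> Q (c *: p + q)) -> Q 0 -> Q 1 ->
  (forall i p, Q p -> Q ('X_i * p)) -> forall p, Q p.
Proof.
move=> QL Q0 Q1 QX p; apply: (@degree_ind (fun=> Q)) (leqnSn (msize p)) => //.
Qed.

End Degree.

Section Complexify.
Variables (R : realType) (X : rootData R).
Notation V := (rV X).
Notation C := R[i].

Lemma embL (U : vectType R) r (v w : U) : emb (r *: v + w) = r%:C *: emb v + emb w.
Proof. by apply/rowP => i; rewrite !mxE linearP rmorphD rmorphM. Qed.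

Lemma linCL c (x y : cplx R V) : linC (c *: x + y) = c *: linC x + linC y.
Proof.
rewrite /linC scaler_sumr -big_split; apply: eq_bigr => i _ /=.
by rewrite !mxE scalerDl scalerA.
Qed.

Lemma linC_embL r (v w : V) :
  linC (emb (r *: v + w)) = r%:C *: linC (emb v) + linC (emb w).
Proof. by rewrite embL linCL. Qed.

Lemma linC_emb0 : linC (emb (0 : V)) = 0.
Proof. by rewrite /linC big1 // => i _; rewrite mxE linear0 scale0r. Qed.

Lemma linC_embZ r (v : V) : linC (emb (r *: v)) = r%:C *: linC (emb v).
Proof. by rewrite -[r *: v]addr0 linC_embL linC_emb0 addr0. Qed.

Lemma linC_embD (v w : V) : linC (emb (v + w)) = linC (emb v) + linC (emb w).
Proof. by rewrite -{1}[v]scale1r linC_embL scale1r. Qed.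

Lemma linC_sum (I : Type) (s : seq I) (f : I -> V) :
  linC (emb (\sum_(i <- s) f i)) = \sum_(i <- s) linC (emb (f i)).
Proof. exact: (big_morph (fun v => linC (emb v)) linC_embD linC_emb0). Qed.

Lemma basis_expand (U : vectType R) (v : U) : v = \sum_i crd U i v *: bas U i.
Proof. exact: coord_vbasis (memvf v). Qed.

Lemma linC_bas (i : 'I_(\dim {:V})) : linC (emb (bas V i)) = 'X_i :> symV X.
Proof.
rewrite /linC (bigD1 i) //= big1 ?addr0 => [|k ki]; rewrite mxE coord_free ?(basis_free (vbasisP _)) //.
  by rewrite eqxx scale1r.
by rewrite eq_sym (negPf ki) scale0r.
Qed.

Lemma msize_linC (x : cplx R V) : (msize (linC x : symV X) <= 2)%N.
Proof.
rewrite /linC; elim/big_ind: _ => [|p q hp hq|i _]; first by rewrite mmeasure0.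
  by rewrite -[p]scale1r; exact: msizeL.
by apply: leq_trans (msizeZ_le _ _) _; rewrite msizeX mdeg1.
Qed.

Lemma pC_emb v y : @pC R X (emb v) (emb y) = (pr v y)%:C.
Proof.
rewrite [in RHS](basis_expand v) [in RHS](basis_expand y).
have prl z := prDl (X := X) _ _ z.
have prsl (I : Type) (s : seq I) f z : pr (\sum_(i <- s) f i) z = \sum_(i <- s) pr (f i) z.
  by apply: (big_morph (fun v => pr v z)) => [a b|]; [exact: prDl|exact: pr0l].
have prDr x a b : @pr R X x (a + b) = pr x a + pr x b.
  by rewrite -{1}[a]scale1r pr_scalarr mul1r.
have pr0r x : @pr R X x 0 = 0 by apply: (addrI (pr x 0)); rewrite -prDr !addr0.
have prsr (I : Type) (s : seq I) f z : @pr R X z (\sum_(i <- s) f i) = \sum_(i <- s) pr z (f i).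
  by apply: (big_morph (fun v => pr z v)) => [a b|]; [exact: prDr|exact: pr0r].
rewrite prsl rmorph_sum; apply: eq_bigr => i _.
rewrite prsr rmorph_sum; apply: eq_bigr => k _.
rewrite prZl -[crd _ k y *: _]addr0 pr_scalarr pr0r addr0 mulrA !rmorphM /=.
by rewrite !mxE.
Qed.

Lemma wactL w c (p q : symV X) : wact w (c *: p + q) = c *: wact w p + wact w q.
Proof. by rewrite /wact linearP. Qed.
Lemma wactM w (p q : symV X) : wact w (p * q) = wact w p * wact w q.
Proof. by rewrite /wact rmorphM. Qed.
Lemma wact_one w : wact w 1 = 1 :> symV X.
Proof. by rewrite /wact rmorph1. Qed.
Lemma wact_zero w : wact w 0 = 0 :> symV X.
Proof. by rewrite /wact rmorph0. Qed.
Lemma wact_sum (I : Type) (s : seq I) w (f : I -> symV X) :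
  wact w (\sum_(i <- s) f i) = \sum_(i <- s) wact w (f i).
Proof. by rewrite /wact linear_sum. Qed.
Lemma wactX w i : wact w 'X_i = linC (emb (w (bas V i))) :> symV X.
Proof. by rewrite /wact comp_mpolyXU -tnth_nth tnth_mktuple. Qed.

Lemma wact_linC w v : wact w (linC (emb v)) = linC (emb (w v)) :> symV X.
Proof.
rewrite [in RHS](basis_expand v) linear_sum linC_sum /wact linear_sum.
apply: eq_bigr => i _; rewrite linearZ /= linearZ /= linC_embZ mxE.
by rewrite -[_ \mPo _]/(wact w 'X_i) wactX.
Qed.

Lemma wact_comp w u (p : symV X) : wact w (wact u p) = wact (w \o u)%VF p.
Proof.
move: p; apply: mpoly_gen_ind => [c p q hp hq||| i p hp].
- apply: etrans (congr1 (wact w) (wactL u c p q)) _; apply: etrans (wactL w c _ _) _.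
  exact: etrans (congr2 (fun x y => c *: x + y) hp hq) (esym (wactL _ c p q)).
- by rewrite !wact_zero.
- by rewrite !wact_one.
- apply: etrans (congr1 (wact w) (wactM u _ p)) _; apply: etrans (wactM w _ _) _.
  apply: etrans _ (esym (wactM (w \o u)%VF 'X_i p)); rewrite -hp.
  apply: (congr1 (fun y : symV X => y * wact w (wact u p))).
  apply: etrans (congr1 (wact w) (wactX u i)) _; apply: etrans (wact_linC _ _) _.
  by apply/esym; apply: etrans (wactX _ _) _; rewrite comp_lfunE.
Qed.

Lemma wact_id (p : symV X) : wact \1%VF p = p.
Proof.
move: p; apply: mpoly_gen_ind => [c p q hp hq||| i p hp].
- by rewrite wactL hp hq.
- by rewrite wact_zero.
- by rewrite wact_one.
- by rewrite wactM hp wactX id_lfunE linC_bas.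
Qed.

Lemma msize_wact w n (p : symV X) : (msize p <= n)%N -> (msize (wact w p) <= n)%N.
Proof.
case: n => [|n]; first by rewrite leqn0 mmeasure_poly_eq0 => /eqP->; rewrite wact_zero mmeasure0.
move: n p; apply: degree_ind => [n c p q|n||n i p hp|n p hp].
- by rewrite wactL; exact: msizeL.
- by rewrite wact_zero mmeasure0.
- by rewrite wact_one mmeasure1.
- by rewrite wactM wactX; apply: leq_trans (msizeM_bound (msize_linC _) hp) _.
- exact: leqW.
Qed.

End Complexify.

(** * Left and right normal forms, and the projection onto the parabolic subalgebra *)

Section Hecke.
Variables (R : realType) (X : rootData R) (H : hecke X).
Notation V := (rV X).
Notation C := R[i].
Notation W := (weyl X).
Notation hS := (hS H).
Notation hW := (hW H).

Lemma simple_cross a v : a \in simples X ->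
  hW (srefl a) * hS (linC (emb v)) =
  hS (linC (emb (srefl a v))) * hW (srefl a) + (pr v (cor a))%:C%:A.
Proof.
move=> aS; have := h_cross H aS (emb v); rewrite wact_linC pC_emb => /eqP.
by rewrite subr_eq addrC => /eqP.
Qed.

(** The correction [q] is a divided difference of [p]; only the drop of its degree is recorded. *)
Lemma simple_cross_sym a n p : a \in simples X -> (msize p <= n.+1)%N ->
  exists2 q : symV X, (msize q <= n)%N &
    hW (srefl a) * hS p = hS (wact (srefl a) p) * hW (srefl a) + hS q.
Proof.
move=> aS; suff h : forall n p, (msize p <= n.+1)%N -> (msize p <= n.+1)%N /\
    exists2 q : symV X, (msize q <= n)%N &
    hW (srefl a) * hS p = hS (wact (srefl a) p) * hW (srefl a) + hS q.
  by move=> /h[].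
apply: degree_ind => [{}n c p1 p2 [s1 [q1 b1 e1]] [s2 [q2 b2 e2]]|{}n||{}n i {}p [s [q b e]]|{}n {}p [s [q b e]]].
- split; first exact: msizeL.
  exists (c *: q1 + q2); first exact: msizeL.
  rewrite wactL !linearP /= mulrDr mulrDl -scalerAr -scalerAl e1 e2.
  by rewrite scalerDr addrACA.
- by split; [rewrite mmeasure0|exists 0; rewrite ?mmeasure0 // wact_zero !rmorph0 mulr0 mul0r addr0].
- by split; [rewrite mmeasure1|exists 0; rewrite ?mmeasure0 // wact_one rmorph0 rmorph1 mulr1 mul1r addr0].
- split.
    have X2 : (msize ('X_i : symV X) <= 2)%N by rewrite msizeX mdeg1.
    exact: leq_trans (msizeM_bound X2 s) _.
  exists (linC (emb (srefl a (bas V i))) * q + (pr (bas V i) (cor a))%:C *: p).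
    rewrite addrC; apply: msizeL => //.
    by apply: leq_trans (msizeM_bound (msize_linC _) b) _.
  rewrite rmorphM /= mulrA -linC_bas simple_cross // mulrDl -mulrA e wactM wact_linC.
  rewrite rmorphD rmorphM /= mulrDr !mulrA linearZ /= rmorphM /=.
  by rewrite mulr_algl addrA.
- by split; [exact: leqW|exists q => //; exact: leqW].
Qed.

(** The filtration by polynomial degree, shifted by one because [n] bounds [msize]: level 0 contains
    only 0, which starts the inductions. *)
Definition filt (n : nat) (h : H) : Prop :=
  exists2 f : 'End(V) -> symV X, forall u, (msize (f u) <= n)%N &
    h = \sum_(u <- W) hS (f u) * hW u.

Definition rfilt (n : nat) (h : H) : Prop :=
  exists2 f : 'End(V) -> symV X, forall u, (msize (f u) <= n)%N &
    h = \sum_(u <- W) hW u * hS (f u).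

Lemma filtL n c h k : filt n h -> filt n k -> filt n (c *: h + k).
Proof.
move=> [f fn ->] [g gn ->]; exists (fun u => c *: f u + g u).
  by move=> u; exact: msizeL.
rewrite scaler_sumr -big_split; apply: eq_bigr => u _ /=.
by rewrite linearP mulrDl scalerAl.
Qed.

Lemma rfiltL n c h k : rfilt n h -> rfilt n k -> rfilt n (c *: h + k).
Proof.
move=> [f fn ->] [g gn ->]; exists (fun u => c *: f u + g u).
  by move=> u; exact: msizeL.
rewrite scaler_sumr -big_split; apply: eq_bigr => u _ /=.
by rewrite linearP mulrDr scalerAr.
Qed.

Lemma filt0 n : filt n 0.
Proof.
exists (fun=> 0) => [u|]; first by rewrite mmeasure0.
by rewrite big1 // => u _; rewrite rmorph0 mul0r.
Qed.

Lemma rfilt0 n : rfilt n 0.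
Proof.
exists (fun=> 0) => [u|]; first by rewrite mmeasure0.
by rewrite big1 // => u _; rewrite rmorph0 mulr0.
Qed.

Lemma filtD n h k : filt n h -> filt n k -> filt n (h + k).
Proof. by move=> *; rewrite -[h]scale1r; exact: filtL. Qed.
Lemma rfiltD n h k : rfilt n h -> rfilt n k -> rfilt n (h + k).
Proof. by move=> *; rewrite -[h]scale1r; exact: rfiltL. Qed.
Lemma rfiltN n h : rfilt n h -> rfilt n (- h).
Proof. by move=> *; rewrite -scaleN1r -[_ *: _]addr0; apply: rfiltL => //; exact: rfilt0. Qed.

Lemma single_sum (T : zmodType) (F : 'End(V) -> symV X -> T) w p : w \in W ->
  (forall u, F u 0 = 0) -> \sum_(u <- W) F u (if u == w then p else 0) = F w p.
Proof.
move=> wW F0; rewrite (bigD1_seq w) ?weyl_uniq //= eqxx big1 ?addr0 // => u uw.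
by rewrite (negPf uw) F0.
Qed.

Lemma filt_single n p w : w \in W -> (msize p <= n)%N -> filt n (hS p * hW w).
Proof.
move=> wW pn; exists (fun u => if u == w then p else 0).
  by move=> u; case: eqP; rewrite ?mmeasure0.
by rewrite (single_sum (F := fun u q => hS q * hW u)) // => u; rewrite rmorph0 mul0r.
Qed.

Lemma rfilt_single n p w : w \in W -> (msize p <= n)%N -> rfilt n (hW w * hS p).
Proof.
move=> wW pn; exists (fun u => if u == w then p else 0).
  by move=> u; case: eqP; rewrite ?mmeasure0.
by rewrite (single_sum (F := fun u q => hW u * hS q)) // => u; rewrite rmorph0 mulr0.
Qed.

Lemma rfiltS n h : rfilt n h -> rfilt n.+1 h.
Proof. by move=> [f fn ->]; exists f => // u; exact: leqW. Qed.

Lemma filt_simple n a h : a \in simples X -> filt n h -> filt n (hW (srefl a) * h).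
Proof.
move=> aS [f fn ->]; have sW := weyl_refl (simples_sub aS).
rewrite mulr_sumr big_seq; elim/big_ind: _ => [||u uW]; first exact: filt0.
  by move=> *; exact: filtD.
have [q qn e] := simple_cross_sym aS (leqW (fn u)).
rewrite mulrA e mulrDl -mulrA -hWM //.
apply: filtD; apply: filt_single => //; [exact: weylM|exact: msize_wact].
Qed.

Lemma cross_lower n w p : w \in W -> (msize p <= n.+1)%N ->
  filt n (hW w * hS p - hS (wact w p) * hW w).
Proof.
move=> /weyl_simple + pn; elim=> [|a g aS gS IH].
  by rewrite hW1 wact_id mul1r mulr1 subrr; exact: filt0.
have gW : g \in W by apply/weyl_simple.
have sW := weyl_refl (simples_sub aS).
rewrite hWM //.
have gpn : (msize (wact g p) <= n.+1)%N by exact: msize_wact.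
have [q qn e] := simple_cross_sym aS gpn.
have -> : hW (srefl a) * hW g * hS p - hS (wact (srefl a \o g)%VF p) * (hW (srefl a) * hW g)
   = hW (srefl a) * (hW g * hS p - hS (wact g p) * hW g) + hS q * hW g.
  rewrite mulrBr (mulrA (hW (srefl a)) (hS _) (hW g)) e mulrDl wact_comp opprD addrA subrK.
  by rewrite !(mulrA _ (hW _)).
by apply: filtD; [exact: filt_simple|exact: filt_single].
Qed.

(** Modulo a lower level, [p w] equals [w] times the image of [p] under the inverse of [w];
    induction on the level handles the rest. *)
Lemma filt_rfilt n h : filt n h -> rfilt n h.
Proof.
elim: n h => [|n IH] _ [f fn ->].
  rewrite big1; first exact: rfilt0.
  move=> u _; have := fn u; rewrite leqn0 mmeasure_poly_eq0 => /eqP->.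
  by rewrite rmorph0 mul0r.
rewrite big_seq; elim/big_ind: _ => [||u uW]; first exact: rfilt0.
  by move=> *; exact: rfiltD.
have uVn : (msize (wact (u^-1)%VF (f u)) <= n.+1)%N by exact: msize_wact.
have := cross_lower uW uVn; rewrite wact_comp weylVK // wact_id => /IH/rfiltN/rfiltS.
rewrite opprB => h; rewrite -(subrK (hW u * hS (wact (u^-1)%VF (f u))) (hS (f u) * hW u)).
by apply: rfiltD => //; exact: rfilt_single.
Qed.

Lemma weyl_bound (f : 'End(V) -> symV X) : exists n, {in W, forall u, (msize (f u) <= n)%N}.
Proof.
exists (\max_(u <- W) msize (f u)) => u uW.
by rewrite (big_rem u uW) /= leq_maxl.
Qed.

Lemma right_span h : exists f : 'End(V) -> symV X, h = \sum_(u <- W) hW u * hS (f u).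
Proof.
have [f ->] := h_span h; have [n fn] := weyl_bound f.
have [|g _ gE] := @filt_rfilt n (\sum_(w <- W) hS (f w) * hW w); last by exists g.
(* The degree bound is known only on [W], so the coefficients are set to 0 elsewhere. *)
exists (fun u => if u \in W then f u else 0).
  by move=> u; case: ifP => [/fn|] //; rewrite mmeasure0.
by rewrite !big_seq; apply: eq_bigr => u ->.
Qed.

(** Rewriting the relation with polynomials on the left, [h_free] identifies the transform of each
    [f u] with a polynomial of lower degree. The bound on all the [f u] thus sinks to zero. *)
Lemma right_free (f : 'End(V) -> symV X) :
  \sum_(u <- W) hW u * hS (f u) = 0 -> {in W, forall u, f u = 0}.
Proof.
move=> f0; have [n] := weyl_bound f; elim: n => [|n IH] fn.
  by move=> u /fn; rewrite leqn0 mmeasure_poly_eq0 => /eqP.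
apply: IH => u uW.
have [g gn gE] : filt n (\sum_(u <- W) (hW u * hS (f u) - hS (wact u (f u)) * hW u)).
  rewrite big_seq; elim/big_ind: _ => [||v vW]; first exact: filt0.
    by move=> *; exact: filtD.
  by apply: cross_lower => //; exact: fn.
move: gE; rewrite sumrB f0 sub0r => /eqP; rewrite eq_sym -addr_eq0 -big_split /=.
under eq_bigr do rewrite -mulrDl -rmorphD /=.
move=> /eqP/h_free/(_ u uW)/eqP; rewrite addrC addr_eq0 => /eqP e.
rewrite -[f u]wact_id -(weylKV uW) -wact_comp e; apply: msize_wact.
by rewrite mmeasureN.
Qed.

Definition rcoef (h : H) : 'End(V) -> symV X := sval (cid (right_span h)).

Lemma rcoefE h : h = \sum_(u <- W) hW u * hS (rcoef h u).
Proof. exact: svalP (cid (right_span h)). Qed.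

Lemma rcoef_uniq (f g : 'End(V) -> symV X) :
  \sum_(u <- W) hW u * hS (f u) = \sum_(u <- W) hW u * hS (g u) ->
  {in W, forall u, f u = g u}.
Proof.
move=> /eqP; rewrite -subr_eq0 -sumrB => /eqP e u uW; apply/eqP; rewrite -subr_eq0.
apply/eqP; apply: (right_free (f := fun u => f u - g u)) uW.
by rewrite -[RHS]e; apply: eq_bigr => v _; rewrite rmorphB mulrBr.
Qed.

Lemma hecke_ext (T : lmodType C) (f g : H -> T) : linear f -> linear g ->
  {in W, forall w p, f (hW w * hS p) = g (hW w * hS p)} -> f =1 g.
Proof.
move=> fl gl fg h.
have lD (k : H -> T) : linear k -> forall x y, k (x + y) = k x + k y.
  by move=> kl x y; rewrite -{1}[x]scale1r kl scale1r.
have l0 (k : H -> T) : linear k -> k 0 = 0.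
  by move=> kl; apply: (addrI (k 0)); rewrite -lD // !addr0.
rewrite [h]rcoefE (big_morph f (lD f fl) (l0 f fl)) (big_morph g (lD g gl) (l0 g gl)).
by rewrite !big_seq; apply: eq_bigr => w wW; exact: fg.
Qed.

Lemma wtildeL (r : R) v v' ps :
  wtilde H ps (r *: v + v') = r%:C *: wtilde H ps v + wtilde H ps v'.
Proof.
rewrite /wtilde linC_embL linearP /= scalerBr addrACA -opprD; congr (_ - _).
rewrite scalerA mulrC -scalerA -scalerDr; congr (_ *: _).
rewrite scaler_sumr -big_split; apply: eq_bigr => b _ /=.
by rewrite prDl prZl rmorphD rmorphM scalerDl scalerA.
Qed.

(** For a simple reflection s_a, the constant of the cross relation is cancelled by the change of
    sign of the term at [a]; that term changes by twice itself, which is the origin of the factor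
    1/2 in [wtilde]. *)
Lemma wtilde_weyl w v : w \in W ->
  hW w * wtilde H (posroots X) v = wtilde H (posroots X) (w v) * hW w.
Proof.
move=> /weyl_simple; elim=> [|a g aS gS IH].
  by rewrite hW1 id_lfunE mul1r mulr1.
have gW : g \in W by apply/weyl_simple.
have aR := simples_sub aS; have sW := weyl_refl aR.
rewrite hWM // -mulrA IH comp_lfunE !mulrA; congr (_ * _).
set u := g v; rewrite /wtilde mulrBr mulrBl simple_cross // -addrA.
congr (_ + _); rewrite -scalerAr -scalerAl.
pose G b : H := (pr (srefl a u) (cor b))%:C *: hW (srefl b) * hW (srefl a).
have Gopp b : b \in allroots X -> G (- b) = - G b.
  by move=> bR; rewrite /G cor_opp // srefl_opp // rmorphN scaleNr mulNr.
have -> : hW (srefl a) * (\sum_(b <- posroots X) (pr u (cor b))%:C *: hW (srefl b))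
   = \sum_(b <- posroots X) G (srefl a b).
  rewrite mulr_sumr !big_seq; apply: eq_bigr => b; rewrite mem_posroots => /andP[_ bR].
  rewrite /G weyl_cor // -scalerAr -scalerAl -!hWM ?weyl_refl ?root_refl //.
  by rewrite weyl_conj.
have -> : (\sum_(b <- posroots X) (pr (srefl a u) (cor b))%:C *: hW (srefl b)) * hW (srefl a)
   = \sum_(b <- posroots X) G b by rewrite mulr_suml.
have Ga : G a = - (pr u (cor a))%:C%:A.
  rewrite /G -scalerAl -hWM // sreflK // hW1 -[in RHS](weyl_cor u sW aR) srefl_root //.
  by rewrite cor_opp // rmorphN scaleNr opprK.
have half : 2^-1 *: (G a + G a) = G a.
  rewrite scalerDr -scalerDl (_ : 2^-1 + 2^-1 = 1) ?scale1r //.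
  by rewrite -mulr2n -[_ *+ 2]mulr_natr mulVf ?pnatr_eq0.
rewrite sum_pos_simple // Gopp // -addrA -opprD scalerBr half Ga opprK.
by rewrite opprD addrCA addrN addr0.
Qed.

Variable M : subsystem X.
Notation HM := (hecke_sub (H := H) (WM M)).

Definition expect (h : H) : H :=
  \sum_(u <- W | `[< WM M u >]) hW u * hS (rcoef h u).

Lemma expect_sum f : expect (\sum_(u <- W) hW u * hS (f u)) =
  \sum_(u <- W | `[< WM M u >]) hW u * hS (f u).
Proof.
rewrite /expect big_seq_cond [RHS]big_seq_cond; apply: eq_bigr => u /andP[uW _].
by congr (_ * hS _); apply: rcoef_uniq uW; rewrite -rcoefE.
Qed.

Lemma expectL : linear expect.
Proof.
move=> c h k; rewrite [h in LHS]rcoefE [k in LHS]rcoefE.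
have -> : c *: (\sum_(u <- W) hW u * hS (rcoef h u)) + \sum_(u <- W) hW u * hS (rcoef k u)
  = \sum_(u <- W) hW u * hS (c *: rcoef h u + rcoef k u).
  rewrite scaler_sumr -big_split; apply: eq_bigr => u _ /=.
  by rewrite linearP mulrDr scalerAr.
rewrite expect_sum /expect scaler_sumr -big_split; apply: eq_bigr => u _ /=.
by rewrite linearP mulrDr scalerAr.
Qed.

Lemma expectD h k : expect (h + k) = expect h + expect k.
Proof. by rewrite -{1}[h]scale1r expectL scale1r. Qed.
Lemma expectN h : expect (- h) = - expect h.
Proof.
have e0 : expect 0 = 0 by apply: (addrI (expect 0)); rewrite -expectD !addr0.
by apply: (addrI (expect h)); rewrite -expectD !subrr e0.
Qed.

Lemma expect_single w p : w \in W ->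
  expect (hW w * hS p) = if `[< WM M w >] then hW w * hS p else 0.
Proof.
move=> wW; have h0 u : hW u * hS 0 = 0 by rewrite rmorph0 mulr0.
rewrite -[X in expect X](single_sum (F := fun u q => hW u * hS q) p wW h0) expect_sum.
rewrite big_mkcond -[RHS](single_sum (F := fun u q => if `[< WM M u >] then hW u * hS q else 0) p wW).
  by [].
by move=> u; case: ifP.
Qed.

Lemma expect_in h : HM (expect h).
Proof.
rewrite /expect; elim/big_ind: _ => [|x y hx hy|u /asboolP uM].
- by rewrite -(rmorph0 hS); exact: hecke_subS.
- exact: hecke_subD.
- by apply: hecke_subM; [exact: hecke_subW|exact: hecke_subS].
Qed.

(** Checked on generators of H_M. Moving a polynomial past s_a, with [a] in Pi_M, produces only
    terms on [w] and on w s_a, which are both in W_M or both outside it. *)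
Lemma expect_mulr h m : HM m -> expect (h * m) = expect h * m.
Proof.
move=> mM; elim: mM h => [p|w wM|m1 m2 _ IH1 _ IH2|m1 m2 _ IH1 _ IH2] h.
- move: h; apply: hecke_ext => [c x y|c x y|w wW q].
  + by rewrite mulrDl -scalerAl expectL.
  + by rewrite expectL mulrDl -scalerAl.
  + rewrite -mulrA -rmorphM /= !expect_single //.
    by case: ifP; rewrite ?mul0r // rmorphM mulrA.
- elim: {w} wM h => [|a g aM gM IH] h; first by rewrite hW1 !mulr1.
  have aS := M_simples aM; have sW := weyl_refl (simples_sub aS).
  rewrite hWM ?(WM_weyl gM) // !mulrA IH; congr (_ * _).
  have sM : WM M (srefl a) by exact: rgroup_refl.
  move: h {IH}; apply: hecke_ext => [c x y|c x y|w wW q].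
  + by rewrite mulrDl -scalerAl expectL.
  + by rewrite expectL mulrDl -scalerAl.
  have [q' _ e] := simple_cross_sym aS (leqnSn (msize (wact (srefl a) q))).
  rewrite wact_comp sreflK ?(simples_sub aS) // wact_id in e.
  have e' : hS q * hW (srefl a) = hW (srefl a) * hS (wact (srefl a) q) - hS q'.
    by rewrite e addrK.
  rewrite -mulrA e' mulrBr mulrA -hWM // expectD expectN !expect_single ?weylM //.
  have -> : `[< WM M (w \o srefl a)%VF >] = `[< WM M w >].
    by apply: asbool_equiv_eq; exact: WM_mulr.
  case: ifP => _; last by rewrite subr0 mul0r.
  by rewrite hWM // -!mulrA -mulrBr -e'.
- by rewrite mulrDr expectD IH1 IH2 mulrDr.
- by rewrite mulrA IH2 IH1 mulrA.
Qed.

Lemma expect_hW w : w \in W -> expect (hW w) = if `[< WM M w >] then hW w else 0.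
Proof. by move=> wW; have := expect_single 1 wW; rewrite rmorph1 mulr1. Qed.

Lemma expect1 : expect 1 = 1.
Proof.
by rewrite -(hW1 H) expect_hW ?weyl1 // asboolT //; exact: WM1.
Qed.

End Hecke.

(** * Tensor products and pin covers *)

Section LinearFun.
Variables (F : fieldType) (U T : lmodType F) (f : U -> T).
Hypothesis fl : linear f.
Lemma linD x y : f (x + y) = f x + f y.
Proof. by rewrite -{1}[x]scale1r fl scale1r. Qed.
Lemma lin0 : f 0 = 0.
Proof. by apply: (addrI (f 0)); rewrite -linD !addr0. Qed.
Lemma linZ c x : f (c *: x) = c *: f x.
Proof. by rewrite -[c *: x]addr0 fl lin0 addr0. Qed.
Lemma linN x : f (- x) = - f x.
Proof. by rewrite -scaleN1r linZ scaleN1r. Qed.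
Lemma linB x y : f (x - y) = f x - f y.
Proof. by rewrite linD linN. Qed.
Lemma lin_sum (I : Type) (s : seq I) (Q : pred I) (g : I -> U) :
  f (\sum_(i <- s | Q i) g i) = \sum_(i <- s | Q i) f (g i).
Proof. exact: (big_morph f linD lin0). Qed.
End LinearFun.

Lemma linear_comp (F : fieldType) (U T Z : lmodType F) (g : T -> Z) (f : U -> T) :
  linear g -> linear f -> linear (fun x => g (f x)).
Proof. by move=> gl fl a x y; rewrite fl gl. Qed.

Section Tensor.
Variable F : fieldType.

Section Pure.
Variables (U : lmodType F) (S : vectType F).

Lemma pureLl (c : F) (u v : U) (s : S) : pure (c *: u + v) s = c *: pure u s + pure v s.
Proof. by apply/ffunP => i; rewrite !ffunE scalerDr !scalerA mulrC. Qed.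

Lemma pureLr (c : F) (u : U) (s t : S) : pure u (c *: s + t) = c *: pure u s + pure u t.
Proof. by apply/ffunP => i; rewrite !ffunE linearP scalerDl scalerA. Qed.

Lemma pure_linl (s : S) : linear (fun u : U => pure u s).
Proof. by move=> c u v; exact: pureLl. Qed.

Lemma pure_linr (u : U) : linear (fun s : S => pure u s).
Proof. by move=> c s t; exact: pureLr. Qed.

Lemma tens_expand (x : tens U S) : x = \sum_j pure (x j) (bas S j).
Proof.
apply/ffunP => i; rewrite sum_ffunE (bigD1 i) //= big1 ?addr0 => [|k ki].
  by rewrite ffunE coord_free ?(basis_free (vbasisP _)) // eqxx scale1r.
by rewrite ffunE coord_free ?(basis_free (vbasisP _)) // (negPf ki) scale0r.
Qed.

Lemma tens_ext (T : lmodType F) (f g : tens U S -> T) : linear f -> linear g ->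
  (forall u s, f (pure u s) = g (pure u s)) -> f =1 g.
Proof.
move=> fl gl fg x; rewrite [x]tens_expand (lin_sum fl) (lin_sum gl).
by apply: eq_bigr => i _; rewrite fg.
Qed.
End Pure.

(** Allows different source and target spaces; on endomorphisms it is convertible with [tmap], so
    the actions and Dirac operators unfold to it directly. *)
Definition tm (U U' : lmodType F) (S S' : vectType F) (f : U -> U') (g : S -> S')
  (x : tens U S) : tens U' S' := \sum_j pure (f (x j)) (g (bas S j)).

Section Map.
Variables (U U' : lmodType F) (S S' : vectType F) (f : U -> U') (g : S -> S').

Lemma tm_linear : linear f -> linear (tm f g).
Proof.
move=> fl c x y; rewrite /tm scaler_sumr -big_split; apply: eq_bigr => i _ /=.
by rewrite !ffunE fl pureLl.
Qed.

Lemma tm_pure u s : linear f -> linear g -> tm f g (pure u s) = pure (f u) (g s).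
Proof.
move=> fl gl; rewrite /tm [in RHS](coord_vbasis (memvf s)).
rewrite (lin_sum gl) (lin_sum (@pure_linr _ S' (f u))); apply: eq_bigr => i _.
rewrite ffunE (linZ fl) (linZ gl) (linZ (@pure_linr _ S' (f u))).
by rewrite (linZ (@pure_linl U' _ (g (bas S i)))).
Qed.

Lemma eq_tm (f' : U -> U') (g' : S -> S') : f =1 f' -> g =1 g' -> tm f g =1 tm f' g'.
Proof. by move=> ff' gg' x; apply: eq_bigr => i _; rewrite ff' gg'. Qed.
End Map.

Lemma tm_comp (U U' U'' : lmodType F) (S S' S'' : vectType F)
  (f : U -> U') (g : S -> S') (f' : U' -> U'') (g' : S' -> S'') x :
  linear f -> linear g -> linear f' -> linear g' ->
  tm f' g' (tm f g x) = tm (f' \o f) (g' \o g) x.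
Proof.
move=> fl gl fl' gl'; move: x; apply: tens_ext.
- by apply: linear_comp; exact: tm_linear.
- by apply: tm_linear; exact: linear_comp.
- by move=> u s; rewrite !tm_pure //; exact: linear_comp.
Qed.

Lemma tm_id (U : lmodType F) (S : vectType F) (x : tens U S) : tm id id x = x.
Proof. exact: esym (tens_expand x). Qed.

Section Bilinear.
Variables (U U' : lmodType F) (S S' : vectType F).

Lemma tmLl c (f f' : U -> U') (g : S -> S') x :
  tm (fun u => c *: f u + f' u) g x = c *: tm f g x + tm f' g x.
Proof.
rewrite /tm scaler_sumr -big_split; apply: eq_bigr => i _ /=.
by rewrite pureLl.
Qed.

Lemma tmLr c (f : U -> U') (g g' : S -> S') x :
  tm f (fun s => c *: g s + g' s) x = c *: tm f g x + tm f g' x.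
Proof.
rewrite /tm scaler_sumr -big_split; apply: eq_bigr => i _ /=.
by rewrite pureLr.
Qed.

Lemma tm0l (g : S -> S') x : tm (fun _ : U => 0 : U') g x = 0.
Proof. by rewrite /tm big1 // => i _; exact: (lin0 (@pure_linl U' _ _)). Qed.
Lemma tm0r (f : U -> U') x : tm f (fun _ : S => 0 : S') x = 0.
Proof. by rewrite /tm big1 // => i _; exact: (lin0 (@pure_linr _ S' _)). Qed.

Lemma tmZl c (f : U -> U') (g : S -> S') x : tm (fun u => c *: f u) g x = c *: tm f g x.
Proof.
rewrite -[RHS]addr0 -(tm0l g x) -tmLl; apply: eq_tm => // u.
by rewrite addr0.
Qed.
Lemma tmZr c (f : U -> U') (g : S -> S') x : tm f (fun s => c *: g s) x = c *: tm f g x.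
Proof.
rewrite -[RHS]addr0 -(tm0r f x) -tmLr; apply: eq_tm => // u.
by rewrite addr0.
Qed.
Lemma tmDl (f f' : U -> U') (g : S -> S') x :
  tm (fun u => f u + f' u) g x = tm f g x + tm f' g x.
Proof.
rewrite -[tm f g x]scale1r -tmLl; apply: eq_tm => // u.
by rewrite scale1r.
Qed.
Lemma tmDr (f : U -> U') (g g' : S -> S') x :
  tm f (fun s => g s + g' s) x = tm f g x + tm f g' x.
Proof.
rewrite -[tm f g x]scale1r -tmLr; apply: eq_tm => // u.
by rewrite scale1r.
Qed.
Lemma tm_suml (I : Type) (r : seq I) (f : I -> U -> U') (g : S -> S') x :
  tm (fun u => \sum_(i <- r) f i u) g x = \sum_(i <- r) tm (f i) g x.
Proof.
elim: r => [|i r IH]; rewrite ?big_nil ?big_cons.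
  by rewrite -[RHS](tm0l g x); apply: eq_tm => // u; rewrite big_nil.
by rewrite -IH -tmDl; apply: eq_tm => // u; rewrite big_cons.
Qed.
Lemma tm_sumr (I : Type) (r : seq I) (f : U -> U') (g : I -> S -> S') x :
  tm f (fun s => \sum_(i <- r) g i s) x = \sum_(i <- r) tm f (g i) x.
Proof.
elim: r => [|i r IH]; rewrite ?big_nil ?big_cons.
  by rewrite -[RHS](tm0r f x); apply: eq_tm => // u; rewrite big_nil.
by rewrite -IH -tmDr; apply: eq_tm => // u; rewrite big_cons.
Qed.
End Bilinear.
End Tensor.

(** * Lifts of Weyl group elements to the pin covers *)

Section SpinGroup.
Variables (R : realType) (X : rootData R) (Cl : clifford (@ip R X)).
Notation V := (rV X).
Notation ip := (@ip R X).
Notation Wt := (@Wt R X Cl).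
Let ips := @ip_scalar R X.
Let ipy := @ip_sym R X.
Let ipp := @ip_pos R X.

Lemma Wt1 : Wt (1, \1%VF).
Proof.
split=> /=; [exact: pin1|exact: weyl1|move=> v].
by rewrite rmorph1 tr1 mul1r mulr1 id_lfunE.
Qed.

Lemma Wt_mul k k' : Wt k -> Wt k' -> Wt (k.1 * k'.1, (k.2 \o k'.2)%VF).
Proof.
move=> [p1 w1 e1] [p2 w2 e2]; split=> /=; [exact: pinM|exact: weylM|move=> v].
by rewrite comp_lfunE -e1 -e2 rmorphM trM /= !mulrA.
Qed.

Lemma Wt_inv k : Wt k -> Wt (tr Cl k.1, (k.2^-1)%VF).
Proof.
move=> [[a1 a2 a3] w e]; have [wV Vw] := (weylKV w, weylVK w).
have h v : eps Cl (tr Cl k.1) * gam Cl v * tr Cl (tr Cl k.1) = gam Cl ((k.2^-1)%VF v).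
  have := e ((k.2^-1)%VF v); rewrite -comp_lfunE Vw id_lfunE => <-.
  by rewrite trK !mulrA -rmorphM /= a2 rmorph1 mul1r -!mulrA a2 mulr1.
split=> /=; [|exact: weylV|exact: h].
by split; rewrite ?trK // => v; exists ((k.2^-1)%VF v); rewrite -h trK.
Qed.

Lemma Wt_opp k : Wt k -> Wt (- k.1, k.2).
Proof.
move=> [[a1 a2 a3] w e]; have h v : eps Cl (- k.1) * gam Cl v * tr Cl (- k.1) = gam Cl (k.2 v).
  by rewrite rmorphN linearN /= mulNr mulrN mulNr opprK e.
split=> //=; split; rewrite ?linearN /= ?mulrNN // => v; exists (k.2 v).
by rewrite mulNr mulrNN e.
Qed.

Lemma unit_root a : a \in allroots X -> ip ((norm a)^-1 *: a) ((norm a)^-1 *: a) = 1.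
Proof.
move=> aR; have a0 := ip_root_gt0 aR.
rewrite (qZl ips ipy) (qZr ips) mulrA -expr2 exprVn sqr_sqrtr ?ltW //.
by rewrite mulVf // gt_eqF.
Qed.

Lemma unit_srefl a v : a \in allroots X ->
  v - 2 * ip v ((norm a)^-1 *: a) *: ((norm a)^-1 *: a) = srefl a v.
Proof.
move=> aR; have a0 := ip_root_gt0 aR.
rewrite sreflE corE // (qZr ips) scalerA; congr (_ - _ *: _).
have -> : (ip a a)^-1 = (norm a)^-1 * (norm a)^-1.
  by rewrite -expr2 exprVn sqr_sqrtr // ltW.
by rewrite -!mulrA (mulrCA (norm a)^-1).
Qed.

Lemma stildeE a : stilde Cl a = gam Cl ((norm a)^-1 *: a).
Proof. by rewrite /stilde linearZ. Qed.

Lemma stilde_conj a v : a \in allroots X ->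
  stilde Cl a * gam Cl v * stilde Cl a = gam Cl (srefl a v).
Proof.
by move=> aR; rewrite stildeE (gam_conj Cl ipy) ?unit_root // unit_srefl.
Qed.

Lemma Wt_stilde a : a \in allroots X -> Wt (stilde Cl a, srefl a).
Proof.
move=> aR; split=> /=; [|exact: weyl_refl|move=> v].
  by rewrite stildeE; apply: pin_unit; rewrite ?unit_root.
rewrite -stilde_conj // stildeE epsE trE.
by rewrite mulrN !mulNr opprK.
Qed.

Lemma stilde_sqr a : a \in allroots X -> stilde Cl a * stilde Cl a = -1.
Proof. by move=> aR; rewrite stildeE gam_sqr unit_root // scale1r. Qed.

Lemma Wt_exists w : w \in weyl X -> exists a, Wt (a, w).
Proof.
move=> /weylP; elim=> [|a g aR _ [b bW]]; first by exists 1; exact: Wt1.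
by exists (stilde Cl a * b); exact: (Wt_mul (Wt_stilde aR) bW).
Qed.

Lemma Wt_uniq a b w : Wt (a, w) -> Wt (b, w) -> a = b \/ a = - b.
Proof.
move=> aW bW; have bV := Wt_inv bW; have := Wt_mul aW bV.
have [[_ b2 _] wW _] := bW; rewrite /= in b2 wW *; rewrite weylVK // => -[/= p _ e].
have [v|c1|c1] := pin_kernel ips ipy ipp p; first by rewrite e id_lfunE.
  by left; rewrite -[a]mulr1 -b2 mulrA c1 mul1r.
by right; rewrite -[a]mulr1 -b2 mulrA c1 mulN1r.
Qed.

Definition pin_lift (w : 'End(V)) : Cl :=
  if pselect (exists a, Wt (a, w)) is left e then sval (cid e) else 1.

Lemma pin_liftP w : w \in weyl X -> Wt (pin_lift w, w).
Proof.
rewrite /pin_lift; case: pselect => [e _|n /Wt_exists e]; first exact: svalP (cid e).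
by case: n.
Qed.

End SpinGroup.

Section SpinM.
Variables (R : realType) (X : rootData R) (M : subsystem X).
Notation V := (rV X).
Notation ip := (@ip R X).
Notation VM := (VM M).
Notation ipM := (@ipM R X M).
Let ips := @ip_scalar R X.
Let ipy := @ip_sym R X.
Let ipp := @ip_pos R X.

Lemma ipM_scalar x : scalar (ipM x).
Proof. by move=> a y z; rewrite /Defs.ipM linearP ips. Qed.
Lemma ipM_sym x y : ipM x y = ipM y x.
Proof. exact: ipy. Qed.
Lemma ipM_pos x : x != 0 -> 0 < ipM x x.
Proof.
move=> x0; apply: ipp; apply: contra_neq x0 => vx.
by apply: val_inj; rewrite /= vx.
Qed.

Variables (Cl : clifford ip) (ClM : clifford ipM).
Notation Wt := (@Wt R X Cl).
Notation WtM := (@WtM R X M ClM).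

Lemma vsval_WM w (v : subvs_of VM) : WM M w -> vsval (vsproj VM (w (vsval v))) = w (vsval v).
Proof. by move=> wM; rewrite vsprojK // (WM_VM wM) // subvsP. Qed.

Lemma WtM_1 : WtM (1, \1%VF).
Proof.
split=> /=; [exact: pin1|exact: WM1|move=> v].
by rewrite rmorph1 tr1 mul1r mulr1 id_lfunE vsvalK.
Qed.

Lemma WtM_mul k k' : WtM k -> WtM k' -> WtM (k.1 * k'.1, (k.2 \o k'.2)%VF).
Proof.
move=> [p1 w1 e1] [p2 w2 e2]; split=> /=; [exact: pinM|exact: WMM|move=> v].
by rewrite comp_lfunE -(vsval_WM _ w2) -e1 -e2 rmorphM trM /= !mulrA.
Qed.

Lemma WtM_inv k : WtM k -> WtM (tr ClM k.1, (k.2^-1)%VF).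
Proof.
move=> [[a1 a2 a3] w e]; have wW := WM_weyl w; have wVM := WMV w.
have [wV Vw] := (weylKV wW, weylVK wW).
have h v : eps ClM (tr ClM k.1) * gam ClM v * tr ClM (tr ClM k.1)
    = gam ClM (vsproj VM ((k.2^-1)%VF (vsval v))).
  have := e (vsproj VM ((k.2^-1)%VF (vsval v))).
  rewrite (vsval_WM _ wVM) -comp_lfunE Vw id_lfunE vsvalK => <-.
  by rewrite trK !mulrA -rmorphM /= a2 rmorph1 mul1r -!mulrA a2 mulr1.
split=> /=; [|exact: wVM|exact: h].
by split; rewrite ?trK // => v; exists (vsproj VM ((k.2^-1)%VF (vsval v))); rewrite -h trK.
Qed.

Lemma WtM_opp k : WtM k -> WtM (- k.1, k.2).
Proof.
move=> [[a1 a2 a3] w e].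
have h v : eps ClM (- k.1) * gam ClM v * tr ClM (- k.1)
    = gam ClM (vsproj VM (k.2 (vsval v))).
  by rewrite rmorphN linearN /= mulNr mulrN mulNr opprK e.
split=> //=; split; rewrite ?linearN /= ?mulrNN // => v; exists (vsproj VM (k.2 (vsval v))).
by rewrite mulNr mulrNN e.
Qed.

Lemma WtM_exists w : WM M w -> exists a, WtM (a, w).
Proof.
elim=> [|a g aM _ [b bW]]; first by exists 1; exact: WtM_1.
have aS := simplesM_rootsM aM; have aR := simples_sub (M_simples aM).
have aV : a \in VM by exact: M_rootsV.
pose u : subvs_of VM := vsproj VM ((norm a)^-1 *: a).
have uE : vsval u = (norm a)^-1 *: a by rewrite vsprojK // rpredZ.
have uu : ipM u u = 1 by rewrite /Defs.ipM uE unit_root.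
suff aW : WtM (gam ClM u, srefl a) by exists (gam ClM u * b); exact: (WtM_mul aW bW).
split=> /=; first by apply: pin_unit; [exact: ipM_sym|].
  exact: rgroup_refl.
move=> v; rewrite epsE trE mulrN !mulNr opprK (gam_conj _ ipM_sym) //; congr (gam ClM _).
apply: val_inj; rewrite /= vsval_WM; last exact: rgroup_refl.
by rewrite -unit_srefl // /Defs.ipM uE.
Qed.

Lemma WtM_uniq a b w : WtM (a, w) -> WtM (b, w) -> a = b \/ a = - b.
Proof.
move=> aW bW; have bV := WtM_inv bW; have := WtM_mul aW bV.
have [[_ b2 _] /= wM _] := bW; rewrite /= in b2 *; rewrite weylVK ?(WM_weyl wM) // => -[/= p _ e].
have [v|c1|c1] := pin_kernel ipM_scalar ipM_sym ipM_pos p; first by rewrite e id_lfunE vsvalK.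
  by left; rewrite -[a]mulr1 -b2 mulrA c1 mul1r.
by right; rewrite -[a]mulr1 -b2 mulrA c1 mulN1r.
Qed.

Variables (j : {lrmorphism ClM -> Cl}) (jE : forall v, j (gam ClM v) = gam Cl (vsval v)).

(** Realises the cover of W_M inside that of W. A vector is split along V_M: on V_M the conjugation
    formula is inherited, and on the orthogonal complement [j k.1] supercommutes with vectors, in
    agreement with W_M fixing them. *)
Lemma WtM_Wt k : WtM k -> Wt (j k.1, k.2).
Proof.
move=> [[a1 a2 a3] w e]; have wW := WM_weyl w.
have j1 : j k.1 * tr Cl (j k.1) = 1 by rewrite -(incl_tr jE) -rmorphM a1 rmorph1.
have j2 : tr Cl (j k.1) * j k.1 = 1 by rewrite -(incl_tr jE) -rmorphM a2 rmorph1.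
suff h v : eps Cl (j k.1) * gam Cl v * tr Cl (j k.1) = gam Cl (k.2 v).
  by split=> //; split=> // v; exists (k.2 v).
have hM (u : subvs_of VM) : eps Cl (j k.1) * gam Cl (vsval u) * tr Cl (j k.1) = gam Cl (k.2 (vsval u)).
  rewrite -(incl_eps jE) -(incl_tr jE) -jE -!rmorphM e /= jE.
  by rewrite vsval_WM.
have [es [on sp]] := orthonormal_basis ips ipy ipp VM.
pose v2 := v - \sum_(f <- es) ip v f *: f.
have v2o u : u \in VM -> ip v2 u = 0.
  by rewrite -sp => us; exact: (on_ortho_span ips (on_projP ips ipy v on) us).
have v1M : \sum_(f <- es) ip v f *: f \in VM.
  by rewrite -sp big_seq; apply: rpred_sum => f fes; rewrite rpredZ // memv_span.
have -> : v = vsval (vsproj VM (\sum_(f <- es) ip v f *: f)) + v2.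
  by rewrite vsprojK // addrC subrK.
move: v2 v2o => v2 v2o; rewrite !linearD /= mulrDr mulrDl hM; congr (_ + _).
rewrite (incl_ortho jE) => [|u]; last by rewrite ipy v2o // subvsP.
rewrite -mulrA j1 mulr1 (WM_fix w) // => a aM.
by rewrite v2o // M_rootsV.
Qed.

End SpinM.

(** * Frobenius reciprocity *)

Section WeylInverse.
Variables (R : realType) (X : rootData R).
Notation W := (weyl X).

Lemma weylV_uniq g h : g \in W -> (h \o g)%VF = \1%VF -> h = (g^-1)%VF.
Proof. by move=> gW hg; rewrite -[h]comp_lfun1r -(weylVK gW) comp_lfunA hg comp_lfun1l. Qed.

Lemma weylVV g : g \in W -> ((g^-1)^-1)%VF = g.
Proof. by move=> gW; apply/esym/weylV_uniq; [exact: weylV|exact: weylVK]. Qed.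

Lemma weylV_comp g h : g \in W -> h \in W -> ((g \o h)^-1)%VF = (h^-1 \o g^-1)%VF.
Proof.
move=> gW hW; apply/esym/weylV_uniq; first exact: weylM.
by rewrite -comp_lfunA (comp_lfunA g^-1) weylKV // comp_lfun1l weylKV.
Qed.

Lemma sum_weyl_inv (T : zmodType) (F : 'End(rV X) -> T) :
  \sum_(w <- W) F (w^-1)%VF = \sum_(w <- W) F w.
Proof.
rewrite -(big_map (fun w : 'End(rV X) => (w^-1)%VF) xpredT F); apply: perm_big.
apply: uniq_perm => [||g]; rewrite ?weyl_uniq //.
  rewrite map_inj_in_uniq ?weyl_uniq // => g h gW hW e.
  by rewrite -(weylVV gW) e weylVV.
apply/mapP/idP => [[h hW ->]|gW]; first exact: weylV.
by exists (g^-1)%VF; [exact: weylV|rewrite weylVV].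
Qed.

End WeylInverse.

Section Induced.
Variables (R : realType) (X : rootData R) (H : hecke X) (M : subsystem X).
Notation C := R[i].
Notation W := (weyl X).
Notation hS := (hS H).
Notation hW := (hW H).
Notation HM := (hecke_sub (H := H) (WM M)).
Variables (PM : lmodType C) (actM : H -> PM -> PM) (PM_module : is_module HM actM).
Variables (P : lmodType C) (act : H -> P -> P) (tau : H -> PM -> P).
Hypothesis P_induced : is_induced HM actM act tau.

Lemma act_lin h : linear (act h).
Proof. by case: P_induced => -[+ _ _ _] _ _ _ _; apply. Qed.
Lemma act_mul h k x : act (h * k) x = act h (act k x).
Proof. by case: P_induced => -[_ _ + _] _ _ _ _; apply. Qed.

Lemma actM_lin h : HM h -> linear (actM h).
Proof. by case: PM_module => + _ _ _; apply. Qed.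
Lemma actM1 x : actM 1 x = x.
Proof. by case: PM_module => _ + _ _; apply. Qed.
Lemma actMM h k x : HM h -> HM k -> actM (h * k) x = actM h (actM k x).
Proof. by move=> hM kM; case: PM_module => _ _ + _; apply. Qed.
Lemma actML c h k x : HM h -> HM k -> actM (c *: h + k) x = c *: actM h x + actM k x.
Proof. by move=> hM kM; case: PM_module => _ _ _; apply. Qed.

Lemma HM_scale c h : HM h -> HM (c *: h).
Proof.
move=> hM; rewrite -mulr_algl -(rmorph1 hS) -linearZ /=.
by apply: hecke_subM => //; exact: hecke_subS.
Qed.
Lemma HM_W w : WM M w -> HM (hW w). Proof. exact: hecke_subW. Qed.
Lemma HM0 : HM 0. Proof. by rewrite -(rmorph0 hS); exact: hecke_subS. Qed.
Lemma actM0 x : actM 0 x = 0.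
Proof.
have := actML 1 x HM0 HM0; rewrite !scale1r addr0 => /eqP.
by rewrite -subr_eq0 opprD addNKr oppr_eq0 => /eqP.
Qed.
Lemma actMD h k x : HM h -> HM k -> actM (h + k) x = actM h x + actM k x.
Proof. by move=> hM kM; rewrite -{1}[h]scale1r actML // scale1r. Qed.
Lemma actMZ c h x : HM h -> actM (c *: h) x = c *: actM h x.
Proof. by move=> hM; rewrite -[c *: h]addr0 actML ?actM0 ?addr0 //; exact: HM0. Qed.

Lemma tau_linr h : linear (tau h).
Proof. by case: P_induced => _ [+ _ _] _ _ _; apply. Qed.
Lemma tau_linl x : linear (tau^~ x).
Proof. by case: P_induced => _ [_ + _] _ _ _; apply. Qed.
Lemma tau_bal h m x : HM m -> tau (h * m) x = tau h (actM m x).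
Proof. by case: P_induced => _ [_ _ +] _ _ _; apply. Qed.
Lemma act_tau h k x : act h (tau k x) = tau (h * k) x.
Proof. by case: P_induced => _ _ + _ _; apply. Qed.

(** In the right normal form polynomials pass through the tensor sign into [PM], so the elements w
    (x) x span the induced module. *)
Lemma induced_ext (T : lmodType C) (f g : P -> T) : linear f -> linear g ->
  {in W, forall w x, f (act (hW w) (tau 1 x)) = g (act (hW w) (tau 1 x))} -> f =1 g.
Proof.
move=> fl gl fg; case: P_induced => _ _ _ _ uniq; apply: uniq => // h x; move: h.
apply: (@hecke_ext _ _ _ _ (fun h => f (tau h x)) (fun h => g (tau h x))).
- exact: linear_comp fl (tau_linl x).
- exact: linear_comp gl (tau_linl x).
move=> w wW p; rewrite tau_bal; last exact: hecke_subS.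
by have := fg w wW (actM (hS p) x); rewrite act_tau mulr1.
Qed.

Lemma proj_exists : exists2 e : P -> PM, linear e &
  forall h x, e (tau h x) = actM (expect M h) x.
Proof.
case: P_induced => _ _ _ + _; apply; split.
- by move=> h; apply: actM_lin; exact: expect_in.
- by move=> x c h k; rewrite expectL actML //; exact: expect_in.
- by move=> h m x mM; rewrite expect_mulr // actMM //; exact: expect_in.
Qed.

Definition proj : P -> PM := s2val (cid2 proj_exists).
Lemma proj_lin : linear proj. Proof. exact: s2valP (cid2 proj_exists). Qed.
Lemma projE h x : proj (tau h x) = actM (expect M h) x.
Proof. exact: (s2valP' (cid2 proj_exists)). Qed.

Lemma proj_tau1 x : proj (tau 1 x) = x.
Proof. by rewrite projE expect1 actM1. Qed.

Lemma proj_W w x : w \in W ->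
  proj (act (hW w) (tau 1 x)) = if `[< WM M w >] then actM (hW w) x else 0.
Proof.
move=> wW; rewrite act_tau mulr1 projE expect_hW //.
by case: ifP => // _; exact: actM0.
Qed.

Lemma act_tau1 m x : HM m -> act m (tau 1 x) = tau 1 (actM m x).
Proof. by move=> mM; rewrite act_tau mulr1 -(mul1r m) tau_bal // mul1r. Qed.

Lemma proj_equiv u y : WM M u -> proj (act (hW u) y) = actM (hW u) (proj y).
Proof.
move=> uM; have uW := WM_weyl uM; move: y; apply: induced_ext.
- exact: linear_comp proj_lin (act_lin _).
- by apply: linear_comp proj_lin; apply: actM_lin; exact: HM_W.
move=> w wW x; rewrite -act_mul -hWM // !proj_W ?weylM //.
have -> : `[< WM M (u \o w)%VF >] = `[< WM M w >] by apply: asbool_equiv_eq; exact: WM_mull.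
case: ifP => [/asboolP wM|_]; first by rewrite hWM // actMM //; exact: HM_W.
by rewrite (lin0 (actM_lin (HM_W uM))).
Qed.

Definition ordM : nat := count (fun u => `[< WM M u >]) W.

Lemma ordM_gt0 : (0 < ordM)%N.
Proof.
rewrite -has_count; apply/hasP; exists \1%VF; first exact: weyl1.
by apply/asboolP; exact: WM1.
Qed.

(** For [y] equal to u (x) x, a term survives only if the inverse of [w] times [u] lies in W_M.
    There are |W_M| such [w], and each contributes u (x) x. *)
Lemma reconstruct y :
  \sum_(w <- W) act (hW w) (tau 1 (proj (act (hW (w^-1)%VF) y))) = ordM%:R *: y.
Proof.
move: y; apply: induced_ext.
- move=> c x y; rewrite scaler_sumr -big_split; apply: eq_bigr => w _ /=.
  by rewrite act_lin proj_lin tau_linr act_lin.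
- by move=> c x y; rewrite scalerDr !scalerA mulrC.
move=> u uW x.
have -> : ordM%:R *: act (hW u) (tau 1 x) =
    \sum_(w <- W) if `[< WM M w >] then act (hW u) (tau 1 x) else 0.
  by rewrite -big_mkcond big_const_seq /= -/ordM iter_addr_0 scaler_nat.
rewrite -(sum_weyl_mull _ uW) -sum_weyl_inv !big_seq; apply: eq_bigr => w wW.
have wVW := weylV wW; rewrite weylV_comp // weylVV // -act_mul -hWM ?weylM ?weylV //.
rewrite -comp_lfunA weylKV // comp_lfun1r proj_W //.
case: ifP => [/asboolP wM|_]; last by rewrite (lin0 (tau_linr 1)) (lin0 (act_lin _)).
rewrite -act_tau1; last exact: HM_W.
by rewrite -act_mul -hWM ?weylM // -comp_lfunA weylKV // comp_lfun1r.
Qed.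

End Induced.

Section Frobenius.
Variables (R : realType) (X : rootData R) (H : hecke X) (M : subsystem X).
Notation C := R[i].
Notation W := (weyl X).
Notation hS := (hS H).
Notation hW := (hW H).
Notation HM := (hecke_sub (H := H) (WM M)).
Variables (Cl : clifford (@ip R X)) (ClM : clifford (@ipM R X M)).
Variables (j : {lrmorphism ClM -> Cl}) (jE : forall v, j (gam ClM v) = gam Cl (vsval v)).
Variables (PM : lmodType C) (actM : H -> PM -> PM) (PM_module : is_module HM actM).
Variables (P : lmodType C) (act : H -> P -> P) (tau : H -> PM -> P).
Hypothesis P_induced : is_induced HM actM act tau.
Variables (S : vectType C) (rho : Cl -> 'End(S)) (rho_module : cl_module rho).
Variables (E : vectType C) (s : Cl -> 'End(E)) (s_irrep : spin_irrep s).
Notation Wt := (@Wt R X Cl).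
Notation WtM := (@WtM R X M ClM).
Notation A k := (spin_act act rho k).
Notation proj := (proj PM_module P_induced).

Lemma rhoM_comp a b x : rho (a * b) x = rho a (rho b x).
Proof. by have [_ -> _] := rho_module; rewrite comp_lfunE. Qed.
Lemma rho1E x : rho 1 x = x.
Proof. by have [-> _ _] := rho_module; rewrite id_lfunE. Qed.

Lemma lfun_lin (U T : vectType C) (f : 'Hom(U, T)) : linear f.
Proof. exact: linearP. Qed.

Lemma spin_actE k x : A k x = tm (act (hW k.2)) (rho k.1) x.
Proof. by []. Qed.

Lemma spin_act_lin k : linear (A k).
Proof. exact: tm_linear (act_lin P_induced _). Qed.

Lemma spin_act_mul k k' x : Wt k -> Wt k' ->
  A (k.1 * k'.1, (k.2 \o k'.2)%VF) x = A k (A k' x).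
Proof.
move=> [_ w _] [_ w' _]; rewrite !spin_actE [RHS]tm_comp; try exact: act_lin P_induced _; try exact: lfun_lin.
apply: eq_tm => y /=; first by rewrite hWM // (act_mul P_induced).
exact: rhoM_comp.
Qed.

Lemma spin_act_opp a w x : A (- a, w) x = - A (a, w) x.
Proof.
rewrite !spin_actE /= -[RHS]scaleN1r -[RHS]tmZr; apply: eq_tm => // y.
by rewrite cl_moduleN // opp_lfunE scaleN1r.
Qed.

Definition incl_tens : tens PM S -> tens P S := tm (tau 1) idfun.
Definition proj_tens : tens P S -> tens PM S := tm proj idfun.
Definition spin_actR (k : ClM * 'End(rV X)) : tens PM S -> tens PM S :=
  tm (actM (hW k.2)) (rho (j k.1)).

Lemma idfun_lin (U : lmodType C) : linear (@idfun U). Proof. by []. Qed.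

Lemma incl_tens_lin : linear incl_tens.
Proof. exact: tm_linear (tau_linr P_induced _). Qed.
Lemma proj_tens_lin : linear proj_tens.
Proof. exact: tm_linear (proj_lin _ _). Qed.

Lemma proj_incl y : proj_tens (incl_tens y) = y.
Proof.
rewrite /proj_tens /incl_tens tm_comp; try exact: idfun_lin.
- rewrite -[RHS]tm_id; apply: eq_tm => // u.
  exact: proj_tau1.
- exact: tau_linr P_induced _.
- exact: proj_lin.
Qed.

Lemma proj_spin_act a w y : WtM (a, w) ->
  proj_tens (A (j a, w) y) = spin_actR (a, w) (proj_tens y).
Proof.
move=> [_ /= wM _]; have hM := HM_W H wM.
have l1 := act_lin P_induced (hW w); have l2 := proj_lin PM_module P_induced.
have l3 := actM_lin PM_module hM.
rewrite /proj_tens /spin_actR spin_actE /=.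
rewrite tm_comp //; [|exact: lfun_lin].
rewrite [RHS]tm_comp //; [|exact: lfun_lin].
by apply: eq_tm => // u /=; rewrite proj_equiv.
Qed.

Lemma proj_spin_act_incl a w y : Wt (a, w) -> ~ WM M w ->
  proj_tens (A (a, w) (incl_tens y)) = 0.
Proof.
move=> [_ /= wW _] wM.
have l1 := act_lin P_induced (hW w); have l2 := proj_lin PM_module P_induced.
have l3 := tau_linr P_induced 1.
rewrite /proj_tens /incl_tens spin_actE /= [tm _ _ (tm _ _ y)]tm_comp //; [|exact: lfun_lin].
rewrite tm_comp //; [|exact: linear_comp l1 l3|exact: lfun_lin].
rewrite -[RHS](tm0l PM (rho a) y); apply: eq_tm => // u /=.
by rewrite proj_W // asboolF.
Qed.

Lemma reconstruct_tens y :
  \sum_(w <- W) A (pin_lift Cl w, w) (incl_tens (proj_tens (A (tr Cl (pin_lift Cl w), (w^-1)%VF) y)))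
  = (ordM M)%:R *: y.
Proof.
have l2 := proj_lin PM_module P_induced; have l3 := tau_linr P_induced 1.
have -> : (ordM M)%:R *: y = tm (fun u => (ordM M)%:R *: u) idfun y.
  by rewrite tmZl tm_id.
rewrite -(eq_tm (f := fun u => \sum_(w <- W) act (hW w) (tau 1 (proj (act (hW (w^-1)%VF) u))))
  (g := idfun) (reconstruct PM_module P_induced) (fun=> erefl)).
rewrite tm_suml !big_seq; apply: eq_bigr => w wW.
have [[/= _ h2 _] _ _] := Wt_inv (pin_liftP Cl wW); rewrite trK in h2.
have l1 := act_lin P_induced (hW w); have l1' := act_lin P_induced (hW (w^-1)%VF).
rewrite /incl_tens /proj_tens !spin_actE /=.
rewrite [X in tm (tau 1) _ X]tm_comp //; [|exact: lfun_lin].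
rewrite [X in tm _ (rho _) X]tm_comp //; [|exact: linear_comp l2 l1'|exact: lfun_lin].
rewrite [LHS]tm_comp; [|exact: linear_comp l3 (linear_comp l2 l1')|exact: lfun_lin|exact: l1|exact: lfun_lin].
apply: eq_tm => // u /=.
by rewrite -rhoM_comp h2 rho1E.
Qed.

Definition homWt (F : E -> tens P S) : Prop :=
  intertwiner Wt (fun k => s k.1 : _ -> _) (spin_act act rho) F.
Definition homWtM (f : E -> tens PM S) : Prop :=
  intertwiner WtM (fun k => s (j k.1) : _ -> _) spin_actR f.

Lemma s_mul k k' x : Wt k -> Wt k' -> s (k.1 * k'.1) x = s k.1 (s k'.1 x).
Proof. by move=> kW k'W; have [_ -> //] := s_irrep; rewrite comp_lfunE. Qed.
Lemma s1E x : s 1 x = x.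
Proof. by have [-> _ _] := s_irrep; rewrite id_lfunE. Qed.

(** No genuineness is assumed of [s]: the element -1 already lies in the cover of W_M and acts by -1
    on spinors, so an intertwiner turns [s (- 1)] into a sign. *)
Lemma homWtM_opp f k x : homWtM f -> Wt k -> f (s (- k.1) x) = - f (s k.1 x).
Proof.
move=> [fl fe] kW; have m1 : WtM (-1, \1%VF) := WtM_opp (WtM_1 ClM).
have jm : Wt (j (-1), \1%VF) := WtM_Wt jE m1.
rewrite -[- k.1]mulN1r -(rmorph1 j) -rmorphN /= (s_mul _ jm kW) (fe _ m1).
rewrite /spin_actR -[RHS]scaleN1r -[in RHS](tm_id (f (s k.1 x))) -[RHS]tmZr.
apply: eq_tm => y /=; first by rewrite hW1 (actM1 PM_module).
by rewrite rmorphN rmorph1 cl_moduleN // opp_lfunE rho1E scaleN1r.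
Qed.

Definition frob_term (f : E -> tens PM S) (a : Cl) (w : 'End(rV X)) (x : E) : tens P S :=
  A (a, w) (incl_tens (f (s (tr Cl a) x))).

(** Two lifts of [w] differ by a sign, which occurs once in the outer action and once inside [s],
    and so cancels. *)
Lemma frob_term_lift f a b w x : homWtM f -> Wt (a, w) -> Wt (b, w) ->
  frob_term f a w x = frob_term f b w x.
Proof.
move=> hf aW bW; case: (Wt_uniq aW bW) => [-> //|->].
rewrite /frob_term spin_act_opp linearN /=.
rewrite (homWtM_opp x hf (Wt_inv bW)) (linN incl_tens_lin).
by rewrite (linN (spin_act_lin _)) opprK.
Qed.

(** The sum runs over all of W instead of coset representatives, whence the division by |W_M|. *)
Definition frob (f : E -> tens PM S) (x : E) : tens P S :=
  (ordM M)%:R^-1 *: \sum_(w <- W) frob_term f (pin_lift Cl w) w x.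

Lemma ordM_neq0 : (ordM M)%:R != 0 :> C.
Proof. by rewrite pnatr_eq0 -lt0n ordM_gt0. Qed.

Lemma frob_term_lin f a w : linear f -> linear (frob_term f a w).
Proof.
move=> fl; apply: linear_comp; first exact: spin_act_lin.
by apply: linear_comp incl_tens_lin _; apply: linear_comp fl (lfun_lin _).
Qed.

Lemma frob_lin f : linear f -> linear (frob f).
Proof.
move=> fl c x y; rewrite /frob scalerA mulrC -scalerA -scalerDr; congr (_ *: _).
rewrite scaler_sumr -big_split; apply: eq_bigr => w _ /=.
exact: frob_term_lin.
Qed.

Lemma frob_hom f : homWtM f -> homWt (frob f).
Proof.
move=> hf; have [fl fe] := hf; split=> [|k kW x]; first exact: frob_lin.
rewrite /frob (linZ (spin_act_lin k)) (lin_sum (spin_act_lin k)); congr (_ *: _).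
have [_ k2W _] := kW; have [[_ kk _] _ _] := kW.
rewrite -(sum_weyl_mull _ k2W) !big_seq; apply: eq_bigr => w wW.
have lW := pin_liftP Cl wW; have kl := Wt_mul kW lW.
rewrite (frob_term_lift _ hf (pin_liftP Cl (weylM k2W wW)) kl) /frob_term /=.
rewrite (spin_act_mul _ kW lW); congr (A k (A _ (incl_tens (f _)))).
have /= <- := s_mul x (Wt_inv kl) kW.
by rewrite trM -mulrA kk mulr1.
Qed.

(** Only [w] in W_M survive the projection. For these the lift may be taken in the cover of W_M,
    where equivariance of [f] makes every term equal to [f x]. *)
Lemma proj_frob f x : homWtM f -> proj_tens (frob f x) = f x.
Proof.
move=> hf; have [fl fe] := hf.
rewrite /frob (linZ proj_tens_lin) (lin_sum proj_tens_lin).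
have -> : \sum_(w <- W) proj_tens (frob_term f (pin_lift Cl w) w x) =
    \sum_(w <- W) if `[< WM M w >] then f x else 0.
  rewrite !big_seq; apply: eq_bigr => w wW; have lW := pin_liftP Cl wW.
  case: asboolP => [wM|wM]; last exact: proj_spin_act_incl.
  have [a aM] := WtM_exists ClM wM; have aW := WtM_Wt jE aM.
  rewrite (frob_term_lift _ hf lW aW) /frob_term /= proj_spin_act // proj_incl.
  rewrite -(fe (a, w) aM) -(incl_tr jE).
  have := s_mul x aW (WtM_Wt jE (WtM_inv aM)); rewrite /= => <-.
  have [[/= a1 _ _] _ _] := aM.
  by rewrite -rmorphM a1 rmorph1 s1E.
rewrite -big_mkcond big_const_seq iter_addr_0 -/(ordM M) -[f x *+ _]scaler_nat scalerA.
by rewrite mulVf ?scale1r // ordM_neq0.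
Qed.

Lemma proj_hom F : homWt F -> homWtM (fun x => proj_tens (F x)).
Proof.
move=> [Fl Fe]; split=> [|[a w] kM x]; first exact: linear_comp proj_tens_lin Fl.
by rewrite (Fe _ (WtM_Wt jE kM)) proj_spin_act.
Qed.

Lemma frob_proj F x : homWt F -> frob (fun x => proj_tens (F x)) x = F x.
Proof.
move=> [Fl Fe]; rewrite /frob.
have -> : \sum_(w <- W) frob_term (fun x => proj_tens (F x)) (pin_lift Cl w) w x = (ordM M)%:R *: F x.
  rewrite -reconstruct_tens !big_seq; apply: eq_bigr => w wW.
  by rewrite /frob_term (Fe _ (Wt_inv (pin_liftP Cl wW))).
by rewrite scalerA mulVf ?scale1r // ordM_neq0.
Qed.

Lemma frobL c f g x : frob (fun x => c *: f x + g x) x = c *: frob f x + frob g x.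
Proof.
rewrite /frob scalerA mulrC -scalerA -scalerDr; congr (_ *: _).
rewrite scaler_sumr -big_split; apply: eq_bigr => w _ /=.
by rewrite /frob_term incl_tens_lin spin_act_lin.
Qed.

End Frobenius.

(** * Dimension count: r copies of a Hom space *)

Section HasDim.
Variables (F : fieldType) (U T1 T2 : lmodType F).
Variables (P1 : (U -> T1) -> Prop) (P2 : (U -> T2) -> Prop) (r : nat).
Variables (up : 'I_r -> (U -> T1) -> U -> T2) (dn : 'I_r -> (U -> T2) -> U -> T1).
Hypotheses (upP : forall t f, P1 f -> P2 (up t f))
  (dnP : forall t g, P2 g -> P1 (dn t g)).
Hypothesis up_sum : forall t n (c : 'I_n -> F) (f : 'I_n -> U -> T1) x,
  up t (fun x => \sum_i c i *: f i x) x = \sum_i c i *: up t (f i) x.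
Hypothesis dn_sum : forall t n (c : 'I_n -> F) (g : 'I_n -> U -> T2) x,
  dn t (fun x => \sum_i c i *: g i x) x = \sum_i c i *: dn t (g i) x.
Hypothesis dn_up : forall t t' f x, P1 f ->
  dn t (up t' f) x = if t == t' then f x else 0.
Hypothesis up_dn : forall g x, P2 g -> \sum_t up t (dn t g) x = g x.

(** The maps [up] and [dn] are the inclusions and projections of a decomposition of [P2] into [r]
    copies of [P1]; bases are carried over without any finiteness assumption. *)
Lemma has_dim_mul J : has_dim P1 J -> has_dim P2 ('I_r * J).
Proof.
move=> [b [bP bspan bfree]]; exists (fun p => up p.1 (b p.2)); split.
- by move=> [t k]; exact: upP.
- move=> g gP.
  have /choice[d dP] : forall t, exists d : {n & ('I_n -> J) * ('I_n -> F)}%type,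
      forall x, dn t g x = \sum_i (tagged d).2 i *: b ((tagged d).1 i) x.
    move=> t; have [n [k [c e]]] := bspan _ (dnP t gP).
    by exists (existT _ n (k, c)).
  (* The [r] finite expansions of the components have different lengths; dependent pairs gather them
     into one finite sum. *)
  pose I : finType := {t : 'I_r & 'I_(tag (d t))}.
  pose cI (p : I) : F := (tagged (d (tag p))).2 (tagged p).
  pose jI (p : I) : 'I_r * J := (tag p, (tagged (d (tag p))).1 (tagged p)).
  exists #|I|, (fun i => jI (enum_val i)), (fun i => cI (enum_val i)) => x.
  rewrite -(up_dn x gP).
  rewrite -(big_enum_val (A := I) (fun p => cI p *: up (jI p).1 (b (jI p).2) x)) /=.
  rewrite -(sig_big_dep xpredT (fun=> xpredT)
    (fun t (i : 'I_(tag (d t))) => (tagged (d t)).2 i *: up t (b ((tagged (d t)).1 i)) x)) /=.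
  apply: eq_bigr => t _; rewrite -up_sum; congr (up t _ x).
  by apply: funext => y; exact: dP.
move=> n k c kinj c0 i0; pose t := (k i0).1.
(* Applying [dn t] to the relation keeps exactly the terms whose first label is that of [i0], and
   freeness in [P1] finishes. *)
pose I : finType := {i : 'I_n | (k i).1 == t}.
have i0t : (k i0).1 == t by [].
have := @bfree #|I| (fun i => (k (val (enum_val i : I))).2) (fun i => c (val (enum_val i : I))).
move=> /(_ _ _ (enum_rank (Sub i0 i0t : I))); rewrite enum_rankK /=; apply.
  move=> i i' e; apply: enum_val_inj; apply: val_inj; apply: kinj.
  rewrite [LHS]surjective_pairing [RHS]surjective_pairing e.
  by rewrite (eqP (valP (enum_val i : I))) (eqP (valP (enum_val i' : I))).
move=> x; rewrite -(big_enum_val (A := I) (fun i => c (val i) *: b (k (val i)).2 x)) /=.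
have -> : \sum_(p : I) c (val p) *: b (k (val p)).2 x
   = \sum_(i | (k i).1 == t) c i *: b (k i).2 x.
  rewrite [RHS](reindex_omap (val : I -> 'I_n) insub) /=.
    by apply: eq_bigl => p; rewrite valK (valP p) eqxx.
  by move=> i it; rewrite insubT.
rewrite big_mkcond /=.
have := dn_sum t c (fun i => up (k i).1 (b (k i).2)) x.
have -> : (fun x0 => \sum_i c i *: up (k i).1 (b (k i).2) x0) = (fun=> \sum_(i < 0) 0).
  by apply: funext => y; rewrite c0 big_ord0.
have -> : dn t (fun=> \sum_(i < 0) 0) x = 0.
  have := @dn_sum t 0 (fun=> 0) (fun _ _ => 0) x; rewrite !big_ord0.
  by move=> <-; congr (dn t _ x); apply: funext => y; rewrite !big_ord0.
move=> e; rewrite [RHS]e; apply: eq_bigr => i _; rewrite dn_up // eq_sym.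
by case: eqP => // _; rewrite scaler0.
Qed.

End HasDim.

Section SpinorMultiplicity.
Variables (R : realType) (X : rootData R) (H : hecke X) (M : subsystem X).
Notation C := R[i].
Notation HM := (hecke_sub (H := H) (WM M)).
Variables (Cl : clifford (@ip R X)) (ClM : clifford (@ipM R X M)).
Variables (j : {lrmorphism ClM -> Cl}) (jE : forall v, j (gam ClM v) = gam Cl (vsval v)).
Variables (PM : lmodType C) (actM : H -> PM -> PM) (PM_module : is_module HM actM).
Variables (P : lmodType C) (act : H -> P -> P) (tau : H -> PM -> P).
Hypothesis P_induced : is_induced HM actM act tau.
Variables (S SM : vectType C) (rho : Cl -> 'End(S)) (rhoM : ClM -> 'End(SM)).
Hypotheses (rho_module : cl_module rho).
Variables (E : vectType C) (s : Cl -> 'End(E)) (s_irrep : spin_irrep s).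
Notation WtM := (@WtM R X M ClM).
Notation homM := (intertwiner WtM (fun k => s (j k.1) : _ -> _) (spin_actM actM rhoM)).

Lemma spin_actME k x : spin_actM actM rhoM k x = tm (actM (hW H k.2)) (rhoM k.1) x.
Proof. by []. Qed.

Lemma tm_spin_up (f : E -> tens PM SM) (i : 'Hom(SM, S)) :
  (forall a, (i \o rhoM a)%VF = (rho (j a) \o i)%VF) -> homM f ->
  homWtM j actM rho s (fun x => tm idfun i (f x)).
Proof.
move=> ir [fl fe]; split=> [|k kM x].
  by apply: linear_comp _ fl; apply: tm_linear; exact: idfun_lin.
have [_ wM _] := kM; have l := actM_lin PM_module (HM_W H wM).
rewrite (fe k kM) spin_actME tm_comp //; [|exact: lfun_lin|exact: lfun_lin].
rewrite /spin_actR tm_comp //; [|exact: lfun_lin|exact: lfun_lin].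
by apply: eq_tm => // y /=; rewrite -!comp_lfunE ir.
Qed.

Lemma tm_spin_down (f : E -> tens PM S) (p : 'Hom(S, SM)) :
  (forall a, (p \o rho (j a))%VF = (rhoM a \o p)%VF) ->
  homWtM j actM rho s f -> homM (fun x => tm idfun p (f x)).
Proof.
move=> pr [fl fe]; split=> [|k kM x].
  by apply: linear_comp _ fl; apply: tm_linear; exact: idfun_lin.
have [_ wM _] := kM; have l := actM_lin PM_module (HM_W H wM).
rewrite (fe k kM) spin_actME /spin_actR tm_comp //; [|exact: lfun_lin|exact: lfun_lin].
rewrite tm_comp //; [|exact: lfun_lin|exact: lfun_lin].
by apply: eq_tm => // y /=; rewrite -!comp_lfunE pr.
Qed.

(** Each inclusion of [SM] into [S] followed by Frobenius reciprocity gives one [up]; reciprocity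
    backwards followed by the matching projection gives one [dn]. *)
Lemma induced_has_dim r : restricted_sum j rhoM rho r -> forall J : Type,
  has_dim homM J ->
  has_dim (intertwiner (@Wt R X Cl) (fun k => s k.1 : _ -> _) (spin_act act rho)) ('I_r * J).
Proof.
move=> [iota [pi [iotaR piR pi_iota iota_pi]]] J.
pose PJ := proj_tens PM_module P_induced (S := S).
have pjl : linear PJ by exact: proj_tens_lin.
pose up t (f : E -> tens PM SM) : E -> tens P S :=
  frob M act tau rho s (fun x => tm idfun (iota t) (f x)).
pose dn t (g : E -> tens P S) : E -> tens PM SM := fun x => tm idfun (pi t) (PJ (g x)).
have tml (S1 S2 : vectType C) (f : 'Hom(S1, S2)) : linear (tm (@idfun PM) f).
  apply: tm_linear; exact: idfun_lin.
have upl c f g x t : up t (fun x => c *: f x + g x) x = c *: up t f x + up t g x.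
  rewrite -(frobL P_induced); congr (frob _ _ _ _ _ _ x); apply: funext => y.
  exact: tml.
have up0 x t : up t (fun=> 0) x = 0.
  have := upl 1 (fun=> 0) (fun=> 0) x t; rewrite scaler0 addr0 scale1r.
  by move=> /eqP; rewrite -subr_eq0 opprD addNKr oppr_eq0 => /eqP.
apply: (has_dim_mul (up := up) (dn := dn)).
- by move=> t f hf; apply: (frob_hom jE PM_module P_induced) => //; exact: tm_spin_up.
- by move=> t g hg; apply: tm_spin_down (piR t) _; exact: proj_hom.
- move=> t n; elim: n => [|n IH] c f x.
    rewrite big_ord0 -[RHS](up0 x t); congr (up t _ x); apply: funext => y.
    by rewrite big_ord0.
  rewrite big_ord_recl -IH -upl; congr (up t _ x); apply: funext => y.
  by rewrite big_ord_recl.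
- move=> t n c g x; rewrite /dn (lin_sum pjl) (lin_sum (tml _ _ _)).
  apply: eq_bigr => i _.
  by rewrite (linZ pjl) (linZ (tml _ _ _)).
- move=> t t' f x hf; rewrite /dn /PJ (proj_frob jE PM_module P_induced rho_module s_irrep) //; last exact: tm_spin_up.
  rewrite tm_comp //; [|exact: lfun_lin|exact: lfun_lin].
  case: eqP => [<-|tt']; last first.
    rewrite -[RHS](tm0r SM (@idfun PM) (f x)); apply: eq_tm => // y /=.
    by rewrite -comp_lfunE pi_iota; case: eqP tt' => // _ _; rewrite zero_lfunE.
  rewrite -[RHS]tm_id; apply: eq_tm => // y /=.
  by rewrite -comp_lfunE pi_iota eqxx id_lfunE.
- move=> g x hg; rewrite -[RHS](frob_proj PM_module P_induced rho_module x hg).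
  have -> : (fun x => proj_tens PM_module P_induced (g x)) =
      (fun x => \sum_t tm idfun (iota t) (dn t g x)).
    apply: funext => y; rewrite -[LHS]tm_id.
    rewrite -(eq_tm (f := idfun) (g := fun z => \sum_t iota t (pi t z))) //; last first.
      move=> z; rewrite -[RHS](id_lfunE z) -iota_pi sum_lfunE; apply: eq_bigr => t _.
      by rewrite comp_lfunE.
    rewrite tm_sumr; apply: eq_bigr => t _; by rewrite [RHS]tm_comp //; exact: lfun_lin.
  rewrite /up /frob -scaler_sumr; congr (_ *: _); rewrite exchange_big /=.
  apply: eq_bigr => w _; rewrite /frob_term.
  have il : linear (incl_tens tau (S := S)) by exact: (incl_tens_lin P_induced).
  have al k : linear (spin_act act rho k) by exact: (spin_act_lin P_induced).
  by rewrite (lin_sum il) (lin_sum (al _)).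
Qed.

End SpinorMultiplicity.

(** * Symmetry and the square of the Dirac operator *)

Section Hermitian.
Variables (R : realType).
Notation C := R[i].

Definition hermitian_form (U : lmodType C) (h : U -> U -> C) : Prop :=
  [/\ forall y, scalar (h^~ y), forall x y, h y x = (h x y)^*%R
    & forall x, x != 0 -> 0 < h x x].

Definition skew_op (U : lmodType C) (h : U -> U -> C) (f : U -> U) : Prop :=
  forall x y, h (f x) y = - h x (f y).

Section Basic.
Variables (U : lmodType C) (h : U -> U -> C).
Hypothesis hh : hermitian_form h.

Lemma hDl x y z : h (x + y) z = h x z + h y z.
Proof. by case: hh => hl _ _; rewrite -{1}[x]scale1r hl mul1r. Qed.
Lemma h0l z : h 0 z = 0.
Proof. by apply: (addrI (h 0 z)); rewrite -hDl !addr0. Qed.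
Lemma hZl c x z : h (c *: x) z = c * h x z.
Proof. by case: hh => hl _ _; rewrite -[c *: x]addr0 hl h0l addr0. Qed.
Lemma hNl x z : h (- x) z = - h x z.
Proof. by rewrite -scaleN1r hZl mulN1r. Qed.
Lemma h_conj x y : h y x = (h x y)^*%R.
Proof. by case: hh. Qed.
Lemma hDr x y z : h z (x + y) = h z x + h z y.
Proof. by rewrite h_conj hDl rmorphD /= -!h_conj. Qed.
Lemma h0r z : h z 0 = 0.
Proof. by rewrite h_conj h0l rmorph0. Qed.
Lemma hZr c x z : h z (c *: x) = c^*%R * h z x.
Proof. by rewrite h_conj hZl rmorphM /= -h_conj. Qed.
Lemma hRr (r : R) x z : h z (r%:C *: x) = r%:C * h z x.
Proof. by rewrite hZr conj_Creal //; apply/complex_realP; exists r. Qed.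
Lemma hNr x z : h z (- x) = - h z x.
Proof. by rewrite h_conj hNl rmorphN /= -h_conj. Qed.
Lemma h_suml (I : Type) (r : seq I) (f : I -> U) z :
  h (\sum_(i <- r) f i) z = \sum_(i <- r) h (f i) z.
Proof. exact: (big_morph (h^~ z) (fun x y => hDl x y z) (h0l z)). Qed.
Lemma h_sumr (I : Type) (r : seq I) (f : I -> U) z :
  h z (\sum_(i <- r) f i) = \sum_(i <- r) h z (f i).
Proof. exact: (big_morph (h z) (fun x y => hDr x y z) (h0r z)). Qed.
Lemma h_eq0 x : h x x = 0 -> x = 0.
Proof.
case: hh => _ _ hp hx; apply/eqP; apply: contra_eqT hx => /hp.
by rewrite lt0r => /andP[].
Qed.
Lemma h_ge0 x : 0 <= h x x.
Proof.
by have [->|x0] := eqVneq x 0; rewrite ?h0l //; case: hh => _ _ /(_ _ x0)/ltW.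
Qed.

End Basic.

Section TensorForm.
Variables (U : lmodType C) (h : U -> U -> C) (S : vectType C).
Hypothesis hh : hermitian_form h.
Notation T e := (tm (@idfun U) (e : 'End(S))).

(* Summing over the words in es makes every e in es unitary. *)
Fixpoint tform (es : seq 'End(S)) (x y : tens U S) : C :=
  if es is e :: es' then tform es' x y + tform es' (T e x) (T e y)
  else \sum_i h (x i) (y i).

Lemma tm_end_lin (e : 'End(S)) : linear (T e).
Proof. by apply: tm_linear. Qed.

Lemma tform_hermitian es : hermitian_form (tform es).
Proof.
elim: es => [|e es IH] /=; split.
- move=> y c x x'; rewrite mulr_sumr -big_split; apply: eq_bigr => i _ /=.
  by rewrite !ffunE (hDl hh) (hZl hh).
- move=> x y; rewrite rmorph_sum; apply: eq_bigr => i _.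
  exact: (h_conj hh).
- move=> x x0; rewrite lt0r sumr_ge0 => [|i _]; last exact: (h_ge0 hh).
  rewrite andbT psumr_neq0 => [|i _]; last exact: (h_ge0 hh).
  apply/hasP; apply: contrapT => n; case/eqP: x0; apply/ffunP => i; rewrite ffunE.
  apply: (h_eq0 hh); apply/eqP; apply: contrapT => /negP hi; apply: n.
  by exists i; rewrite ?mem_index_enum // lt0r hi (h_ge0 hh).
- by move=> y c x x'; rewrite tm_end_lin !(hDl IH) !(hZl IH) mulrDr addrACA.
- by move=> x y; rewrite (h_conj IH) [in X in _ + X](h_conj IH) rmorphD.
- move=> x x0; apply: (@lt_le_trans _ _ (tform es x x)); first by case: IH => _ _; apply.
  by rewrite lerDl (h_ge0 IH).
Qed.

Lemma tm_lfun_comp (f g : U -> U) (e e' : 'End(S)) x : linear f -> linear g ->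
  tm g e' (tm f e x) = tm (g \o f) (e' \o e)%VF x.
Proof.
move=> fl gl; rewrite tm_comp //; try exact: linearP.
by apply: eq_tm => // y; rewrite comp_lfunE.
Qed.

Lemma tform_skew es f : linear f -> skew_op h f -> skew_op (tform es) (tm f (\1%VF : 'End(S))).
Proof.
move=> fl fs; elim: es => [|e es IH] x y /=.
  rewrite -sumrN; apply: eq_bigr => i _.
  have tf z k : tm f (\1%VF : 'End(S)) z k = f (z k).
    rewrite {2}(tens_expand z) !sum_ffunE (lin_sum fl); apply: eq_bigr => m _.
    by rewrite !ffunE (linZ fl) id_lfunE.
  by rewrite !tf fs.
have comm z : T e (tm f (\1%VF : 'End(S)) z) = tm f (\1%VF : 'End(S)) (T e z).
  rewrite !tm_lfun_comp //; apply: eq_tm => // u.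
  by rewrite !comp_lfunE !id_lfunE.
by rewrite IH !comm IH opprD.
Qed.

(** Since [e] squares to -1, it exchanges the two summands of the form that it introduced, up to
    signs in both arguments. Operators treated earlier anticommute with [e], so again a sign appears
    in both arguments and cancels. *)
Lemma tform_unitary es : anticommuting (es : seq (endo S)) ->
  {in es, forall e, forall x y, tform es (T e x) (T e y) = tform es x y}.
Proof.
elim: es => // e es IH /= [e2 ee an] g; rewrite inE => /orP[/eqP->|ges] x y.
  have TT z : T e (T e z) = - z.
    rewrite tm_lfun_comp // -[RHS]scaleN1r -[in RHS](tm_id z) -[RHS]tmZr.
    apply: eq_tm => // u /=.
    have /(congr1 (fun f : endo S => (f : 'End(S)) u)) := e2.
    by rewrite mulE -comp_lfunE => ->; rewrite opp_lfunE id_lfunE scaleN1r.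
  by rewrite !TT (hNl (tform_hermitian es)) (hNr (tform_hermitian es)) opprK addrC.
rewrite IH //; congr (_ + _).
have TT z : T e (T g z) = - T g (T e z).
  rewrite !tm_lfun_comp // -[RHS]scaleN1r -[RHS]tmZr.
  apply: eq_tm => // u /=; have := ee g ges; rewrite /anti.
  move=> /(congr1 (fun f : endo S => (f : 'End(S)) u)); rewrite mulE -comp_lfunE => ->.
  by rewrite opp_lfunE scaleN1r.
by rewrite !TT (hNl (tform_hermitian es)) (hNr (tform_hermitian es)) opprK IH.
Qed.

(** A unitary operator with square -1 has adjoint equal to its inverse, which is its negative. *)
Lemma tform_skew_right es e : anticommuting (es : seq (endo S)) -> e \in es ->
  (e \o e)%VF = - \1%VF -> skew_op (tform es) (T e).
Proof.
move=> an ees e2 x y.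
rewrite -[LHS](tform_unitary an ees) tm_lfun_comp // -(hNl (tform_hermitian es)).
congr (tform es _ _); rewrite -[RHS]scaleN1r -[in RHS](tm_id x) -[RHS]tmZr.
by apply: eq_tm => // u /=; rewrite e2 opp_lfunE id_lfunE scaleN1r.
Qed.

End TensorForm.

(** Stated for arbitrary skew operators [f i], to serve both V and V_M. Each summand of D is a
    product of two commuting skew operators, hence symmetric, and <Dx, Dx> = <x, DDx>. *)
Lemma dirac_sq0 (V : vectType R) (q : V -> V -> R) (A : clifford q)
    (U : lmodType C) (h : U -> U -> C) (S : vectType C) (rho : A -> 'End(S))
    (n : nat) (f : 'I_n -> U -> U) (v : 'I_n -> V) :
  (forall x, scalar (q x)) -> (forall x y, q x y = q y x) ->
  (forall x, x != 0 -> 0 < q x x) ->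
  hermitian_form h -> cl_module rho -> (forall i, linear (f i)) ->
  (forall i, skew_op h (f i)) ->
  let D x := \sum_i tm (f i) (rho (gam A (v i))) x in
  forall x, D (D x) = 0 -> D x = 0.
Proof.
move=> qs qy qp hh rm fl fs D x DD.
have [es [on sp]] := orthonormal_basis qs qy qp fullv.
pose gs : seq 'End(S) := map (fun e => rho (gam A e)) es.
have rM a b : rho (a * b) = (rho a \o rho b)%VF by case: rm.
have r1 : rho 1 = \1%VF by case: rm.
have an : anticommuting (gs : seq (endo S)).
  rewrite /gs; elim: es on {sp gs} => //= e es IH [ee eo on]; split; last exact: IH.
    by rewrite /GRing.mul /= -rM gam_sqr ee scale1r cl_moduleN // r1.
  move=> _ /mapP[w wes ->]; rewrite /anti /GRing.mul /= -!rM (gam_anti _ (eo w wes)).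
  by rewrite cl_moduleN.
have th := tform_hermitian hh gs.
(* Skewness passes from the orthonormal basis to all vectors because the coefficients of the
   expansion are real. *)
have gskew (w : V) : skew_op (tform h gs) (tm (@idfun U) (rho (gam A w))).
  have -> : tm (@idfun U) (rho (gam A w)) =
      (fun x => \sum_(e <- es) (q w e)%:C *: tm (@idfun U) (rho (gam A e)) x).
    apply: funext => y; rewrite {1}(on_expand qs qy qp on (_ : w \in _)) ?sp ?memvf //.
    transitivity (tm (@idfun U) (fun s => \sum_(e <- es) (q w e)%:C *: rho (gam A e) s) y).
      apply: eq_tm => // s; rewrite linear_sum.
      elim: (es) => [|e es' IH]; first by rewrite !big_nil cl_module0 // zero_lfunE.
      rewrite !big_cons cl_moduleD // add_lfunE IH linearZ /= cl_moduleZ //.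
      by rewrite scale_lfunE.
    by rewrite tm_sumr; apply: eq_bigr => e _; rewrite tmZr.
  move=> x1 x2; rewrite (h_suml th) (h_sumr th) -sumrN !big_seq.
  apply: eq_bigr => e ees; rewrite (hZl th) (hRr th) -mulrN; congr (_ * _).
  apply: (tform_skew_right hh an); first exact: map_f.
  have ee : q e e = 1.
    elim: es on ees {sp gs an th} => //= e' es IH [ee _ on].
    by rewrite inE => /orP[/eqP->|/(IH on)].
  by rewrite -rM gam_sqr ee scale1r cl_moduleN // r1.
have Dadj x1 x2 : tform h gs (D x1) x2 = tform h gs x1 (D x2).
  rewrite /D (h_suml th) (h_sumr th); apply: eq_bigr => i _.
  have split1 z : tm (f i) (rho (gam A (v i))) z =
      tm (f i) (\1%VF : 'End(S)) (tm (@idfun U) (rho (gam A (v i))) z).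
    rewrite tm_lfun_comp //; apply: eq_tm => // s.
    by rewrite comp_lfun1l.
  have split2 z : tm (f i) (rho (gam A (v i))) z =
      tm (@idfun U) (rho (gam A (v i))) (tm (f i) (\1%VF : 'End(S)) z).
    rewrite tm_lfun_comp //; apply: eq_tm => // s.
    by rewrite comp_lfun1r.
  by rewrite split1 (tform_skew gs (fl i) (fs i)) gskew opprK -split2.
by apply: (h_eq0 th); rewrite Dadj DD (h0r th).
Qed.

End Hermitian.

(** * The positive form on the induced module and the skewness of [wtilde] *)

Section InducedForm.
Variables (R : realType) (X : rootData R) (H : hecke X) (M : subsystem X).
Notation C := R[i].
Notation V := (rV X).
Notation W := (weyl X).
Notation roots := (allroots X).
Notation pos := (nonneg (simples X)).
Notation hS := (hS H).
Notation hW := (hW H).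
Notation HM := (hecke_sub (H := H) (WM M)).
Notation wtP := (wtilde H (posroots X)).
Notation wtM := (wtilde H (posrootsM M)).

Lemma mem_posrootsM b : (b \in posrootsM M) = pos b && (b \in rootsM M).
Proof. by rewrite mem_filter. Qed.

Lemma posrootsM_perm : perm_eq (posrootsM M) [seq b <- posroots X | b \in rootsM M].
Proof.
apply: uniq_perm.
- by rewrite filter_uniq //; case: (M_root_system M) => -[].
- by rewrite !filter_uniq // roots_uniq.
move=> b; rewrite mem_posrootsM mem_filter mem_posroots.
by case: (boolP (b \in rootsM M)) => [/M_roots -> |]; rewrite ?andbT ?andbF.
Qed.

Lemma WM_posrootsM b : b \in posrootsM M -> WM M (srefl b).
Proof. by rewrite mem_posrootsM => /andP[_ bM]; apply/(WM_srefl _ (M_roots bM)). Qed.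

Lemma HM_sum (I : eqType) (r : seq I) (f : I -> H) : {in r, forall i, HM (f i)} ->
  HM (\sum_(i <- r) f i).
Proof.
move=> fM; rewrite big_seq; elim/big_ind: _ => //; first exact: HM0.
exact: hecke_subD.
Qed.

Lemma HM_reflsum v : HM (\sum_(b <- posrootsM M) (pr v (cor b))%:C *: hW (srefl b)).
Proof. by apply: HM_sum => b bM; apply/HM_scale/HM_W/WM_posrootsM. Qed.

Lemma HM_wtM v : HM (wtM v).
Proof.
rewrite /wtilde; apply: hecke_subD; first exact: hecke_subS.
by rewrite -scaleN1r; do 2!apply: HM_scale; exact: HM_reflsum.
Qed.

(** Only roots [b] with s_b w in W_M contribute. For them the inverse of [w] sends [b] where the
    inverse of s_b w sends [- b]; as [b] is outside R_M, this has the sign of [- b], so the sum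
    effectively runs over negative roots. *)
Lemma sum_out_WM (F : V -> H) w : w \in W -> ~ WM M w ->
  (forall b, b \in roots -> F (- b) = - F b) ->
  (forall b, b \in roots -> ~ WM M (srefl b \o w)%VF -> F b = 0) ->
  \sum_(b <- posroots X) F (w b) = - \sum_(b <- posroots X) F b.
Proof.
move=> wW wM Fopp F0.
have full (G : V -> H) : \sum_(b <- posroots X) G b = \sum_(b <- roots) if pos b then G b else 0.
  by rewrite /posroots big_filter big_mkcond.
rewrite full -(sum_roots_weyl _ (weylV wW)).
transitivity (\sum_(b <- roots) if pos (- b) then F b else 0).
  rewrite !big_seq; apply: eq_bigr => b bR; rewrite -comp_lfunE weylVK // id_lfunE.
  have [uM|nM] := pselect (WM M (srefl b \o w)%VF); last by rewrite F0 //; case: ifP; case: ifP.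
  have bM : b \notin rootsM M.
    apply/negP => bM; apply: wM; apply/(WM_mull w (g := srefl b)) => //.
    by apply/(WM_srefl _ bR).
  have uW := WM_weyl uM.
  have -> : (w^-1)%VF b = ((srefl b \o w)^-1)%VF (- b).
    rewrite weylV_comp ?weyl_refl // comp_lfunE -(weylV_uniq (weyl_refl bR) (sreflK bR)).
    by rewrite -srefl_root // -[srefl b (srefl b b)]comp_lfunE sreflK // id_lfunE.
  rewrite (WM_pos (WMV uM)) ?root_opp //; apply: contra bM => nbM.
  by rewrite -[b]opprK -srefl_root ?root_opp // rootsM_refl.
rewrite sum_roots -sumrN !big_seq; apply: eq_bigr => b; rewrite mem_posroots => /andP[pb bR].
by rewrite opprK posN // pb add0r Fopp.
Qed.

Lemma expect_sumL (I : Type) (r : seq I) (f : I -> H) :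
  expect M (\sum_(i <- r) f i) = \sum_(i <- r) expect M (f i).
Proof. by rewrite (lin_sum (@expectL _ _ H M)). Qed.

(** For [w] in W_M the last sum vanishes. Otherwise [w] is moved to the left, the polynomial part is
    projected to 0, and [sum_out_WM] reverses the sign of the reflection part, turning -1/2 into
    +1/2. *)
Lemma expect_wtilde_W v w : w \in W ->
  expect M (wtP v * hW w) = wtM v * expect M (hW w) +
  2^-1 *: \sum_(b <- posroots X | b \notin rootsM M)
     (pr v (cor b))%:C *: expect M (hW (srefl b) * hW w).
Proof.
move=> wW; have EZ c h : expect M (c *: h) = c *: expect M h := linZ (@expectL _ _ H M) c h.
have EB g h : expect M (g - h) = expect M g - expect M h := linB (@expectL _ _ H M) g h.
have sumM v' : \sum_(b <- posrootsM M) (pr v' (cor b))%:C *: hW (srefl b)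
   = \sum_(b <- posroots X | b \in rootsM M) (pr v' (cor b))%:C *: hW (srefl b).
  by rewrite (perm_big _ posrootsM_perm) big_filter.
have [wM|wM] := pselect (WM M w).
  rewrite expect_mulr; last exact: HM_W.
  rewrite expect_hW // asboolT //.
  rewrite [X in _ + _ *: X]big_seq_cond big1 ?scaler0 ?addr0; last first.
    move=> b /andP[]; rewrite mem_posroots => /andP[_ bR] bM.
    rewrite -hWM ?weyl_refl // expect_hW ?weylM ?weyl_refl // asboolF ?scaler0 //.
    by move/(WM_mulr _ wM)/(WM_srefl _ bR); exact/negP.
  have ES p : expect M (hS p) = hS p.
    have := expect_single H M p (@weyl1 _ X); rewrite hW1 mul1r.
    by case: asboolP => // n; case: n; exact: WM1.
  congr (_ * _); rewrite /wtilde EB EZ ES.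
  congr (_ - _ *: _); rewrite expect_sumL sumM [RHS]big_mkcond !big_seq /=.
  apply: eq_bigr => b; rewrite mem_posroots => /andP[_ bR].
  rewrite EZ expect_hW ?weyl_refl //; case: asboolP => [/(WM_srefl _ bR) ->|n] //.
  by rewrite scaler0; case: ifP => // bM; case: n; apply/(WM_srefl _ bR).
rewrite expect_hW // asboolF // mulr0 add0r.
have [v' vE] : exists v', w v' = v.
  by exists ((w^-1)%VF v); rewrite -comp_lfunE weylVK // id_lfunE.
rewrite -vE -wtilde_weyl // /wtilde mulrBr EB -scalerAr EZ expect_single // asboolF // sub0r.
pose F b : H := (pr v (cor b))%:C *: expect M (hW (srefl b) * hW w).
have -> : expect M (hW w * \sum_(b <- posroots X) (pr v' (cor b))%:C *: hW (srefl b))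
   = \sum_(b <- posroots X) F (w b).
  rewrite mulr_sumr expect_sumL !big_seq; apply: eq_bigr => b.
  rewrite mem_posroots => /andP[_ bR]; rewrite /F -vE weyl_cor // -scalerAr EZ.
  by rewrite -!hWM ?weyl_refl ?weyl_root // weyl_conj.
have F0 b : b \in roots -> ~ WM M (srefl b \o w)%VF -> F b = 0.
  move=> bR nM; rewrite /F -hWM ?weyl_refl // expect_hW ?weylM ?weyl_refl //.
  by rewrite asboolF // scaler0.
rewrite (@sum_out_WM F) //; last first.
  by move=> b bR; rewrite /F cor_opp // srefl_opp // rmorphN scaleNr.
rewrite scalerN opprK; congr (_ *: _); rewrite [RHS]big_mkcond !big_seq; apply: eq_bigr => b.
rewrite mem_posroots => /andP[_ bR]; rewrite vE; case: ifP => // /negbFE bM.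
by apply: F0 => // /(WM_mull w (proj2 (WM_srefl M bR) bM)).
Qed.

Lemma expect_wtilde v h :
  expect M (wtP v * h) = wtM v * expect M h +
  2^-1 *: \sum_(b <- posroots X | b \notin rootsM M)
     (pr v (cor b))%:C *: expect M (hW (srefl b) * h).
Proof.
move: h; apply: hecke_ext => [c x y|c x y|w wW p].
- by rewrite mulrDr -scalerAr expectL.
- rewrite expectL mulrDr -scalerAr scalerDr addrACA; congr (_ + _).
  rewrite scalerA mulrC -scalerA -scalerDr; congr (_ *: _).
  rewrite scaler_sumr -big_split; apply: eq_bigr => b _ /=.
  by rewrite mulrDr -scalerAr expectL scalerDr !scalerA mulrC.
have pM : HM (hS p) by exact: hecke_subS.
rewrite mulrA expect_mulr // expect_wtilde_W // mulrDl -mulrA -expect_mulr //.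
congr (_ + _); rewrite -scalerAl mulr_suml; congr (_ *: _); apply: eq_bigr => b _.
by rewrite -scalerAl -expect_mulr // mulrA.
Qed.

Variables (PM : lmodType C) (actM : H -> PM -> PM) (PM_module : is_module HM actM).
Variables (P : lmodType C) (act : H -> P -> P) (tau : H -> PM -> P).
Hypothesis P_induced : is_induced HM actM act tau.
Notation proj := (proj PM_module P_induced).

Lemma actM_sum (I : eqType) (r : seq I) (Q : pred I) (f : I -> H) x :
  {in r, forall i, Q i -> HM (f i)} ->
  actM (\sum_(i <- r | Q i) f i) x = \sum_(i <- r | Q i) actM (f i) x.
Proof.
move=> fM; suff [] : HM (\sum_(i <- r | Q i) f i) /\
    actM (\sum_(i <- r | Q i) f i) x = \sum_(i <- r | Q i) actM (f i) x by [].
rewrite big_seq_cond [in RHS]big_seq_cond.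
elim/big_rec2: _ => [|i y1 y2 /andP[ir Qi] [hy ey]].
  by split; [exact: HM0|exact: (actM0 PM_module)].
have fi := fM i ir Qi.
by split; [exact: hecke_subD|rewrite (actMD PM_module) // ey].
Qed.

(** The precise failure of epsilon to intertwine [wtilde] for R with [wtilde] for R_M: a correction
    by reflections outside W_M. *)
Lemma proj_wtilde v y :
  proj (act (wtP v) y) = actM (wtM v) (proj y) +
  2^-1 *: \sum_(b <- posroots X | b \notin rootsM M)
     (pr v (cor b))%:C *: proj (act (hW (srefl b)) y).
Proof.
have pl := proj_lin PM_module P_induced.
have al h := act_lin P_induced h.
move: y; apply: (induced_ext P_induced).
- exact: linear_comp pl (al _).
- move=> c x y; rewrite pl (actM_lin PM_module (HM_wtM v)) scalerDr addrACA; congr (_ + _).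
  rewrite scalerA mulrC -scalerA -scalerDr; congr (_ *: _).
  rewrite scaler_sumr -big_split; apply: eq_bigr => b _ /=.
  by rewrite al pl scalerDr !scalerA mulrC.
move=> w wW x; rewrite !(act_tau P_induced) !mulr1 !projE expect_wtilde.
have EM h : HM (expect M h) := expect_in M h.
have sM b : HM ((pr v (cor b))%:C *: expect M (hW (srefl b) * hW w)) := HM_scale _ (EM _).
have sumM : HM (\sum_(b <- posroots X | b \notin rootsM M)
     (pr v (cor b))%:C *: expect M (hW (srefl b) * hW w)).
  elim/big_ind: _ => //; [exact: HM0|exact: hecke_subD].
rewrite (actMD PM_module) //; last exact: HM_scale.
  rewrite (actMM PM_module) //; last exact: HM_wtM.
  congr (_ + _); rewrite (actMZ PM_module) // actM_sum //; congr (_ *: _).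
  apply: eq_bigr => b _; rewrite (actMZ PM_module) // (act_tau P_induced) projE.
  by [].
by apply: hecke_subM => //; exact: HM_wtM.
Qed.

Variable form : PM -> PM -> C.
Hypothesis hf : hermitian_form form.
Hypothesis wtM_skew : forall v, skew_op form (actM (wtM v)).

Definition formP (y y' : P) : C :=
  \sum_(w <- W) form (proj (act (hW (w^-1)%VF) y)) (proj (act (hW (w^-1)%VF) y')).

(** Definiteness comes from [reconstruct]: if epsilon kills every Weyl translate of [x], then
    [x = 0]. *)
Lemma formP_hermitian : hermitian_form formP.
Proof.
have pl := proj_lin PM_module P_induced; have al h := act_lin P_induced h.
split.
- move=> y c x x'; rewrite /formP mulr_sumr -big_split; apply: eq_bigr => w _ /=.
  by rewrite al pl (hDl hf) (hZl hf).
- by move=> x y; rewrite /formP rmorph_sum; apply: eq_bigr => w _; exact: (h_conj hf).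
move=> x x0; rewrite lt0r sumr_ge0 => [|w _]; last exact: (h_ge0 hf).
rewrite andbT psumr_neq0 => [|w _]; last exact: (h_ge0 hf).
apply/hasP; apply: contrapT => n; case/eqP: x0.
have := reconstruct PM_module P_induced x; rewrite big_seq big1 => [|w wW].
  move=> /esym/eqP; rewrite scaler_eq0 pnatr_eq0.
  by rewrite gtn_eqF ?ordM_gt0 //= => /eqP.
have -> : proj (act (hW (w^-1)%VF) x) = 0.
  apply: (h_eq0 hf); apply/eqP; apply: contrapT => /negP nz; apply: n.
  by exists w => //; rewrite lt0r nz (h_ge0 hf).
by rewrite (lin0 (tau_linr P_induced 1)) (lin0 (al _)).
Qed.

(** The M-part of [proj_wtilde] is skew by assumption. In the correction for a root [b], replacing
    [w] by w s_b exchanges the two arguments' roles and negates the coefficient, so the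
    contributions of the two arguments cancel. *)
Lemma formP_wtilde v : skew_op formP (act (wtP v)).
Proof.
move=> y y'; have pl := proj_lin PM_module P_induced; have al h := act_lin P_induced h.
pose N := [seq b <- posroots X | b \notin rootsM M].
pose q w z := proj (act (hW (w^-1)%VF) z).
pose t (b : V) w z := proj (act (hW (srefl b)) (act (hW (w^-1)%VF) z)).
have qE w z : w \in W -> q w (act (wtP v) z) = actM (wtM ((w^-1)%VF v)) (q w z) +
    2^-1 *: \sum_(b <- N) (pr ((w^-1)%VF v) (cor b))%:C *: t b w z.
  move=> wW; rewrite /q -(act_mul P_induced) wtilde_weyl ?weylV // (act_mul P_induced).
  by rewrite proj_wtilde /N big_filter.
apply/eqP; rewrite -addr_eq0 /formP -big_split /=; apply/eqP.
have -> : \sum_(w <- W) (form (q w (act (wtP v) y)) (q w y') + form (q w y) (q w (act (wtP v) y')))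
  = 2^-1 * \sum_(w <- W) \sum_(b <- N)
      (pr ((w^-1)%VF v) (cor b))%:C * (form (t b w y) (q w y') + form (q w y) (t b w y')).
  rewrite mulr_sumr !big_seq; apply: eq_bigr => w wW; rewrite !qE //.
  have h2 : 2^-1 = (2^-1 : R)%:C :> C by rewrite fmorphV rmorph_nat.
  rewrite (hDl hf) (hDr hf) wtM_skew addrACA addNr add0r (hZl hf) h2 (hRr hf) -mulrDr.
  congr (_ * _); rewrite (h_suml hf) (h_sumr hf) -big_split; apply: eq_bigr => b _ /=.
  by rewrite (hZl hf) (hRr hf) mulrDr.
rewrite exchange_big big_seq big1 ?mulr0 // => b.
rewrite mem_filter mem_posroots => /and3P[_ _ bR].
have sW := weyl_refl bR.
under eq_bigr do rewrite mulrDr.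
rewrite big_split /= -(sum_weyl_mulr _ sW) -big_split big_seq big1 // => w wW /=.
have sV : ((srefl b)^-1)%VF = srefl b by apply/esym/weylV_uniq => //; exact: sreflK.
have tE z : t b w z = q (w \o srefl b)%VF z.
  by rewrite /t /q weylV_comp // sV hWM ?weylV // (act_mul P_induced).
have qE' z : t b (w \o srefl b)%VF z = q w z.
  rewrite /t /q weylV_comp // sV -(act_mul P_induced) -hWM ?weylM ?weylV //.
  by rewrite comp_lfunA sreflK // comp_lfun1l.
rewrite qE' tE weylV_comp // sV comp_lfunE.
have -> : pr (srefl b ((w^-1)%VF v)) (cor b) = - pr ((w^-1)%VF v) (cor b).
  by rewrite -[in RHS](weyl_cor _ sW bR) srefl_root // cor_opp // opprK.
by rewrite rmorphN mulNr addNr.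
Qed.

End InducedForm.

Section DualBases.
Variables (R : realType) (V : vectType R) (q : V -> V -> R).
Hypotheses (qs : forall x, scalar (q x)) (qy : forall x y, q x y = q y x)
  (qp : forall x, x != 0 -> 0 < q x x).

(** The consequence of duality that is preserved by isometries and that gives basis independence of
    contractions. *)
Definition expanding n (b b' : 'I_n -> V) : Prop :=
  (forall v, v = \sum_i q v (b' i) *: b i) /\ (forall v, v = \sum_i q v (b i) *: b' i).

Lemma dual_expanding n (b b' : 'I_n -> V) : dual_bases q b b' -> expanding b b'.
Proof.
have main (c c' : 'I_n -> V) : <<codom c'>>%VS = fullv ->
    (forall i k, q (c i) (c' k) = (i == k)%:R) -> forall v, v = \sum_i q v (c' i) *: c i.
  move=> sp cc v; apply/eqP; rewrite -subr_eq0; apply/eqP/(q_eq0 qp).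
  apply: (on_ortho_span qs (es := codom c')); last by rewrite sp memvf.
  move=> _ /codomP[k ->]; rewrite (qDl qs qy) (qNl qs qy) (qsuml qs qy) (bigD1 k) //= big1 => [|i ik].
    by rewrite (qZl qs qy) cc eqxx mulr1 addr0 subrr.
  by rewrite (qZl qs qy) cc (negPf ik) mulr0.
move=> [/span_basis sb /span_basis sb' bb]; split; first exact: main.
by apply: main => // i k; rewrite qy bb eq_sym.
Qed.

Lemma expanding_isom n (b b' : 'I_n -> V) (g g' : 'End(V)) : expanding b b' ->
  (forall x y, q (g x) (g y) = q x y) -> (g \o g')%VF = \1%VF ->
  expanding (fun i => g (b i)) (fun i => g (b' i)).
Proof.
move=> [e e'] gq gg; split=> v; rewrite -{1}[v]id_lfunE -gg comp_lfunE.
  rewrite {1}(e (g' v)) linear_sum; apply: eq_bigr => i _.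
  by rewrite linearZ /= -gq -comp_lfunE gg id_lfunE.
rewrite {1}(e' (g' v)) linear_sum; apply: eq_bigr => i _.
by rewrite linearZ /= -gq -comp_lfunE gg id_lfunE.
Qed.

Lemma expanding_sum (T : lmodType R[i]) (B : V -> V -> T) n m (b b' : 'I_n -> V)
    (c c' : 'I_m -> V) :
  (forall r x y z, B (r *: x + y) z = r%:C *: B x z + B y z) ->
  (forall r x y z, B z (r *: x + y) = r%:C *: B z x + B z y) ->
  expanding b b' -> expanding c c' ->
  \sum_i B (b i) (b' i) = \sum_k B (c k) (c' k).
Proof.
move=> Bl Br [_ eb] [ec _].
have BDl x y z : B (x + y) z = B x z + B y z by rewrite -{1}[x]scale1r Bl scale1r.
have B0l z : B 0 z = 0 by apply: (addrI (B 0 z)); rewrite -BDl !addr0.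
have BZl r x z : B (r *: x) z = r%:C *: B x z by rewrite -[r *: x]addr0 Bl B0l addr0.
have BDr x y z : B z (x + y) = B z x + B z y by rewrite -{1}[x]scale1r Br scale1r.
have B0r z : B z 0 = 0 by apply: (addrI (B z 0)); rewrite -BDr !addr0.
have BZr r x z : B z (r *: x) = r%:C *: B z x by rewrite -[r *: x]addr0 Br B0r addr0.
transitivity (\sum_i \sum_k (q (b i) (c' k))%:C *: B (c k) (b' i)).
  apply: eq_bigr => i _; rewrite {1}(ec (b i)).
  rewrite (big_morph (B^~ (b' i)) (fun x y => BDl x y _) (B0l _)).
  by apply: eq_bigr => k _.
rewrite exchange_big; apply: eq_bigr => k _ /=; rewrite [in RHS](eb (c' k)).
rewrite (big_morph (B (c k)) (fun x y => BDr x y _) (B0r _)).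
by apply: eq_bigr => i _; rewrite BZr qy.
Qed.
End DualBases.

Section RootPairs.
Variables (R : realType) (X : rootData R) (U : lmodType R[i]).
Notation V := (rV X).
Notation roots := (allroots X).
Notation pos := (nonneg (simples X)).
Variable T : V -> V -> U.
Hypothesis T_oppl : forall a b, a \in roots -> b \in roots -> T (- a) b = - T a b.
Hypothesis T_oppr : forall a b, a \in roots -> b \in roots -> T a (- b) = - T a b.
Hypothesis T_swap : forall a b, a \in roots -> b \in roots -> T a b = - T (srefl a b) a.

Let sg (b : V) : R[i] := if pos b then 1 else -1.
Let sgN b : b \in roots -> sg (- b) = - sg b.
Proof. by move=> bR; rewrite /sg posN //; case: (pos b); rewrite ?opprK. Qed.

(* Each product of two reflections arises from several pairs of roots; on all
   pairs of roots, (a, b) |-> (s_a b, a) exchanges the two signed sums below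
   up to sign. *)
Lemma sum_root_pairs :
  \sum_(a <- posroots X) \sum_(b <- posroots X | pos (srefl a b)) T a b = 0.
Proof.
pose Z := \sum_(a <- roots) \sum_(b <- roots) (sg a * (sg b + sg (srefl a b))) *: T a b.
have Z0 : Z = 0.
  rewrite /Z; under eq_bigr do under eq_bigr do rewrite mulrDr scalerDl.
  under eq_bigr do rewrite big_split /=; rewrite big_split /=.
  have -> : \sum_(a <- roots) \sum_(b <- roots) (sg a * sg (srefl a b)) *: T a b =
      - \sum_(a <- roots) \sum_(b <- roots) (sg a * sg b) *: T b a.
    rewrite -sumrN !big_seq; apply: eq_bigr => a aR.
    rewrite -(sum_roots_weyl (fun b => (sg a * sg b) *: T b a) (weyl_refl aR)).
    rewrite -sumrN !big_seq; apply: eq_bigr => b bR.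
    by rewrite [in LHS]T_swap // scalerN.
  rewrite [X in X - _]exchange_big /=.
  apply/eqP; rewrite subr_eq0; apply/eqP; apply: eq_bigr => a _; apply: eq_bigr => b _.
  by rewrite mulrC.
(* The factor 8 is 4 choices of signs for [a] and [b], under which each term is invariant, times the
   value 2 of the coefficient on positive pairs with [srefl a b] positive; it is 0 on the other
   positive pairs. *)
have Z8 : Z = (\sum_(a <- posroots X) \sum_(b <- posroots X | pos (srefl a b)) T a b) *+ 8.
  rewrite /Z sum_roots -sumrMnl !big_seq; apply: eq_bigr => a.
  rewrite mem_posroots => /andP[pa aR].
  have -> : \sum_(b <- roots) (sg (- a) * (sg b + sg (srefl (- a) b))) *: T (- a) b =
      \sum_(b <- roots) (sg a * (sg b + sg (srefl a b))) *: T a b.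
    rewrite !big_seq; apply: eq_bigr => b bR.
    by rewrite srefl_opp // T_oppl // sgN // mulNr scalerN scaleNr opprK.
  rewrite -mulr2n sum_roots [X in _ = X *+ 8]big_mkcond -!sumrMnl !big_seq.
  apply: eq_bigr => b; rewrite mem_posroots => /andP[pb bR].
  rewrite linearN /= T_oppr // !sgN ?root_refl // -opprD mulrN scaleNr scalerN opprK.
  rewrite /sg pa pb mul1r; case: ifP => _; last by rewrite subrr scale0r addr0 !mul0rn.
  by rewrite -mulr2n -(mulr2n 1) scaler_nat -!mulrnA.
have := Z8; rewrite Z0 => /esym/eqP; rewrite -scaler_nat scaler_eq0 pnatr_eq0 /=.
by move/eqP.
Qed.
End RootPairs.

(** * The square of the Dirac operator *)

Section DiracSquare.
Variables (R : realType) (X : rootData R) (H : hecke X).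
Notation C := R[i].
Notation V := (rV X).
Notation W := (weyl X).
Notation roots := (allroots X).
Notation pos := (nonneg (simples X)).
Notation hS := (hS H).
Notation hW := (hW H).
Notation ip := (@ip R X).
Notation wt := (wtilde H (posroots X)).
Let ips := @ip_scalar R X.
Let ipy := @ip_sym R X.
Let ipp := @ip_pos R X.
Variables (Cl : clifford ip) (P : lmodType C) (act : H -> P -> P).
Hypothesis act_module : is_module (fun=> True) act.
Variables (S : vectType C) (rho : Cl -> 'End(S)) (rho_module : cl_module rho).
Variables (n : nat) (b b' : 'I_n -> V).
Hypothesis bb : expanding ip b b'.

Let act_l h : linear (act h). Proof. by case: act_module => + _ _ _; apply. Qed.
Let act_m h k x : act (h * k) x = act h (act k x).
Proof. by case: act_module => _ _ + _; apply. Qed.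
Let act_c c h k x : act (c *: h + k) x = c *: act h x + act k x.
Proof. by case: act_module => _ _ _; apply. Qed.
Let rho_m c d x : rho (c * d) x = rho c (rho d x).
Proof. by have [_ -> _] := rho_module; rewrite comp_lfunE. Qed.

Definition op (h : H) (a : Cl) : tens P S -> tens P S := tm (act h) (rho a).

Lemma op_lin h a : linear (op h a). Proof. exact: tm_linear. Qed.
Lemma op_mul h a k c x : op h a (op k c x) = op (h * k) (a * c) x.
Proof.
rewrite /op tm_comp //; try exact: linearP.
by apply: eq_tm => y /=; rewrite ?act_m ?rho_m.
Qed.
Lemma opLl c h k a x : op (c *: h + k) a x = c *: op h a x + op k a x.
Proof. by rewrite /op -tmLl; apply: eq_tm => // y. Qed.
Lemma opLr (r : R) h a c x : op h (r *: a + c) x = r%:C *: op h a x + op h c x.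
Proof.
rewrite /op -tmLr; apply: eq_tm => // y; have [_ _ ->] := rho_module.
by rewrite add_lfunE scale_lfunE.
Qed.
Lemma op0l a x : op 0 a x = 0.
Proof. by have := opLl (-1) 0 0 a x; rewrite scaler0 addr0 scaleN1r addNr. Qed.
Lemma op0r h x : op h 0 x = 0.
Proof. by have := opLr (-1) h 0 0 x; rewrite scaler0 addr0 rmorphN rmorph1 scaleN1r addNr. Qed.
Lemma opZl c h a x : op (c *: h) a x = c *: op h a x.
Proof. by rewrite -[c *: h]addr0 opLl op0l addr0. Qed.
Lemma opZr (r : R) h a x : op h (r *: a) x = r%:C *: op h a x.
Proof. by rewrite -[r *: a]addr0 opLr op0r addr0. Qed.
Lemma opDl h k a x : op (h + k) a x = op h a x + op k a x.
Proof. by rewrite -{1}[h]scale1r opLl scale1r. Qed.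
Lemma opDr h a c x : op h (a + c) x = op h a x + op h c x.
Proof. by rewrite -{1}[a]scale1r opLr scale1r. Qed.
Lemma opNr h a x : op h (- a) x = - op h a x.
Proof. by rewrite -scaleN1r opZr rmorphN rmorph1 scaleN1r. Qed.
Lemma opNl h a x : op (- h) a x = - op h a x.
Proof. by rewrite -scaleN1r opZl scaleN1r. Qed.
Lemma op_suml (I : Type) (r : seq I) (f : I -> H) a x :
  op (\sum_(i <- r) f i) a x = \sum_(i <- r) op (f i) a x.
Proof. exact: (big_morph (fun h => op h a x) (fun h k => opDl h k a x) (op0l a x)). Qed.
Lemma op_sumr (I : Type) (r : seq I) (f : I -> Cl) h x :
  op h (\sum_(i <- r) f i) x = \sum_(i <- r) op h (f i) x.
Proof. exact: (big_morph (fun a => op h a x) (fun a c => opDr h a c x) (op0r h x)). Qed.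

Notation D := (dirac act rho b b').
Let lin v : symV X := linC (emb v).

Lemma diracE x : D x = \sum_i op (wt (b i)) (gam Cl (b' i)) x.
Proof. by []. Qed.

Lemma dirac_lin : linear D.
Proof.
move=> c x y; rewrite !diracE scaler_sumr -big_split; apply: eq_bigr => i _ /=.
exact: op_lin.
Qed.

(** The Dirac operator with the vectors themselves in place of their [wtilde]. Its coefficients
    commute, so its square is the Casimir element up to sign; [Gam] collects the reflection part. *)
Definition D0 x := \sum_i op (hS (lin (b i))) (gam Cl (b' i)) x.
Definition Gam x := \sum_(a <- posroots X) op (hW (srefl a)) (gam Cl (sharp (cor a))) x.

Lemma Gam_lin : linear Gam.
Proof.
move=> c x y; rewrite /Gam scaler_sumr -big_split; apply: eq_bigr => i _ /=.
exact: op_lin.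
Qed.

Lemma D0_split x : D0 x = D x + 2^-1 *: Gam x.
Proof.
have -> : Gam x = \sum_i op (\sum_(a <- posroots X) (pr (b i) (cor a))%:C *: hW (srefl a)) (gam Cl (b' i)) x.
  under [RHS]eq_bigr do rewrite op_suml; rewrite exchange_big; apply: eq_bigr => a _ /=.
  rewrite {1}(bb.2 (sharp (cor a))) linear_sum op_sumr; apply: eq_bigr => i _.
  by rewrite linearZ /= opZr opZl ipy sharpP.
rewrite diracE scaler_sumr -big_split; apply: eq_bigr => i _ /=.
by rewrite -opZl -opDl /wtilde subrK.
Qed.

Definition casimir : symV X := \sum_i lin (b i) * lin (b' i).

(** Polynomials commute, so adding the terms (i, k) and (k, i) leaves the Clifford anticommutator, a
    scalar. The double sum is thus computed twice over and then halved. *)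
Lemma D0_sqr x : D0 (D0 x) = - op (hS casimir) 1 x.
Proof.
pose T i k : tens P S := op (hS (lin (b i)) * hS (lin (b k))) (gam Cl (b' i) * gam Cl (b' k)) x.
have -> : D0 (D0 x) = \sum_i \sum_k T i k.
  rewrite {1}/D0; apply: eq_bigr => i _; rewrite {1}/D0 (lin_sum (op_lin _ _)).
  by apply: eq_bigr => k _; rewrite op_mul.
have TT i k : T i k + T k i = - ((2 * ip (b' i) (b' k))%:C *: op (hS (lin (b i) * lin (b k))) 1 x).
  have -> : T k i = op (hS (lin (b i)) * hS (lin (b k))) (gam Cl (b' k) * gam Cl (b' i)) x.
    by rewrite /T -!rmorphM mulrC.
  rewrite -opDr gam_rel opZr -rmorphM -scaleNr; congr (_ *: _).
  by rewrite mulNr rmorphN.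
have dbl : (\sum_i \sum_k T i k) *+ 2 = - (op (hS casimir) 1 x *+ 2).
  rewrite mulr2n {2}exchange_big -big_split /=.
  under eq_bigr do rewrite -big_split /=.
  under eq_bigr do under eq_bigr do rewrite TT.
  rewrite /casimir rmorph_sum op_suml -sumrMnl -sumrN; apply: eq_bigr => i _.
  rewrite -mulNrn -opNl -[RHS]scaler_nat.
  have -> : - hS (lin (b i) * lin (b' i)) =
      \sum_k - ((ip (b' i) (b' k))%:C *: hS (lin (b i) * lin (b k))).
    rewrite sumrN; congr (- _); rewrite {1}(bb.1 (b' i)) /lin linC_sum mulr_sumr rmorph_sum.
    by apply: eq_bigr => k _; rewrite /= linC_embZ -scalerAr linearZ.
  rewrite op_suml scaler_sumr; apply: eq_bigr => k _.
  by rewrite opNl opZl scalerN scalerA rmorphM rmorph_nat.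
apply: (@scalerI _ _ (2 : C)); first by rewrite pnatr_eq0.
by rewrite !scaler_nat dbl mulNrn.
Qed.

Lemma sharp_cor a : a \in roots -> sharp (cor a) = (2 / ip a a) *: a.
Proof.
move=> aR; apply: (q_inj ips ipy ipp) => z.
by rewrite ipy sharpP corE // (qZl ips ipy) (ipy a) mulrAC.
Qed.

Lemma normd_cor a : a \in roots -> normd (cor a) = 2 / norm a.
Proof.
move=> aR; have a0 := ip_root_gt0 aR.
rewrite /normd /ipd sharp_cor // (qZl ips ipy) (qZr ips).
have -> : 2 / ip a a * (2 / ip a a * ip a a) = (2 / norm a) ^+ 2.
  by rewrite divfK ?gt_eqF // expr_div_n sqr_sqrtr ?ltW // expr2 mulrAC.
by rewrite sqrtr_sqr ger0_norm // divr_ge0 // sqrtr_ge0.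
Qed.

Lemma gam_sharp_cor a : a \in roots ->
  gam Cl (sharp (cor a)) = normd (cor a) *: stilde Cl a.
Proof.
move=> aR; have a0 := ip_root_gt0 aR.
rewrite sharp_cor // normd_cor // /stilde scalerA -mulrA -linearZ; congr (gam Cl (_ *: _)).
by rewrite -expr2 exprVn sqr_sqrtr // ltW.
Qed.

Lemma Gam_stilde x : Gam x = \sum_(a <- posroots X)
  (normd (cor a))%:C *: op (hW (srefl a)) (stilde Cl a) x.
Proof.
rewrite /Gam !big_seq; apply: eq_bigr => a; rewrite mem_posroots => /andP[_ aR].
by rewrite gam_sharp_cor // opZr.
Qed.

(** Moving the lifted reflection across D replaces both dual bases by their images under s_a, which
    D does not see; the Clifford side contributes the sign. *)
Lemma dirac_anticomm a x : a \in roots ->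
  D (op (hW (srefl a)) (stilde Cl a) x) = - op (hW (srefl a)) (stilde Cl a) (D x).
Proof.
move=> aR; have sW := weyl_refl aR.
have stg v : stilde Cl a * gam Cl v = - (gam Cl (srefl a v) * stilde Cl a).
  by rewrite -stilde_conj // -mulrA stilde_sqr // mulrN1 opprK.
rewrite diracE (lin_sum (op_lin _ _)) -sumrN.
transitivity (\sum_i op (wt (srefl a (b i)) * hW (srefl a)) (gam Cl (srefl a (b' i)) * stilde Cl a) x).
  under eq_bigr do rewrite op_mul.
  pose B v w := op (wt v * hW (srefl a)) (gam Cl w * stilde Cl a) x.
  apply: (expanding_sum ipy (B := B)) bb _.
  - by move=> r v w z; rewrite /B wtildeL mulrDl -scalerAl opLl.
  - by move=> r v w z; rewrite /B linearP /= [in X in op _ X]mulrDl -scalerAl opLr.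
  - apply: (expanding_isom bb (g' := srefl a)); last exact: sreflK.
    by move=> v w; exact: srefl_ip.
by apply: eq_bigr => i _; rewrite op_mul wtilde_weyl // stg opNr opprK.
Qed.

Lemma dirac_Gam x : D (Gam x) = - Gam (D x).
Proof.
rewrite !Gam_stilde (lin_sum dirac_lin) -sumrN !big_seq; apply: eq_bigr => a.
rewrite mem_posroots => /andP[_ aR].
by rewrite (linZ dirac_lin) dirac_anticomm // scalerN.
Qed.

(** In the square of [D0] = D + [Gam] / 2 the cross terms cancel, because D anticommutes with
    [Gam]. *)
Lemma dirac_sqr x : D (D x) = - op (hS casimir) 1 x - 4^-1 *: Gam (Gam x).
Proof.
rewrite -D0_sqr !D0_split (linD dirac_lin) (linZ dirac_lin) (linD Gam_lin) (linZ Gam_lin).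
rewrite dirac_Gam scalerN scalerDr scalerA -addrA; set y := 2^-1 *: _.
rewrite !addrA subrK -invfM.
by rewrite (_ : 2 * 2 = 4 :> C) ?addrK // -natrM.
Qed.

(** The pairs with [srefl a c] positive add up to zero by [sum_root_pairs]; the remaining ones are
    those that define [Omega]. *)
Lemma Gam_sqr x : Gam (Gam x) = \sum_(a <- posroots X)
    \sum_(c <- posroots X | pos (- srefl a c))
    (normd (cor a) * normd (cor c))%:C *:
      op (hW (srefl a) * hW (srefl c)) (stilde Cl a * stilde Cl c) x.
Proof.
pose T a c : tens P S := (normd (cor a) * normd (cor c))%:C *:
      op (hW (srefl a) * hW (srefl c)) (stilde Cl a * stilde Cl c) x.
have -> : Gam (Gam x) = \sum_(a <- posroots X) \sum_(c <- posroots X) T a c.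
  rewrite Gam_stilde; apply: eq_bigr => a _; rewrite Gam_stilde.
  rewrite (lin_sum (op_lin _ _)) scaler_sumr; apply: eq_bigr => c _.
  by rewrite (linZ (op_lin _ _)) op_mul scalerA -rmorphM.
have stN a : a \in roots -> stilde Cl (- a) = - stilde Cl a.
  move=> aR; rewrite /stilde linearN scalerN; congr (- (_^-1 *: _)).
  by rewrite /norm (qNl ips ipy) (qNr ips) opprK.
have ncW w a : w \in W -> a \in roots -> normd (cor (w a)) = normd (cor a).
  by move=> wW aR; rewrite !normd_cor ?weyl_root // /norm weyl_ip.
have ncN a : a \in roots -> normd (cor (- a)) = normd (cor a).
  by move=> aR; rewrite -srefl_root // ncW // weyl_refl.
have Tl a c : a \in roots -> c \in roots -> T (- a) c = - T a c.
  by move=> aR cR; rewrite /T ncN // stN // srefl_opp // mulNr opNr scalerN.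
have Tr a c : a \in roots -> c \in roots -> T a (- c) = - T a c.
  by move=> aR cR; rewrite /T ncN // stN // srefl_opp // mulrN opNr scalerN.
have Ts a c : a \in roots -> c \in roots -> T a c = - T (srefl a c) a.
  move=> aR cR; have sW := weyl_refl aR; have rR := root_refl aR cR.
  rewrite /T ncW // mulrC -!hWM ?weyl_refl // weyl_conj // -scalerN -opNr; congr (_ *: op _ _ x).
  have -> : stilde Cl (srefl a c) = stilde Cl a * stilde Cl c * stilde Cl a.
    rewrite [stilde Cl c]stildeE stilde_conj // /stilde -linearZ /=; congr (gam Cl _).
    by rewrite linearZ /= /norm weyl_ip.
  by rewrite -mulrA stilde_sqr // mulrN1 opprK.
have := sum_root_pairs Tl Tr Ts => Z.
transitivity (\sum_(a <- posroots X) \sum_(c <- posroots X) T a c -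
  \sum_(a <- posroots X) \sum_(c <- posroots X | pos (srefl a c)) T a c); first by rewrite Z subr0.
rewrite -sumrB !big_seq; apply: eq_bigr => a.
rewrite mem_posroots => /andP[_ aR].
rewrite (bigID (fun c => pos (srefl a c))) /= addrC addrK big_seq_cond [RHS]big_seq_cond.
apply: eq_bigl => c; case: (boolP (c \in posroots X)) => //=.
by rewrite mem_posroots => /andP[_ cR]; rewrite posN // root_refl.
Qed.

Lemma casimir_wact w : w \in W -> wact w casimir = casimir.
Proof.
move=> wW; rewrite /casimir wact_sum; under eq_bigr do rewrite wactM !wact_linC.
pose B v u : symV X := lin v * lin u.
apply: (expanding_sum ipy (B := B)) bb.
- by move=> r v u z; rewrite /B /lin linC_embL mulrDl scalerAl.
- by move=> r v u z; rewrite /B /lin linC_embL mulrDr scalerAr.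
- apply: (expanding_isom bb (g' := (w^-1)%VF)); last exact: weylVK.
  by move=> v u; exact: weyl_ip.
Qed.

Lemma pC_embl v (y : cplx R (rVd X)) :
  @pC R X (emb v) y = \sum_k y 0 k * (pr v (bas (rVd X) k))%:C.
Proof.
rewrite /pC /pairC exchange_big; apply: eq_bigr => k _ /=.
rewrite [in RHS](basis_expand v).
rewrite (big_morph (fun v => pr v (bas (rVd X) k)) (fun x y => prDl x y _) (pr0l _)).
rewrite rmorph_sum mulr_sumr; apply: eq_bigr => i _ /=.
by rewrite prZl rmorphM mxE mulrCA mulrA.
Qed.

Lemma evalC_lin v nu : evalC (lin v) nu = pC (emb v) nu.
Proof.
rewrite /evalC /lin /linC raddf_sum /=.
under eq_bigr do rewrite mevalZ mevalXU.
rewrite pC_embl; under eq_bigr do rewrite pC_embl mulr_sumr mxE.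
rewrite exchange_big; apply: eq_bigr => k _ /=.
rewrite [in RHS](basis_expand v).
rewrite (big_morph (fun v => pr v (bas (rVd X) k)) (fun x y => prDl x y _) (pr0l _)).
rewrite rmorph_sum mulr_sumr; apply: eq_bigr => i _ /=.
by rewrite prZl rmorphM mulrCA.
Qed.

Lemma evalC_casimir (nu : cplx R (rVd X)) : evalC casimir nu = ipdC nu nu.
Proof.
have -> : evalC casimir nu = \sum_i pC (emb (b i)) nu * pC (emb (b' i)) nu.
  rewrite /evalC /casimir raddf_sum /=; apply: eq_bigr => i _.
  by rewrite mevalM -!evalC_lin.
under eq_bigr do rewrite !pC_embl mulr_suml.
rewrite exchange_big; apply: eq_bigr => k _ /=.
under eq_bigr do rewrite mulr_sumr.
rewrite exchange_big; apply: eq_bigr => l _ /=.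
rewrite /ipd [in RHS](bb.2 (sharp (bas (rVd X) k))) (qsuml ips ipy) rmorph_sum mulr_sumr.
apply: eq_bigr => i _; rewrite (qZl ips ipy) -!sharpP rmorphM /= (ipy (sharp _)).
by rewrite -!mulrA; congr (_ * _); rewrite mulrCA.
Qed.

Lemma ipdCZ c (nu : cplx R (rVd X)) : ipdC (c *: nu) (c *: nu) = c ^+ 2 * ipdC nu nu.
Proof.
rewrite /ipdC mulr_sumr; apply: eq_bigr => i _; rewrite mulr_sumr; apply: eq_bigr => k _.
by rewrite !mxE mulrACA -expr2 !mulrA.
Qed.

End DiracSquare.

(** * From an occurrence of sigma_M to one of the restriction of sigma *)

Section ExtendM.
Variables (R : realType) (X : rootData R) (H : hecke X) (M : subsystem X).
Notation C := R[i].
Notation W := (weyl X).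
Notation HM := (hecke_sub (H := H) (WM M)).
Variables (Cl : clifford (@ip R X)) (ClM : clifford (@ipM R X M)).
Variables (j : {lrmorphism ClM -> Cl}) (jE : forall v, j (gam ClM v) = gam Cl (vsval v)).
Variables (PM : lmodType C) (actM : H -> PM -> PM) (PM_module : is_module HM actM).
Variables (SM : vectType C) (rhoM : ClM -> 'End(SM)) (rhoM_module : cl_module rhoM).
Variables (EM : vectType C) (sM : ClM -> 'End(EM)) (sM_irrep : spin_irrepM sM).
Variables (E : vectType C) (s : Cl -> 'End(E)) (s_irrep : spin_irrep s).
Hypothesis s_genuine : genuine s.
Notation WtM := (@WtM R X M ClM).
Notation A := (spin_actM actM rhoM).

(** The kernel is invariant and proper, hence zero. The retraction is merely linear; equivariance is
    restored later by averaging. *)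
Lemma irrep_hom_inj (phi : EM -> E) (x0 : EM) :
  intertwiner WtM (fun k => sM k.1 : _ -> _) (fun k => s (j k.1) : _ -> _) phi ->
  phi x0 != 0 -> exists2 psi : E -> EM, linear psi & forall x, psi (phi x) = x.
Proof.
move=> [phil phie] x0n; pose p : 'Hom(EM, E) := linfun phi.
have pE x : p x = phi x by rewrite linfunE.
have [_ _ [_ /(_ (lker p)) irr]] := sM_irrep.
have k0 : lker p == 0%VS.
  case: irr => [k kM|->|k1]; rewrite ?eqxx //.
    apply/subvP => _ /memv_imgP[y + ->]; rewrite !memv_ker !pE phie // => /eqP->.
    by rewrite linear0.
  have : x0 \in lker p by rewrite k1 memvf.
  by rewrite memv_ker pE (negPf x0n).
exists (p^-1)%VF => [|x]; first exact: lfun_lin.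
by rewrite -pE -comp_lfunE lker0_compVf // id_lfunE.
Qed.

Lemma spin_actM_lin k : WM M k.2 -> linear (A k).
Proof. by move=> kM; apply: tm_linear; apply: (actM_lin PM_module); exact: HM_W. Qed.

Lemma spin_actM_mul k k' x : WtM k -> WtM k' ->
  A (k.1 * k'.1, (k.2 \o k'.2)%VF) x = A k (A k' x).
Proof.
move=> [_ wM _] [_ wM' _]; rewrite !spin_actME tm_comp.
- apply: eq_tm => y /=; last by have [_ -> _] := rhoM_module; rewrite comp_lfunE.
  by rewrite hWM ?(WM_weyl wM) ?(WM_weyl wM') // (actMM PM_module) //; exact: HM_W.
- by apply: (actM_lin PM_module); exact: HM_W.
- exact: lfun_lin.
- by apply: (actM_lin PM_module); exact: HM_W.
- exact: lfun_lin.
Qed.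

Lemma spin_actM_opp a w x : A (- a, w) x = - A (a, w) x.
Proof.
rewrite !spin_actME /= -[RHS]scaleN1r -[RHS]tmZr; apply: eq_tm => // y.
by rewrite cl_moduleN // opp_lfunE scaleN1r.
Qed.

Definition pin_liftM (w : 'End(rV X)) : ClM :=
  if pselect (exists a, WtM (a, w)) is left e then sval (cid e) else 1.

Lemma pin_liftMP w : WM M w -> WtM (pin_liftM w, w).
Proof.
rewrite /pin_liftM; case: pselect => [e _|n /(WtM_exists ClM) e]; last by case: n.
exact: svalP (cid e).
Qed.

Lemma genuine_opp k x : Wt k -> s (- k.1) x = - s k.1 x.
Proof.
move=> kW; rewrite -[- k.1]mulN1r -[RHS]s_genuine.
exact: (s_mul s_irrep _ (Wt_opp (Wt1 Cl)) kW).
Qed.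

(* [phi] has a linear retraction [psi]; averaging [f \o psi] over the lifts of
   W_M gives an equivariant map whose composite with [phi] is a multiple of [f]. *)
Lemma extend_hom (f : EM -> tens PM SM) :
  intertwiner WtM (fun k => sM k.1 : _ -> _) A f -> (exists x, f x != 0) ->
  hom_neq0 WtM (fun k => sM k.1 : _ -> _) (fun k => s (j k.1) : _ -> _) ->
  hom_neq0 WtM (fun k => s (j k.1) : _ -> _) A.
Proof.
move=> [fl fe] [y0 fy0] [phi hphi [x0 phi0]]; have [phil phie] := hphi.
have [psi psil psiK] := irrep_hom_inj hphi phi0.
pose t a w x := A (a, w) (f (psi (s (j (tr ClM a)) x))).
have t_lift a c w x : WtM (a, w) -> WtM (c, w) -> t a w x = t c w x.
  move=> aW cW; case: (WtM_uniq aW cW) => [-> //|->].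
  rewrite /t spin_actM_opp !linearN /=.
  rewrite (genuine_opp _ (WtM_Wt jE (WtM_inv cW))) (linN psil) (linN fl).
  by rewrite (linN (spin_actM_lin _)) ?opprK //; case: cW.
pose g x := \sum_(w <- W | `[< WM M w >]) t (pin_liftM w) w x.
have tl a w : WM M w -> linear (t a w).
  move=> wM; apply: linear_comp; first exact: spin_actM_lin.
  by apply: linear_comp fl _; apply: linear_comp psil (lfun_lin _).
exists g; last first.
  exists (phi y0); have -> : g (phi y0) = (ordM M)%:R *: f y0.
    rewrite /g; transitivity (\sum_(w <- W | `[< WM M w >]) f y0).
      apply: eq_bigr => w /asboolP wM; have lM := pin_liftMP wM.
      rewrite /t -(phie _ (WtM_inv lM)) psiK -(fe _ lM).
      have [s1 sm _] := sM_irrep; rewrite -comp_lfunE -(sm _ _ lM (WtM_inv lM)) /=.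
      by have [[/= -> _ _] _ _] := lM; rewrite s1 id_lfunE.
    by rewrite big_const_seq iter_addr_0 -/(ordM M) scaler_nat.
  by rewrite scaler_eq0 negb_or fy0 andbT pnatr_eq0 -lt0n ordM_gt0.
split=> [|k kM x].
  move=> c x y; rewrite scaler_sumr -big_split; apply: eq_bigr => w /asboolP wM /=.
  exact: tl.
have [[_ kk _] k2M _] := kM; have k2W := WM_weyl k2M.
rewrite /g (lin_sum (spin_actM_lin k2M)) big_mkcond -(sum_weyl_mull _ k2W) [RHS]big_mkcond.
apply: eq_bigr => w _; have -> : `[< WM M (k.2 \o w)%VF >] = `[< WM M w >].
  by apply: asbool_equiv_eq; exact: WM_mull.
case: asboolP => // wM; have lM := pin_liftMP wM; have kl := WtM_mul kM lM.
rewrite (t_lift _ _ _ _ (pin_liftMP (WMM k2M wM)) kl) /t /= (spin_actM_mul _ kM lM).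
congr (A k (A _ (f (psi _)))).
have /= <- := s_mul s_irrep x (WtM_Wt jE (WtM_inv kl)) (WtM_Wt jE kM).
by rewrite -rmorphM trM -mulrA kk mulr1.
Qed.

End ExtendM.

Section Unitary.
Variables (R : realType) (X : rootData R) (H : hecke X) (M : subsystem X).
Notation C := R[i].
Notation hW := (hW H).
Notation hS := (hS H).
Notation HM := (hecke_sub (H := H) (WM M)).
Variables (PM : lmodType C) (actM : H -> PM -> PM) (PM_module : is_module HM actM).
Variable star : H -> H.
Hypothesis star_star : is_star (WM M) (posrootsM M) star.

(** The reflection sum is fixed by the star, reflections being involutions with real coefficients.
    Subtracting half of it splits the sum in the star of a vector evenly. *)
Lemma star_wtilde v : star (wtilde H (posrootsM M) v) = - wtilde H (posrootsM M) v.
Proof.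
have [_ sL _ sW sV] := star_star.
set sg := \sum_(b <- posrootsM M) (pr v (cor b))%:C *: hW (srefl b).
have HM0' : HM 0 by exact: HM0.
have s0 : star 0 = 0.
  by have := sL (-1) 0 0 HM0' HM0'; rewrite scaler0 addr0 rmorphN rmorph1 scaleN1r addNr.
have ssg : star sg = sg.
  rewrite /sg; have : {subset posrootsM M <= posrootsM M} by [].
  elim: {1 3 4}(posrootsM M) => [|b r IH] br; first by rewrite !big_nil.
  have br' : {subset r <= posrootsM M} by move=> c cr; apply: br; rewrite inE cr orbT.
  have bM : b \in posrootsM M by apply: br; rewrite inE eqxx.
  rewrite !big_cons sL ?IH ?sW //.
  - have bR : b \in allroots X by move: bM; rewrite mem_posrootsM => /andP[_ /M_roots].
    rewrite -(weylV_uniq (weyl_refl bR) (sreflK bR)) conj_Creal //.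
    by apply/complex_realP; exists (pr v (cor b)).
  - exact: WM_posrootsM.
  - by apply: HM_W; exact: WM_posrootsM.
  - by apply: HM_sum => c cr; apply/HM_scale/HM_W/WM_posrootsM/br'.
rewrite /wtilde -/sg [_ - _]addrC -scaleNr sL ?ssg ?sV -/sg; last exact: hecke_subS.
  have -> : (- (2^-1 : C))^*%R = - 2^-1 by rewrite rmorphN fmorphV rmorph_nat.
  rewrite addrCA opprD addrC; congr (_ + _).
  rewrite scaleNr opprK; apply/eqP; rewrite addrC subr_eq -scalerDl -div1r.
  by rewrite -splitr scale1r.
exact: HM_reflsum.
Qed.

Lemma wtildeM_skew (form : PM -> PM -> C) :
  hermitian_form form ->
  (forall h, HM h -> forall x y, form (actM h x) y = form x (actM (star h) y)) ->
  forall v, skew_op form (actM (wtilde H (posrootsM M) v)).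
Proof.
move=> hf adj v x y; have wM := HM_wtM H M v; rewrite (adj _ wM) star_wtilde.
by rewrite -scaleN1r (actMZ PM_module) // scaleN1r (hNr hf).
Qed.

End Unitary.

Section DiracInduced.
Variables (R : realType) (X : rootData R) (H : hecke X).
Notation C := R[i].
Variables (Cl : clifford (@ip R X)) (P : lmodType C) (act : H -> P -> P).
Hypothesis act_module : is_module (fun=> True) act.
Variables (S : vectType C) (rho : Cl -> 'End(S)) (rho_module : cl_module rho).
Variables (n : nat) (b b' : 'I_n -> rV X) (bb : expanding (@ip R X) b b').
Variables (E : vectType C) (s : Cl -> 'End(E)) (s_irrep : spin_irrep s).
Hypothesis s_genuine : genuine s.
Notation D := (dirac act rho b b').
Notation homWt := (homWt act rho s).

(** Each product of two lifted reflections is carried through [F]; the minus sign is that of the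
    central element in [Omega], which acts by -1 on a genuine representation. *)
Lemma Gam_sqr_hom F x : homWt F -> Gam act rho (Gam act rho (F x)) = - F (Omega s x).
Proof.
move=> [Fl Fe]; rewrite (Gam_sqr act_module rho_module) /Omega (lin_sum Fl) -sumrN !big_seq.
apply: eq_bigr => a; rewrite mem_posroots => /andP[_ aR].
rewrite (lin_sum Fl) -sumrN big_seq_cond [RHS]big_seq_cond; apply: eq_bigr => c.
rewrite mem_posroots => /andP[/andP[_ cR] _].
rewrite (linZ Fl) -scalerN; congr (_ *: _); rewrite -(linN Fl).
have aW := Wt_stilde Cl aR; have cW := Wt_stilde Cl cR; have acW := Wt_mul aW cW.
rewrite mulN1r (genuine_opp s_irrep s_genuine _ acW) opprK (Fe _ acW) /=.
by rewrite -hWM //; exact: weyl_refl.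
Qed.

Lemma dirac_sqr_hom F h x : homWt F -> central_char act (2^-1 *: h) ->
  Omega s x = ipdC h h *: x -> D (D (F x)) = 0.
Proof.
move=> hF cc Ox; rewrite (dirac_sqr act_module rho_module bb) (Gam_sqr_hom _ hF) Ox.
have [Fl _] := hF; rewrite (linZ Fl) -/(op act rho).
have -> : op act rho (hS H (casimir b b')) 1 (F x) = (4^-1 * ipdC h h) *: F x.
  rewrite -[in RHS](tm_id (F x)) -[RHS]tmZl; apply: eq_tm => y.
    rewrite cc ?(evalC_casimir bb) ?ipdCZ; last by move=> w; exact: casimir_wact.
    by rewrite expr2 -invfM -natrM.
  exact: (rho1E rho_module).
by rewrite scalerN opprK scalerA addNr.
Qed.

End DiracInduced.

Lemma spinor_dim_gt0 (R : realType) (V : vectType R) (q : V -> V -> R) (A : clifford q)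
    (S : vectType R[i]) (rho : A -> 'End(S)) : is_spinor rho -> (0 < \dim {:S})%N.
Proof.
rewrite /is_spinor; case: ifP => _; first by case=> _ [].
case=> _ [S1 [S2 [r1 [r2 [f1 [f2 [[_ [d1 _]] _ _ _ /bij_inj bij]]]]]]].
rewrite lt0n; apply: contraTneq d1 => /eqP; rewrite dimv_eq0 => /eqP S0.
have z (x : S) : x = 0 by apply/eqP; rewrite -memv0 -S0 memvf.
rewrite -eqn0Ngt dimv_eq0 -subv0; apply/subvP => x _; rewrite memv0; apply/eqP.
by have [] : (x, 0 : S2) = (0, 0) by apply: bij; rewrite [LHS]z [RHS]z.
Qed.

Theorem lemma2p6p2 (R : realType) (X : rootData R) (H : hecke X)
    (M : subsystem X)
    (Cl : clifford (@ip R X)) (ClM : clifford (@ipM R X M))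
    (* the inclusion of C(V_M) in C(V) *)
    (j : {lrmorphism ClM -> Cl})
    (jE : forall v, j (gam ClM v) = gam Cl (vsval v))
    (S : vectType R[i]) (rho : Cl -> 'End(S)) (rho_spinor : is_spinor rho)
    (SM : vectType R[i]) (rhoM : ClM -> 'End(SM))
    (rhoM_spinor : is_spinor rhoM)
    (n : nat) (b b' : 'I_n -> rV X) (b_dual : dual_bases (@ip R X) b b')
    (m : nat) (bM bM' : 'I_m -> subvs_of (VM M))
    (bM_dual : dual_bases (@ipM R X M) bM bM')
    (* pi_M and pi *)
    (PM : lmodType R[i]) (actM : H -> PM -> PM)
    (PM_module : is_module (hecke_sub (H := H) (WM M)) actM)
    (P : lmodType R[i]) (act : H -> P -> P) (tau : H -> PM -> P)
    (P_induced : is_induced (hecke_sub (H := H) (WM M)) actM act tau) :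
  (forall (E : vectType R[i]) (s : Cl -> 'End(E)), spin_irrep s ->
     exists2 r : nat, r%:R = (\dim {:S})%:R / (\dim {:SM})%:R :> rat &
     forall J : Type,
       has_dim (intertwiner (@WtM R X M ClM)
                  (fun k => s (j k.1) : _ -> _) (spin_actM actM rhoM)) J ->
       has_dim (intertwiner (@Wt R X Cl)
                  (fun k => s k.1 : _ -> _) (spin_act act rho)) ('I_r * J))
  /\
  (<<allroots X>>%VS = fullv ->
   forall (g : lieAlg X) (Psi : Psi_map g Cl), is_Psi Psi ->
   unitary (WM M) (posrootsM M) actM ->
   forall (EM : vectType R[i]) (sM : ClM -> 'End(EM)),
     spin_irrepM sM -> occurs_in_HDM sM actM rhoM bM bM' ->
   forall (E : vectType R[i]) (s : Cl -> 'End(E)),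
     spin_irrep s -> genuine s ->
     hom_neq0 (@WtM R X M ClM)
       (fun k => sM k.1 : _ -> _) (fun k => s (j k.1) : _ -> _) ->
     (forall (e : g) (h : cplx R (rVd X)) (f : g), Psi E s e h f ->
        central_char act (2^-1 *: h)) ->
     occurs_in_HD s act rho b b').
Proof.
have rhoMm := is_spinor_module rhoM_spinor; have rhom := is_spinor_module rho_spinor.
have [r rs] : exists r, restricted_sum j rhoM rho r.
  apply: (spinor_restriction (@ipM_scalar R X M) (@ipM_sym R X M) (@ipM_pos R X M)
    (@ip_scalar R X) (@ip_sym R X) (@ip_pos R X) (incl := vsval : {linear _ -> _})) => //.
have dimE := restricted_sum_dim rs.
split=> [E s s_irrep|_ g Psi [[PsiE _] _ PsiO _ _] [star [form [starM fl fh fp adj]]]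
    EM sM sM_irrep occ E s s_irrep s_gen hom cc].
  exists r; last exact: (induced_has_dim jE PM_module P_induced rhom s_irrep rs).
  rewrite -dimE natrM mulfK // pnatr_eq0 -lt0n; exact: spinor_dim_gt0 rhoM_spinor.
have hf : hermitian_form form by split.
have skM := wtildeM_skew PM_module starM hf adj.
have [f [fL fD fe [y fy]]] := occ.
have DM_sq0 z : diracM actM rhoM bM bM' (diracM actM rhoM bM bM' z) = 0 ->
    diracM actM rhoM bM bM' z = 0.
  apply: (dirac_sq0 (@ipM_scalar R X M) (@ipM_sym R X M) (@ipM_pos R X M) hf rhoMm
    (f := fun i => actM (wtilde H (posrootsM M) (vsval (bM i)))) _ _) => // i.
  by apply: (actM_lin PM_module); exact: HM_wtM.
(* Equivariance is given only modulo the intersection of kernel and image. By [DM_sq0] that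
   intersection is zero, so it holds exactly. *)
have f_hom : intertwiner (@WtM R X M ClM) (fun k => sM k.1 : _ -> _) (spin_actM actM rhoM) f.
  split=> // k kM x; apply/eqP; rewrite -subr_eq0; apply/eqP.
  have [D0 [z zE]] := fe k kM x; rewrite zE; apply: DM_sq0; by rewrite -zE.
have f_neq0 : exists x, f x != 0.
  exists y; apply/eqP => f0; apply: fy; split; first exact: fD.
  exists 0; rewrite f0 /diracM big1 // => i _; apply: lin0; apply: tm_linear.
  by apply: (actM_lin PM_module); exact: HM_wtM.
have [f1 f1_hom [y1 f1y]] := extend_hom jE PM_module rhoMm sM_irrep s_irrep s_gen f_hom f_neq0 hom.
have r0 : (0 < r)%N.
  by have := spinor_dim_gt0 rho_spinor; rewrite -dimE muln_gt0 => /andP[].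
have [iota [pi [iotaR _ pi_iota _]]] := rs; pose t0 := Ordinal r0.
(* One copy of [SM] inside [S] is enough, and there is one because [r] is positive. *)
pose f2 x := tm (@idfun PM) (iota t0) (f1 x).
have f2_hom : homWtM j actM rho s f2 by apply: tm_spin_up.
have f2y : f2 y1 != 0.
  apply: contra_neq f1y => f20.
  have <- : tm (@idfun PM) (pi t0) (f2 y1) = f1 y1.
    rewrite tm_comp //; [|exact: lfun_lin|exact: lfun_lin].
    rewrite -[RHS]tm_id; apply: eq_tm => // z /=.
    by rewrite -comp_lfunE pi_iota eqxx id_lfunE.
  by rewrite f20; apply: lin0; apply: tm_linear; exact: idfun_lin.
pose F := frob M act tau rho s f2.
have F_hom : homWt act rho s F := frob_hom jE PM_module P_induced rhom s_irrep f2_hom.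
have Fy : F y1 != 0.
  apply: contra_neq f2y => Fy0.
  rewrite -(proj_frob jE PM_module P_induced rhom s_irrep y1 f2_hom) -/(F y1) Fy0.
  exact: (lin0 (proj_tens_lin PM_module P_induced (S := S))).
have act_module : is_module (fun=> True) act by case: P_induced.
have bb := dual_expanding (@ip_scalar R X) (@ip_sym R X) (@ip_pos R X) b_dual.
have Dlin := dirac_lin act_module rho b b'.
have D_sq0 z : dirac act rho b b' (dirac act rho b b' z) = 0 -> dirac act rho b b' z = 0.
  apply: (dirac_sq0 (@ip_scalar R X) (@ip_sym R X) (@ip_pos R X)
    (formP_hermitian PM_module P_induced hf) rhom
    (f := fun i => act (wtilde H (posroots X) (b i)))).
    by move=> i; exact: (act_lin P_induced).
  by move=> i; exact: formP_wtilde.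
have [e [h [k [_ PsiEE]]]] := PsiE E s s_irrep s_gen.
(* The representing triple belongs to its own class, via the identity automorphism. *)
have Psih : Psi E s e h k by apply/PsiEE; exists id => //; exact: inner1.
have DF x : dirac act rho b b' (F x) = 0.
  apply/D_sq0/(dirac_sqr_hom act_module rhom bb s_irrep s_gen F_hom (cc _ _ _ Psih)).
  exact: (PsiO E s e h k s_irrep s_gen Psih).
have [Fl Fe] := F_hom; exists F; split=> [//|//|u uW x|].
  by rewrite Fe // subrr (lin0 Dlin); split=> //; exists 0; rewrite (lin0 Dlin).
(* An element of the image killed by D has a preimage killed by the square of D, hence by D itself,
   so it is zero; but [F y1] is not. *)
exists y1 => -[_ [z zE]]; move: Fy; rewrite zE D_sq0 ?eqxx //.
by rewrite -zE.
Qed.
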